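(* Assume $\beta\in\mathbb{C}^d$ is generic and let $w$ be a weight vector for $H_A(\beta)$. The dimension of the space of Nilsson solutions of $H_A(\beta)$ in the direction of $w$ is \[ \dim_{\mathbb{C}}\bigl(\mathscr{N}_w(H_A(\beta))\bigr)=\sum_{\substack{\sigma\text{ facet of }\Delta_{(0,w)}\\ \text{such that }0\in\sigma}}\mathrm{vol}(\sigma). \]
   Context: Hypergeometric systems. $\mathbb{N}=\{0,1,2,\dots\}$. $A=[a_{ij}]\in\mathbb{Z}^{d\times n}$ is a matrix whose columns $a_1,\dots,a_n$ generate $\mathbb{Z}^d$ as a group, and $\beta\in\mathbb{C}^d$. $D$ is the complex Weyl algebra in $x_1,\dots,x_n,\partial_1,\dots,\partial_n$; $I_A=\langle \partial^u-\partial^v\mid u,v\in\mathbb{N}^n,\ Au=Av\rangle\subseteq\mathbb{C}[\partial_1,\dots,\partial_n]$; $E_i=\sum_{j}a_{ij}x_j\partial_j$; $\langle E-\beta\rangle=\langle E_1-\beta_1,\dots,E_d-\beta_d\rangle$; $H_A(\beta)=D\cdot I_A+\langle E-\beta\rangle$. $\ker_{\mathbb{Z}}(A)=\{u\in\mathbb{Z}^n: Au=0\}$. Weight vectors. For $w\in\mathbb{R}^n$, the $(-w,w)$-weight of $x^u\partial^v$ is $-w\cdot u+w\cdot v$; the initial form of a nonzero $f\in D$ is the sum of its terms of maximal weight; $\mathrm{in}_{(-w,w)}(J)$ is the left ideal generated by the initial forms of nonzero elements of a left ideal $J$. Similarly $\mathrm{in}_w(J)$ for an ideal $J\subseteq\mathbb{C}[\partial]$,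 where $\partial^v$ has weight $w\cdot v$. A vector $w\in\mathbb{R}^n_{>0}$ is a weight vector for $H_A(\beta)$ if there is a strongly convex open rational polyhedral cone $\mathscr{C}\subset\mathbb{R}^n_{>0}$ containing $w$ such that for all $w'\in\mathscr{C}$: $\mathrm{in}_w(I_A)=\mathrm{in}_{w'}(I_A)$ and $\mathrm{in}_{(-w,w)}(H_A(\beta))=\mathrm{in}_{(-w',w')}(H_A(\beta))$. Then $\mathrm{in}_w(I_A)$ is a monomial ideal. When $(1,\dots,1)$ lies in the rational row span of the matrix, the positivity requirements are dropped. $\mathscr{C}^*=\{u\in\mathbb{R}^n: u\cdot w'\ge 0\ \forall w'\in\mathscr{C}\}$. Nilsson series. A basic Nilsson solution of $H_A(\beta)$ in the direction of $w$ is a formal solution of $H_A(\beta)$ of the form $\phi=\sum_{u\in C}x^{v+u}p_u(\log x_1,\dots,\log x_n)$, with $v\in\mathbb{C}^n$, such that: (1) $C\subseteq\mathscr{C}^*\cap\ker_{\mathbb{Z}}(A)$ for some strongly convex open rational polyhedral cone $\mathscr{C}\ni w$ (contained in $\mathbb{R}^n_{>0}$ unless $(1,\dots,1)$ lies in the rational row span of the matrix) such that $\mathrm{in}_w(I_A)=\mathrm{in}_{w'}(I_A)$ and $\mathrm{in}_{(-w,w)}(H_A(\beta))=\mathrm{in}_{(-w',w')}(H_A(\beta))$ for all $w'\in\mathscr{C}$; (2) the $p_u$ are polynomials with degrees bounded by a common integer; (3) $p_0\neq0$. $\mathscr{N}_w(H_A(\beta))$ is the $\mathbb{C}$-span of the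 basic Nilsson solutions in the direction of $w$. Genericity. A standard pair of a monomial ideal $I\subseteq\mathbb{C}[\partial_1,\dots,\partial_n]$ is a pair $(\partial^\alpha,\sigma)$ with $\alpha\in\mathbb{N}^n$, $\sigma\subseteq\{1,\dots,n\}$, such that $\alpha+\mathbb{C}^\sigma$ is an irreducible component of the Zariski closure of $\{u\in\mathbb{N}^n:\partial^u\notin I\}$ and $\alpha$ is the coordinatewise minimal element of $(\alpha+\mathbb{C}^\sigma)\cap\mathbb{N}^n$, where $\mathbb{C}^\sigma=\{t: t_i=0\text{ for }i\notin\sigma\}$. It is top-dimensional if the corresponding associated prime $\langle\partial_i:i\notin\sigma\rangle$ is minimal. $\mathrm{top}(I)=\bigcap\langle\partial_i^{\alpha_i+1}\mid i\notin\sigma\rangle$ over the top-dimensional standard pairs. An exponent of $H_A(\beta)$ with respect to $w$ is $v\in\mathbb{C}^n$ such that $x^v$ is a solution of $\mathrm{in}_{(-w,w)}(H_A(\beta))$. ''$\beta$ generic'' means: (i) $\mathrm{in}_{(-w,w)}(H_A(\beta))=\mathrm{top}(\mathrm{in}_w(I_A))+\langle E-\beta\rangle$, so each exponent $v$ comes from a top-dimensional standard pair $(\partial^\alpha,\sigma)$ of $\mathrm{in}_w(I_A)$, i.e. $Av=\beta$ and $v_i=\alpha_i$ for $i\notin\sigma$; (ii) for each such exponent, $v_i\notin\mathbb{Z}$ for $i\in\sigma$; (iii) no two distinct exponents differ by an integer vector. Triangulation. $\rho(A)\in\mathbb{Z}^{(d+1)\times(n+1)}$ is obtained from $A$ by attaching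 a column of zeros on the left and then a top row of ones; its columns are indexed by $0,1,\dots,n$. $\Delta_{(0,w)}$ is the coherent (regular) subdivision of the configuration of columns of $\rho(A)$ obtained by lifting the $i$-th column to the $i$-th coordinate of $(0,w)$ and projecting the lower hull; it is written as a simplicial complex on $\{0,\dots,n\}$. Standing assumption: for $\beta_0\in\mathbb{C}$ a homogenizing value ($\beta_0\notin\mathbb{Z}$ and $\beta_0-\sum_iv_i\notin\mathbb{Z}$ for all $v$ with $x^v$ a solution of $\mathrm{in}_w(I_A)+\langle E-\beta\rangle$), $(0,w)$ is a weight vector for $H_{\rho(A)}(\beta_0,\beta)$; this implies that $\Delta_{(0,w)}$ is a triangulation. $\mathrm{vol}(\sigma)$ is the normalized volume of the simplex spanned by the columns of $\rho(A)$ indexed by $\sigma$ (a unimodular simplex of the lattice has volume 1). *)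

(* Defs.v *)
From HB Require Import structures.
From mathcomp Require Import all_boot all_order all_algebra.
From mathcomp Require Import mpoly complex.
From mathcomp Require Import boolp reals.

Set Implicit Arguments.
Unset Strict Implicit.
Unset Printing Implicit Defensive.

Import Order.TTheory GRing.Theory Num.Theory.

Local Open Scope ring_scope.

Section Ideals.
Variable R : nzRingType.
Implicit Types I J S : R -> Prop.

(* For commutative R these are the ideals. *)
Definition left_ideal J :=
  [/\ J 0, forall p q, J p -> J q -> J (p + q) & forall p q, J q -> J (p * q)].

Definition ideal_gen S : R -> Prop :=
  fun p => forall J, left_ideal J -> (forall q, S q -> J q) -> J p.

Definition same_ideal I J := forall p, I p <-> J p.
End Ideals.

Section PrimeIdeals.
Variable R : comNzRingType.
Implicit Types I J P : R -> Prop.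

Definition prime_ideal P :=
  [/\ left_ideal P, ~ P 1 & forall p q, P (p * q) -> P p \/ P q].

Definition minimal_prime I P :=
  [/\ prime_ideal P, (forall p, I p -> P p) &
      forall Q, prime_ideal Q -> (forall p, I p -> Q p) ->
        (forall p, Q p -> P p) -> forall p, P p -> Q p].
End PrimeIdeals.

Section MonomialOperator.
Variables (n : nat) (V : Type) (X D : 'I_n -> V -> V).

(* A monomial m in n + n variables stands for x^u \partial^v, where u is given
   by the first n entries of m and v by the last n. *)
Definition monomial_op (m : 'X_{1..n + n}) (x : V) : V :=
  foldr (fun i => iter (m (lshift n i)) (X i))
    (foldr (fun i => iter (m (rshift n i)) (D i)) x (enum 'I_n)) (enum 'I_n).
End MonomialOperator.

Section NormalOrdering.
Variables (n : nat) (K : comNzRingType).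
Local Notation S := {mpoly K[n + n]}.
Implicit Types (p q r : S) (i j : 'I_n) (m : 'X_{1..n + n}).

(* In a polynomial in n + n commuting variables, the first n variables stand for
   x_1, ..., x_n and the last n for \partial_1, ..., \partial_n, each monomial
   being normally ordered. Composition on the left with x_i and \partial_i is
   [weyl_lx] and [weyl_ld], by \partial_i f = f \partial_i + df/dx_i. *)
Definition weyl_lx i p : S := 'X_(lshift n i) * p.
Definition weyl_ld i p : S := 'X_(rshift n i) * p + p^`M(lshift n i).

Definition weyl_mul p q : S :=
  \sum_(m <- msupp p) p@_m *: monomial_op weyl_lx weyl_ld m q.


Local Notation op := (monomial_op weyl_lx weyl_ld).
Local Notation "p ** q" := (weyl_mul p q) (at level 40, left associativity).

Let xpart m := [multinom (if split i is inl j then m (lshift n j) else 0%N) | i < n + n].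
Let ldm (e : 'I_n -> nat) (s : seq 'I_n) q :=
  foldr (fun i => iter (e i) (weyl_ld i)) q s.

Let weyl_ld_is_linear i : linear (weyl_ld i).
Proof.
move=> c p q; rewrite /weyl_ld mulrDr mderivD mderivZ -scalerAr.
by rewrite addrACA scalerDr.
Qed.

Fact weyl_ldC i j p : weyl_ld i (weyl_ld j p) = weyl_ld j (weyl_ld i p).
Proof.
have dX (k l : 'I_n) : ('X_(rshift n k) : S)^`M(lshift n l) = 0.
  by rewrite mderivX mnm1E eq_sym eq_lrshift scale0r.
rewrite /weyl_ld !mderivD !mderivM !dX !mul0r !add0r !mulrDr (mderiv_comm _ _ p).
rewrite !mulrA [X in X * p]mulrC -!addrA; congr (_ + _).
by rewrite !addrA; congr (_ + _); rewrite addrC.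
Qed.

Let ldm_linear e s : linear (ldm e s).
Proof.
move=> c p q; elim: s => //= i s ->.
by elim: (e i) => //= k ->; rewrite weyl_ld_is_linear.
Qed.

Let ldmC i e s q : weyl_ld i (ldm e s q) = ldm e s (weyl_ld i q).
Proof.
elim: s => //= j s IH; rewrite -IH.
by elim: (e j) => //= k IHk; rewrite weyl_ldC IHk.
Qed.

Let ldmS i e s q : uniq s ->
  ldm (fun j => e j + (i == j))%N s q =
  if i \in s then weyl_ld i (ldm e s q) else ldm e s q.
Proof.
elim: s => //= j s IH /andP[js us]; rewrite inE IH //.
have [->|ij] /= := eqVneq i j; first by rewrite (negbTE js) addn1.
rewrite addn0; case: ifP => // _.
by elim: (e j) => //= k ->; rewrite weyl_ldC.
Qed.

Let opE m q :
  op m q = 'X_[xpart m] * ldm (fun i => m (rshift n i)) (enum 'I_n) q.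
Proof.
rewrite /monomial_op -/(ldm _ _ q); set y := ldm _ _ q.
have -> : foldr (fun i => iter (m (lshift n i)) (weyl_lx i)) y (enum 'I_n)
    = (\prod_(i <- enum 'I_n) 'X_(lshift n i) ^+ m (lshift n i)) * y.
  elim: (enum 'I_n) => [|i s IH] /=; first by rewrite big_nil mul1r.
  rewrite big_cons IH -mulrA; set z := _ * y.
  elim: (m _) => [|k IHk] /=; first by rewrite mul1r.
  by rewrite IHk exprS /weyl_lx mulrA.
congr (_ * _); rewrite [RHS]mpolyXE_id big_split_ord /= [X in _ * X]big1 ?mulr1.
  rewrite big_enum; apply: eq_bigr => i _; rewrite mnmE.
  by case: splitP => [j /= /ord_inj <-|k /= /eqP] //; rewrite ltn_eqF // ltn_addr.
move=> i _; rewrite mnmE; case: splitP => [j /= /eqP|k _] //.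
by rewrite gtn_eqF // ltn_addr.
Qed.

Let op_linear m : linear (op m).
Proof. by move=> c p q; rewrite !opE ldm_linear mulrDr scalerAr. Qed.

Let weyl_mulE k p q : (msize p <= k)%N ->
  p ** q = \sum_(m : 'X_{1..(n + n) < k}) p@_m *: op m q.
Proof.
move=> le_pk; pose I : subFinType _ := 'X_{1..(n + n) < k}.
rewrite /weyl_mul (ssrcomplements.big_mksub I) /=; first last.
- by move=> m /msize_mdeg_lt /leq_trans; apply.
- by rewrite msupp_uniq.
by rewrite big_rmcond //= => i /memN_msupp_eq0 ->; rewrite scale0r.
Qed.

Let weyl_mul_linl q : linear (weyl_mul ^~ q).
Proof.
move=> c p r; pose k := (maxn (msize (c *: p + r)) (maxn (msize p) (msize r))).
rewrite !(@weyl_mulE k) ?leq_max ?leqnn ?orbT // scaler_sumr -big_split /=.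
by apply: eq_bigr => m _; rewrite mcoeffD mcoeffZ scalerDl scalerA.
Qed.

Let weyl_mul_linr p : linear (weyl_mul p).
Proof.
move=> c q r; rewrite /weyl_mul scaler_sumr -big_split /=.
by apply: eq_bigr => m _; rewrite op_linear scalerDr !scalerA mulrC.
Qed.

Let linearD' (f : S -> S) : linear f -> {morph f : p q / p + q}.
Proof. by move=> lf p q; rewrite -[p]scale1r lf !scale1r. Qed.

Let linear0' (f : S -> S) : linear f -> f 0 = 0.
Proof. by move=> lf; have := lf (-1) 0 0; rewrite scaler0 addr0 scaleN1r addNr. Qed.

Let linearZ' (f : S -> S) c p : linear f -> f (c *: p) = c *: f p.
Proof. by move=> lf; rewrite -[X in f X]addr0 lf linear0' // addr0. Qed.

Fact weyl_mulX m q : 'X_[m] ** q = op m q.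
Proof. by rewrite /weyl_mul msuppX big_seq1 mcoeffX eqxx scale1r. Qed.

Let eq_linear (f g : S -> S) : linear f -> linear g ->
  (forall m, f 'X_[m] = g 'X_[m]) -> f =1 g.
Proof.
move=> lf lg fg; elim/mpolyind => [|c m p _ _ IH]; first by rewrite !linear0'.
by rewrite lf lg fg IH.
Qed.

Fact weyl_mul_lx i p q : weyl_lx i p ** q = weyl_lx i (p ** q).
Proof.
apply: (eq_linear (f := fun p => weyl_lx i p ** q) (g := fun p => weyl_lx i (p ** q))).
- by move=> c r s; rewrite /weyl_lx mulrDr -scalerAr weyl_mul_linl.
- by move=> c r s; rewrite /weyl_lx weyl_mul_linl mulrDr -scalerAr.
move=> m; rewrite {1}/weyl_lx -mpolyXD !weyl_mulX !opE /weyl_lx mulrA -mpolyXD.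
congr ('X_[_] * _).
  apply/mnmP => j; rewrite mnmDE !mnmE; case: splitP => k /= jk.
    by rewrite mnmDE mnm1E; congr (nat_of_bool _ + _)%N; rewrite -!val_eqE /= jk.
  by rewrite addn0; case: eqP => // /(congr1 val) /= /eqP; rewrite jk ltn_eqF // ltn_addr.
congr foldr; apply/funext => j; congr iter.
by rewrite mnmDE mnm1E eq_lrshift.
Qed.

Fact weyl_mul_ld i p q : weyl_ld i p ** q = weyl_ld i (p ** q).
Proof.
apply: (eq_linear (f := fun p => weyl_ld i p ** q) (g := fun p => weyl_ld i (p ** q))).
- by move=> c r s; rewrite weyl_ld_is_linear weyl_mul_linl.
- by move=> c r s; rewrite weyl_mul_linl weyl_ld_is_linear.
move=> m; rewrite {1}/weyl_ld -mpolyXD mderivX addrC weyl_mul_linl !weyl_mulX !opE.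
set e := fun j => m _; set s := enum _.
have -> : xpart (U_(rshift n i) + m) = xpart m.
  apply/mnmP => j; rewrite !mnmE; case: splitP => // k jk.
  by rewrite mnmDE mnm1E eq_sym eq_lrshift.
have -> : ldm (fun j => (U_(rshift n i) + m)%MM (rshift n j)) s q =
          weyl_ld i (ldm e s q).
  have := @ldmS i e s q (enum_uniq _); rewrite mem_enum inE => <-.
  congr foldr; apply/funext => j; congr iter.
  by rewrite mnmDE mnm1E addnC; congr (_ + nat_of_bool _)%N; rewrite eq_rshift.
have -> : ldm (fun j => (m - U_(lshift n i))%MM (rshift n j)) s q = ldm e s q.
  congr foldr; apply/funext => j; congr iter.
  by rewrite mnmBE mnm1E eq_lrshift subn0.
have -> : xpart (m - U_(lshift n i)) = (xpart m - U_(lshift n i))%MM.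
  apply/mnmP => j; rewrite mnmBE !mnmE; case: splitP => // k jk.
  by rewrite mnmBE mnm1E; congr (_ - nat_of_bool _)%N; rewrite -!val_eqE /= jk.
set y := ldm e s q; rewrite /weyl_ld mderivM mderivX.
have -> : xpart m (lshift n i) = m (lshift n i).
  rewrite mnmE; case: splitP => [j /= /ord_inj <- //|k /= /eqP].
  by rewrite ltn_eqF // ltn_addr.
by rewrite mulrDr -!scalerAl addrCA mulrCA.
Qed.

Let weyl_mul_op m p q : op m p ** q = op m (p ** q).
Proof.
rewrite /monomial_op.
set y := foldr _ p _; set z := foldr _ (p ** q) _.
have <- : y ** q = z.
  rewrite /y /z; elim: (enum _) => //= i s <-.
  by elim: (m _) => //= k <-; rewrite weyl_mul_ld.
elim: (enum _) => //= i s <-.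
by elim: (m _) => //= k <-; rewrite weyl_mul_lx.
Qed.

Fact weyl_mulA : associative weyl_mul.
Proof.
move=> p q r; elim/mpolyind: p => [|c m p _ _ IH].
  by rewrite !(linear0' (weyl_mul_linl _)).
by rewrite !weyl_mul_linl IH !weyl_mulX weyl_mul_op.
Qed.

Fact weyl_mul1r : left_id (1 : S) weyl_mul.
Proof.
move=> q; rewrite -mpolyX0 weyl_mulX opE.
have -> : xpart 0 = 0%MM.
  by apply/mnmP => i; rewrite !mnmE; case: splitP => // j _; rewrite mnm0E.
rewrite mpolyX0 mul1r /ldm; elim: (enum _) => //= i s ->.
by rewrite mnm0E.
Qed.

Fact weyl_mulr1 : right_id (1 : S) weyl_mul.
Proof.
move=> p; rewrite [RHS]mpolyE; apply: eq_bigr => m _; congr (_ *: _).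
rewrite opE [in RHS]mpolyXE_id big_split_ord /=; congr (_ * _).
  rewrite mpolyXE_id big_split_ord /= [X in _ * X]big1 ?mulr1.
    apply: eq_bigr => i _; rewrite mnmE.
    by case: splitP => [j /= /ord_inj <-|k /= /eqP] //; rewrite ltn_eqF // ltn_addr.
  move=> i _; rewrite mnmE; case: splitP => [j /= /eqP|k _] //.
  by rewrite gtn_eqF // ltn_addr.
rewrite -big_enum /=; elim: (enum _) => [|i s IH] /=; first by rewrite big_nil.
rewrite big_cons IH; elim: (m _) => [|k IHk] /=; first by rewrite mul1r.
rewrite IHk /weyl_ld mulrA -exprS -[RHS]addr0; congr (_ + _).
rewrite mprodXnE mpolyXn -mpolyXD mderivX mnmDE mulmnE mnm_sumE mnm1E eq_sym.
rewrite eq_lrshift mul0n.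
rewrite big1 ?scale0r // => j _; by rewrite mulmnE mnm1E eq_sym eq_lrshift.
Qed.

Fact weyl_mulZ c p q : (c *: p) ** q = c *: (p ** q).
Proof. exact: linearZ' (weyl_mul_linl q). Qed.

Fact weyl_mulDl : left_distributive weyl_mul +%R.
Proof. by move=> p q r; exact: linearD' (weyl_mul_linl r) p q. Qed.

Fact weyl_mulDr : right_distributive weyl_mul +%R.
Proof. by move=> p q r; exact: linearD' (weyl_mul_linr p) q r. Qed.

End NormalOrdering.

(* The Weyl algebra: [Weyl p] is the normally ordered operator of symbol p. *)
Record weyl (n : nat) (K : comNzRingType) := Weyl { symbol : {mpoly K[n + n]} }.

Section WeylRing.
Variables (n : nat) (K : comNzRingType).
Local Notation D := (weyl n K).
Implicit Types (p q r : D) (i j : 'I_n) (c : K).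

HB.instance Definition _ := [isNew for @symbol n K].
HB.instance Definition _ := [Choice of D by <:].

Let add p q := Weyl (symbol p + symbol q).
Let opp p := Weyl (- symbol p).
Let scale c p := Weyl (c *: symbol p).
Let mul p q := Weyl (weyl_mul (symbol p) (symbol q)).

Let addA : associative add.
Proof. by move=> p q r; apply: val_inj; exact: addrA. Qed.
Let addC : commutative add.
Proof. by move=> p q; apply: val_inj; exact: addrC. Qed.
Let add0 : left_id (Weyl 0) add.
Proof. by move=> p; apply: val_inj; exact: add0r. Qed.
Let addN : left_inverse (Weyl 0) opp add.
Proof. by move=> p; apply: val_inj; exact: addNr. Qed.

HB.instance Definition _ := GRing.isZmodule.Build D addA addC add0 addN.

Let scaleA b c p : scale b (scale c p) = scale (b * c) p.
Proof. by apply: val_inj; exact: scalerA. Qed.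
Let scale1 : left_id 1 scale.
Proof. by move=> p; apply: val_inj; exact: scale1r. Qed.
Let scaleDr : right_distributive scale +%R.
Proof. by move=> c p q; apply: val_inj; exact: scalerDr. Qed.
Let scaleDl p : {morph scale^~ p : b c / b + c}.
Proof. by move=> b c; apply: val_inj; exact: scalerDl. Qed.

HB.instance Definition _ :=
  GRing.Zmodule_isLmodule.Build K D scaleA scale1 scaleDr scaleDl.

Let mulA : associative mul.
Proof. by move=> p q r; apply: val_inj; exact: weyl_mulA. Qed.
Let mul1 : left_id (Weyl 1) mul.
Proof. by move=> p; apply: val_inj; exact: weyl_mul1r. Qed.
Let mulr_1 : right_id (Weyl 1) mul.
Proof. by move=> p; apply: val_inj; exact: weyl_mulr1. Qed.
Let mulDl : left_distributive mul +%R.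
Proof. by move=> p q r; apply: val_inj; exact: weyl_mulDl. Qed.
Let mulDr : right_distributive mul +%R.
Proof. by move=> p q r; apply: val_inj; exact: weyl_mulDr. Qed.
Let one_neq0 : Weyl 1 != 0 :> D.
Proof. by rewrite -val_eqE; exact: oner_neq0. Qed.

HB.instance Definition _ := GRing.Zmodule_isNzRing.Build D
  mulA mul1 mulr_1 mulDl mulDr one_neq0.

Let scaleAl c p q : c *: (p * q) = (c *: p) * q.
Proof. by apply: val_inj; exact/esym/weyl_mulZ. Qed.

HB.instance Definition _ := GRing.Lmodule_isLalgebra.Build K D scaleAl.

Definition weyl_x i : D := Weyl 'X_(lshift n i).
Definition weyl_d i : D := Weyl 'X_(rshift n i).

Let weyl_xE i p : weyl_x i * p = Weyl (weyl_lx i (symbol p)).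
Proof.
apply: val_inj; rewrite /= -[symbol p in RHS]weyl_mul1r -weyl_mul_lx.
by rewrite /weyl_lx mulr1.
Qed.

Let weyl_dE i p : weyl_d i * p = Weyl (weyl_ld i (symbol p)).
Proof.
apply: val_inj; rewrite /= -[symbol p in RHS]weyl_mul1r -weyl_mul_ld.
by rewrite /weyl_ld mulr1 -mpolyX0 mderivX mnm0E scale0r addr0.
Qed.

Lemma weyl_xC i j : weyl_x i * weyl_x j = weyl_x j * weyl_x i.
Proof. by rewrite !weyl_xE; congr Weyl; exact: mulrC. Qed.

Lemma weyl_dC i j : weyl_d i * weyl_d j = weyl_d j * weyl_d i.
Proof.
have dE k : symbol (weyl_d k) = weyl_ld k 1.
  by rewrite -[weyl_d k]mulr1 weyl_dE.
by rewrite !weyl_dE !dE weyl_ldC.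
Qed.

Lemma weyl_dx i j : weyl_d i * weyl_x j = weyl_x j * weyl_d i + (i == j)%:R.
Proof.
have -> : (i == j)%:R = Weyl (i == j)%:R :> D by case: (i == j).
rewrite weyl_dE weyl_xE /weyl_ld /weyl_lx mulrC; congr (Weyl (_ + _)).
rewrite mderivX mnm1E eq_lshift eq_sym; case: eqP => [->|_].
  by rewrite scale1r -[X in (X - _)%MM]add0m addmK mpolyX0.
by rewrite scale0r.
Qed.

Lemma weyl_monomialE (m : 'X_{1..n + n}) :
  Weyl 'X_[m] = (\prod_(i < n) weyl_x i ^+ m (lshift n i)) *
                (\prod_(i < n) weyl_d i ^+ m (rshift n i)) :> D.
Proof.
have bE (F : 'I_n -> D) : \prod_(i < n) F i = \prod_(i <- enum 'I_n) F i.
  by rewrite enumT [index_enum _]unlock.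
rewrite !{}bE.
apply: val_inj; rewrite /= -[LHS]weyl_mulr1 weyl_mulX /monomial_op.
set y := foldr _ 1 _.
have -> : y = symbol (\prod_(i <- enum 'I_n) weyl_d i ^+ m (rshift n i) : D).
  rewrite /y; elim: (enum _) => [|i s IH] /=; first by rewrite big_nil.
  rewrite big_cons IH; elim: (m _) => [|k IHk]; first by rewrite expr0 mul1r.
  by rewrite iterS IHk exprS -mulrA weyl_dE.
move: (\prod_(i <- _) weyl_d i ^+ _) => z.
rewrite -[weyl_mul _ _]/(symbol (_ * z)).
elim: (enum _) => [|i s IH]; first by rewrite big_nil mul1r.
rewrite big_cons [LHS]/= IH; elim: (m _) => [|k IHk]; first by rewrite expr0 mul1r.
by rewrite iterS IHk exprS -!mulrA weyl_xE.
Qed.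

End WeylRing.

Definition poly_d n (K : comNzRingType) (f : {mpoly K[n]}) : weyl n K :=
  \sum_(m <- msupp f) f@_m *: \prod_(i < n) weyl_d K i ^+ m i.

Section InitialIdeals.
Variables (R : realType) (K : comNzRingType).

Definition weight N (w : 'cV[R]_N) (m : 'X_{1..N}) : R :=
  \sum_(i < N) w i 0 *+ m i.

Definition initial_form N (w : 'cV[R]_N) (f : {mpoly K[N]}) : {mpoly K[N]} :=
  \sum_(m <- msupp f | all (fun m' => weight w m' <= weight w m) (msupp f))
    f@_m *: 'X_[m].

Definition initial_ideal n (w : 'cV[R]_n) (I : {mpoly K[n]} -> Prop) :=
  ideal_gen (fun g => exists2 f, I f /\ f != 0 & g = initial_form w f).

Definition weyl_initial_form n (w : 'cV[R]_n) (P : weyl n K) : weyl n K :=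
  Weyl (initial_form (col_mx (- w) w) (symbol P)).

Definition weyl_initial_ideal n (w : 'cV[R]_n) (J : weyl n K -> Prop) :=
  ideal_gen (fun Q => exists2 P, J P /\ P != 0 & Q = weyl_initial_form w P).
End InitialIdeals.

Section HypergeometricSystems.
Variable R : realType.
Local Notation C := R[i].
Variables (d n : nat) (A : 'M[int]_(d, n)) (beta : 'cV[C]_d).

Definition columns_generate :=
  forall z : 'cV[int]_d, exists u : 'cV[int]_n, A *m u = z.

Definition mnm_col (m : 'X_{1..n}) : 'cV[int]_n := \col_i (m i)%:Z.

Definition toric_ideal : {mpoly C[n]} -> Prop :=
  ideal_gen (fun f => exists u v : 'X_{1..n},
    A *m mnm_col u = A *m mnm_col v /\ f = 'X_[u] - 'X_[v]).

Definition euler (i : 'I_d) : weyl n C :=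
  \sum_(j < n) (A i j)%:~R *: (weyl_x C j * weyl_d C j).

(* D.I + <E - beta> for a set I of polynomials in the \partial_i. *)
Definition add_euler (I : {mpoly C[n]} -> Prop) : weyl n C -> Prop :=
  ideal_gen (fun P => (exists2 f, I f & P = poly_d f) \/
                      (exists i, P = euler i - (beta i 0)%:A)).

Definition hypergeometric_ideal := add_euler toric_ideal.

Definition homogeneous_config :=
  exists r : 'rV[rat]_d, r *m map_mx intr A = const_mx 1.
End HypergeometricSystems.

Section Cones.
Variables (R : realType) (k n : nat) (H : 'M[int]_(k, n)).

(* The open rational polyhedral cone H w > 0. When it is nonempty its closure
   is H w >= 0, so strong convexity says that the latter contains no line. *)
Definition open_cone (w : 'cV[R]_n) := forall i, 0 < (map_mx intr H *m w) i 0.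
Definition closed_cone (w : 'cV[R]_n) := forall i, 0 <= (map_mx intr H *m w) i 0.

Definition strongly_convex :=
  forall w, closed_cone w -> closed_cone (- w) -> w = 0.

Definition in_dual_cone (u : 'cV[R]_n) :=
  forall w, open_cone w -> 0 <= \sum_i u i 0 * w i 0.
End Cones.

Section WeightVectors.
Variable R : realType.
Local Notation C := R[i].
Variables (d n : nat) (A : 'M[int]_(d, n)) (beta : 'cV[C]_d) (w : 'cV[R]_n).
Local Notation I_A := (@toric_ideal R d n A).
Local Notation H_A := (hypergeometric_ideal A beta).

Definition weight_cone k (H : 'M[int]_(k, n)) :=
  [/\ strongly_convex R H, open_cone H w,
      homogeneous_config A \/
        (forall w' : 'cV[R]_n, open_cone H w' -> forall i, 0 < w' i 0) &
      forall w' : 'cV[R]_n, open_cone H w' ->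
        same_ideal (initial_ideal w I_A) (initial_ideal w' I_A) /\
        same_ideal (weyl_initial_ideal w H_A) (weyl_initial_ideal w' H_A)].

Definition weight_vector := exists k (H : 'M[int]_(k, n)), weight_cone H.
End WeightVectors.

Section FormalSeries.
Variable K : fieldType.
Variable n : nat.

(* The formal series \sum_a x^a phi_a(log x_1, ..., log x_n), with a ranging
   over K^n and no condition on the support. *)
Definition log_series := 'cV[K]_n -> {mpoly K[n]}.
Implicit Types (phi : log_series) (a v : 'cV[K]_n).

Definition series_x (i : 'I_n) phi : log_series :=
  fun a => phi (a - delta_mx i 0).

(* From \partial_i (x^b p(log x)) = x^(b - e_i) (b_i p + dp/dy_i)(log x). *)
Definition series_d (i : 'I_n) phi : log_series :=
  fun a => let b := a + delta_mx i 0 in b i 0 *: phi b + (phi b)^`M(i).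

Definition weyl_act (P : weyl n K) phi : log_series :=
  fun a => \sum_(m <- msupp (symbol P))
    (symbol P)@_m *: monomial_op series_x series_d m phi a.

Definition is_solution (J : weyl n K -> Prop) phi :=
  forall P, J P -> forall a, weyl_act P phi a = 0.

Definition power v : log_series := fun a => if a == v then 1 else 0.
End FormalSeries.

Definition has_dimension (K : fieldType) (T : Type) (V : lmodType K)
    (S : (T -> V) -> Prop) (N : nat) :=
  exists b : 'I_N -> T -> V,
    (forall c : 'I_N -> K, (forall t, \sum_i c i *: b i t = 0) -> forall i, c i = 0) /\
    (forall f, S f <-> exists c : 'I_N -> K, forall t, f t = \sum_i c i *: b i t).

Section NilssonSeries.
Variable R : realType.
Local Notation C := R[i].
Variables (d n : nat) (A : 'M[int]_(d, n)) (beta : 'cV[C]_d) (w : 'cV[R]_n).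

Definition basic_nilsson (phi : log_series C n) :=
  is_solution (hypergeometric_ideal A beta) phi /\
  exists (v : 'cV[C]_n) (U : 'cV[int]_n -> Prop) (p : 'cV[int]_n -> {mpoly C[n]}),
    [/\ forall u, U u -> phi (v + map_mx intr u) = p u,
        forall a, (forall u, U u -> a <> v + map_mx intr u) -> phi a = 0,
        exists k (H : 'M[int]_(k, n)), weight_cone A beta w H /\
          forall u, U u -> in_dual_cone H (map_mx intr u : 'cV[R]_n) /\ A *m u = 0,
        exists K : nat, forall u, U u -> (msize (p u) <= K)%N &
        U 0 /\ p 0 <> 0].

Definition nilsson_space (phi : log_series C n) :=
  exists (N : nat) (c : 'I_N -> C) (psi : 'I_N -> log_series C n),
    (forall i, basic_nilsson (psi i)) /\ forall a, phi a = \sum_i c i *: psi i a.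
End NilssonSeries.

Section ZariskiTopology.
Variables (K : fieldType) (n : nat).
Implicit Types S X Z : 'cV[K]_n -> Prop.

Definition zariski_closure S : 'cV[K]_n -> Prop := fun z =>
  forall p : {mpoly K[n]},
    (forall y, S y -> p.@[fun i => y i 0] = 0) -> p.@[fun i => z i 0] = 0.

Definition zariski_closed S := forall z, zariski_closure S z -> S z.

Definition irreducible_set Z :=
  (exists z, Z z) /\
  forall F G, zariski_closed F -> zariski_closed G ->
    (forall z, Z z -> F z \/ G z) ->
    (forall z, Z z -> F z) \/ (forall z, Z z -> G z).

Definition irreducible_component X Z :=
  [/\ irreducible_set Z, (forall z, Z z -> X z) &
      forall Z', irreducible_set Z' -> (forall z, Z' z -> X z) ->
        (forall z, Z z -> Z' z) -> forall z, Z' z -> Z z].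
End ZariskiTopology.

Section StandardPairs.
Variables (K : fieldType) (n : nat) (I : {mpoly K[n]} -> Prop).
Implicit Types (al : 'X_{1..n}) (s : {set 'I_n}).

Definition mnm_point (m : 'X_{1..n}) : 'cV[K]_n := \col_i (m i)%:R.

Definition coordinate_plane al s (z : 'cV[K]_n) :=
  forall i, i \notin s -> z i 0 = (al i)%:R.

Definition standard_pair al s :=
  irreducible_component
    (zariski_closure (fun z => exists2 u, ~ I 'X_[u] & z = mnm_point u))
    (coordinate_plane al s) /\
  forall u, coordinate_plane al s (mnm_point u) -> forall i, (al i <= u i)%N.

Definition coordinate_ideal s : {mpoly K[n]} -> Prop :=
  ideal_gen (fun f => exists2 i, i \notin s & f = 'X_i).

Definition top_standard_pair al s :=
  standard_pair al s /\ minimal_prime I (coordinate_ideal s).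

Definition top_part : {mpoly K[n]} -> Prop := fun f =>
  forall al s, top_standard_pair al s ->
    ideal_gen (fun g => exists2 i, i \notin s & g = 'X_i ^+ (al i).+1) f.
End StandardPairs.

Section Genericity.
Variable R : realType.
Local Notation C := R[i].
Variables (d n : nat) (A : 'M[int]_(d, n)) (beta : 'cV[C]_d) (w : 'cV[R]_n).
Local Notation in_I := (initial_ideal w (@toric_ideal R d n A)).
Local Notation in_H := (weyl_initial_ideal w (hypergeometric_ideal A beta)).

Definition is_exponent (v : 'cV[C]_n) := is_solution in_H (power v).

Definition comes_from (v : 'cV[C]_n) (al : 'X_{1..n}) (s : {set 'I_n}) :=
  [/\ top_standard_pair in_I al s, map_mx intr A *m v = beta &
      coordinate_plane al s v].

Definition generic_parameter :=
  [/\ same_ideal in_H (add_euler A beta (top_part in_I)),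
      forall v al s, is_exponent v -> comes_from v al s ->
        forall i, i \in s -> ~ exists z : int, v i 0 = z%:~R &
      forall v v', is_exponent v -> is_exponent v' -> v <> v' ->
        ~ exists u : 'cV[int]_n, v - v' = map_mx intr u].

Definition homogenizing_value (beta0 : C) :=
  (~ exists z : int, beta0 = z%:~R) /\
  forall v, is_solution (add_euler A beta in_I) (power v) ->
    ~ exists z : int, beta0 - \sum_i v i 0 = z%:~R.
End Genericity.

Section Triangulation.
Variables (R : realType) (d n : nat) (A : 'M[int]_(d, n)).

Definition rho : 'M[int]_(1 + d, 1 + n) := block_mx 1 (const_mx 1) 0 A.

Definition rho_weight (w : 'cV[R]_n) : 'cV[R]_(1 + n) := col_mx 0 w.

(* A lower face of the convex hull of the lifted points (rho_i, omega_i) is the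
   set of those minimizing a linear functional (c, 1). *)
Definition lifted_value (omega : 'cV[R]_(1 + n)) (c : 'rV[R]_(1 + d)) i : R :=
  (c *m map_mx intr rho) 0 i + omega i 0.

Definition lower_face omega (s : {set 'I_(1 + n)}) :=
  exists c : 'rV[R]_(1 + d), forall i,
    i \in s <-> forall j, lifted_value omega c i <= lifted_value omega c j.

Definition facet omega s :=
  lower_face omega s /\ forall t, lower_face omega t -> s \subset t -> t = s.

(* The normalized volume of the simplex with vertices the columns of rho indexed
   by s, when s has d + 1 elements; [ord0] is only a default value. *)
Definition simplex_volume (s : {set 'I_(1 + n)}) : nat :=
  `|\det (colsub (fun j : 'I_(1 + d) => nth ord0 (enum s) j) rho)|%N.
End Triangulation.

(* Main.v *)
(** Write M for in_w(I_A). Since w is generic, a monomial lies outside M exactly when it is the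
    unique w-minimal monomial of its A-degree. This makes the combinatorics elementary: the
    top-dimensional standard pairs of M have the form (d^al, s) with s + {0} a facet of the
    triangulation, and for a fixed facet the map al |-> A al is a bijection from these pairs onto
    Z^d / Z A_s, which has vol(s + {0}) elements.

    Each such pair carries exactly one exponent v, and the Gamma-series
    sum_u prod_i g_i(u_i) x^(v+u), with (v_i + k) g_i(k) = g_i(k - 1), is a basic Nilsson
    solution.

    Conversely, the lowest-weight part of a Nilsson solution is annihilated by
    in_(-w,w)(H_A(beta)) = top(M) + <E - beta>; genericity forces it to be c x^v with v an
    exponent. Exponents in one class modulo Z^n coincide, so subtracting c times the normalized
    Gamma-series of v leaves a solution without lowest-weight term, i.e. 0. *)

From HB Require Import structures.
Require Import Defs.
From mathcomp Require Import all_boot all_order all_algebra.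
From mathcomp Require Import mpoly complex.
From mathcomp Require Import boolp reals.
From mathcomp Require Import zify ring lra.

Set Implicit Arguments.
Unset Strict Implicit.
Unset Printing Implicit Defensive.

Import Order.TTheory GRing.Theory Num.Theory.

Local Open Scope ring_scope.

(** * The Weyl algebra acting on logarithmic series *)

(** No Gröbner bases appear. Ideals are controlled by linear functionals on monomials that vanish,
    with all their shifts, on the generators: functions of the degree for I_A, indicators of the
    minimizers of one degree for in_w(I_A). Minimizers are unique because [w] can be moved inside
    its open cone. This also makes the columns of a facet through 0 independent: an integer
    relation, split by sign, would give two standard monomials of one degree.

    That al |-> A al is onto rests on a pigeonhole argument: when a class is pushed ever deeper
    along the facet, the standard monomial of its degree keeps a bounded part off the facet; some
    part recurs infinitely often, and this part is al.

    The passage to c x^v must exclude logarithms. On x^a p(log x), d^m acts through factors a_i - j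
    + d/dy_i with j < m_i, each injective unless a_i = j. If [a] matched no pair, some monomial of
    top(M) would have injective factors only. Otherwise, for each i off the face, some monomial has
    singular factors in direction i alone, which gives dp/dy_i = 0. Along the face the Euler
    operators finish. *)

Section LinearSums.
Variables (K : comNzRingType) (n : nat) (V : lmodType K).
Implicit Types (F : 'X_{1..n} -> V) (p q : {mpoly K[n]}) (k m : 'X_{1..n}).

(** The linear extension of [F] from monomials. With [F] an indicator it is a functional that tests
    membership in an ideal; with [F m] the effect of a monomial operator it is the action on a
    series. *)
Definition lsum F p := \sum_(m <- msupp p) p@_m *: F m.

Lemma lsumE (k : nat) F p : (msize p <= k)%N ->
  lsum F p = \sum_(m : 'X_{1..n < k}) p@_m *: F m.
Proof.
move=> le_pk; pose I : subFinType _ := 'X_{1..n < k}.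
rewrite /lsum (ssrcomplements.big_mksub I) /=; first last.
- by move=> m /msize_mdeg_lt /leq_trans; apply.
- by rewrite msupp_uniq.
by rewrite big_rmcond //= => i /memN_msupp_eq0 ->; rewrite scale0r.
Qed.

Fact lsum_is_linear F : linear (lsum F).
Proof.
move=> c p r; pose k := (maxn (msize (c *: p + r)) (maxn (msize p) (msize r))).
rewrite !(@lsumE k) ?leq_max ?leqnn ?orbT // scaler_sumr -big_split /=.
by apply: eq_bigr => m _; rewrite mcoeffD mcoeffZ scalerDl scalerA.
Qed.

HB.instance Definition _ F := GRing.isLinear.Build K _ _ _ (lsum F) (lsum_is_linear F).

Lemma lsumX F m : lsum F 'X_[m] = F m.
Proof. by rewrite /lsum msuppX big_seq1 mcoeffX eqxx scale1r. Qed.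

Lemma eq_linear_mpoly (f g : {mpoly K[n]} -> V) : linear f -> linear g ->
  (forall m, f 'X_[m] = g 'X_[m]) -> f =1 g.
Proof.
have l0 (h : {mpoly K[n]} -> V) : linear h -> h 0 = 0.
  by move=> lh; have := lh (-1) 0 0; rewrite scaler0 addr0 scaleN1r addNr.
move=> lf lg fg; elim/mpolyind => [|c m p _ _ IH]; first by rewrite !l0.
by rewrite lf lg fg IH.
Qed.

Lemma lsumMX F k p : lsum F ('X_[k] * p) = lsum (fun m => F (k + m)%MM) p.
Proof.
apply: (eq_linear_mpoly (f := fun p => lsum F ('X_[k] * p))) => [c u v|c u v|m].
- by rewrite mulrDr -scalerAr linearP.
- by rewrite linearP.
- by rewrite -mpolyXD !lsumX.
Qed.

Lemma eq_lsum F G p : {in msupp p, F =1 G} -> lsum F p = lsum G p.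
Proof. by move=> FG; rewrite /lsum; apply: eq_big_seq => m /FG ->. Qed.

Lemma lsum_eq0 F p : {in msupp p, forall m, F m = 0} -> lsum F p = 0.
Proof. by move=> F0; rewrite /lsum big_seq big1 // => m /F0 ->; rewrite scaler0. Qed.

End LinearSums.

Section CommutingIterates.
Variables (I : eqType) (T : Type) (f : I -> T -> T).
Hypothesis fC : forall i j x, f i (f j x) = f j (f i x).

Definition iters (e : I -> nat) (s : seq I) (x : T) :=
  foldr (fun i => iter (e i) (f i)) x s.

Lemma itersS i e s x : uniq s -> i \in s ->
  iters (fun j => (i == j) + e j)%N s x = f i (iters e s x).
Proof.
have notin s' : i \notin s' -> iters (fun j => (i == j) + e j)%N s' x = iters e s' x.
  elim: s' => //= j s' IH; rewrite inE => /norP[/negPf ij js].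
  by rewrite ij add0n IH.
elim: s => //= j s IH /andP[js us]; rewrite inE.
have [eij|ij] /= := eqVneq i j; first by subst j; rewrite notin.
move=> /(IH us) ->.
by elim: (e j) => //= k ->; rewrite fC.
Qed.

End CommutingIterates.

Section Action.
Variables (K : fieldType) (n : nat).
Local Notation D := (weyl n K).
Local Notation series := (log_series K n).
Implicit Types (phi : series) (P Q : D) (i j : 'I_n) (a : 'cV[K]_n) (c : K).

Definition mnm_vec (e : 'I_n -> nat) : 'cV[K]_n := \col_i (e i)%:R.

Lemma series_dC i j phi : series_d i (series_d j phi) = series_d j (series_d i phi).
Proof.
apply: funext => a; rewrite /series_d.
have [->//|ij] := eqVneq i j.
rewrite !mderivD !mderivZ !mxE !eqxx (eq_sym j i) (negPf ij) /= !addr0.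
rewrite [a + _ + _]addrAC (mderiv_comm i j) !scalerDr !scalerA.
rewrite [X in X *: _]mulrC -!addrA; congr (_ + _).
exact: addrCA.
Qed.

Definition dpow (e : 'I_n -> nat) phi : series := iters (@series_d K n) e (enum 'I_n) phi.

Lemma dpowS i e phi : dpow (fun j => (i == j) + e j)%N phi = series_d i (dpow e phi).
Proof. by rewrite /dpow itersS ?enum_uniq ?mem_enum //; apply: series_dC. Qed.

Lemma xpowE (e : 'I_n -> nat) (s : seq 'I_n) phi a : 
  iters (@series_x K n) e s phi a = phi (a - \sum_(i <- s) (e i)%:R *: delta_mx i 0).
Proof.
elim: s a => [|i s IH] a /=; first by rewrite big_nil subr0.
rewrite big_cons; set S := \sum_(_ <- _) _ in IH *.
have it k b psi : iter k (series_x i) psi b = psi (b - k%:R *: delta_mx i 0).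
  elim: k b => [|k IHk] b; first by rewrite scale0r subr0.
  by rewrite iterS {1}/series_x IHk -nat1r scalerDl scale1r opprD addrA.
by rewrite it IH opprD addrA.
Qed.

(** [x_i] translates exponents, so the x-part of a normally ordered monomial only moves the point at
    which the derivatives are read. *)
Lemma monomial_opE m phi a :
  monomial_op (@series_x K n) (@series_d K n) m phi a =
  dpow (fun i => m (rshift n i)) phi (a - mnm_vec (fun i => m (lshift n i))).
Proof.
rewrite /monomial_op -/(iters _ _ _ _) -/(iters (@series_d K n) _ _ _) xpowE.
congr (dpow _ phi (a - _)); apply/matrixP => i j; rewrite ord1 summxE !mxE big_enum /=.
rewrite (bigD1 i) //= !mxE !eqxx mulr1 big1 ?addr0 // => k ki.
by rewrite !mxE eq_sym (negPf ki) mulr0.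
Qed.

Lemma weyl_actE P phi a : weyl_act P phi a =
  lsum (fun m => dpow (fun i => m (rshift n i)) phi
                   (a - mnm_vec (fun i => m (lshift n i)))) (symbol P).
Proof. by apply: eq_bigr => m _; rewrite monomial_opE. Qed.

Lemma weyl_actDl P Q phi a : weyl_act (P + Q) phi a = weyl_act P phi a + weyl_act Q phi a.
Proof. by rewrite !weyl_actE linearD. Qed.

Lemma weyl_actZl c P phi a : weyl_act (c *: P) phi a = c *: weyl_act P phi a.
Proof. by rewrite !weyl_actE linearZ. Qed.

Lemma weyl_act_x i P phi a :
  weyl_act (weyl_x K i * P) phi a = series_x i (weyl_act P phi) a.
Proof.
have -> : weyl_x K i * P = Weyl (weyl_lx i (symbol P)).
  apply: val_inj; rewrite /= -[symbol P in RHS]weyl_mul1r -weyl_mul_lx.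
  by rewrite /weyl_lx mulr1.
rewrite /series_x !weyl_actE /weyl_lx lsumMX; apply: eq_lsum => m _.
congr (dpow _ phi _).
  by apply: funext => j; rewrite mnmDE mnm1E eq_lrshift.
rewrite -addrA -opprD; congr (_ - _); apply/matrixP => j k; rewrite !mxE mnmDE mnm1E.
by rewrite eq_lshift ord1 natrD eqxx andbT eq_sym.
Qed.

(** Leibniz rule: read after translation by the x-exponent [u], the derivative carries the factor
    a_i + 1 - u_i, and the term dp/dx_i of the symbol supplies the missing u_i. *)
Lemma weyl_act_d i P phi a :
  weyl_act (weyl_d K i * P) phi a = series_d i (weyl_act P phi) a.
Proof.
have -> : weyl_d K i * P = Weyl (weyl_ld i (symbol P)).
  apply: val_inj; rewrite /= -[symbol P in RHS]weyl_mul1r -weyl_mul_ld.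
  by rewrite /weyl_ld mulr1 -mpolyX0 mderivX mnm0E scale0r addr0.
rewrite /series_d !weyl_actE /=; set F := fun m => _; set G := fun m => _.
pose f p := (a + delta_mx i 0) i 0 *: lsum G p + (lsum G p)^`M(i).
apply: (eq_linear_mpoly (f := fun p => lsum F (weyl_ld i p)) (g := f)).
- by move=> c u v; rewrite /weyl_ld mulrDr mderivD mderivZ -scalerAr addrACA -scalerDr linearP.
- move=> c u v; rewrite /f linearP mderivD mderivZ !scalerDr !scalerA mulrC.
  by rewrite addrACA -scalerA.
move=> m; rewrite /f /weyl_ld -mpolyXD mderivX linearD linearZ /= !lsumX /F /G.
have -> : (fun i0 => (U_(rshift n i) + m)%MM (rshift n i0)) =
  (fun j => (i == j) + m (rshift n j))%N.
  by apply: funext => j; rewrite mnmDE mnm1E eq_rshift.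
have -> : (fun i0 => (U_(rshift n i) + m)%MM (lshift n i0)) = (fun j => m (lshift n j)).
  by apply: funext => j; rewrite mnmDE mnm1E eq_sym eq_lrshift.
have -> : (fun i0 => (m - U_(lshift n i))%MM (rshift n i0)) = (fun j => m (rshift n j)).
  by apply: funext => j; rewrite mnmBE mnm1E eq_lrshift subn0.
rewrite dpowS /series_d; set psi := dpow _ phi; set u := fun j => m (lshift n j).
rewrite -/(u i); have -> : a - mnm_vec u + delta_mx i 0 = a + delta_mx i 0 - mnm_vec u.
  by rewrite addrAC.
(* The subtraction in [m - U_(lshift n i)] is truncated, so u_i = 0, where that term has coefficient
   0, is treated apart. *)
have [ui0|ui0] := eqVneq (u i) 0%N.
  by rewrite ui0 scale0r addr0 !mxE ui0 subr0.
have -> : a - mnm_vec (fun i0 => (m - U_(lshift n i))%MM (lshift n i0)) =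
  a + delta_mx i 0 - mnm_vec u.
  apply/matrixP => j k; rewrite ord1 !mxE mnmBE mnm1E eq_lshift /u (eq_sym i j) eqxx andbT.
  case: eqVneq => [->|_]; last by rewrite subn0 addr0.
  by rewrite natrB ?lt0n // opprB addrA addrAC.
rewrite addrAC -scalerDl !mxE; congr (_ *: _ + _); ring.
Qed.

Lemma weyl_act1 phi a : weyl_act 1 phi a = phi a.
Proof.
rewrite weyl_actE (_ : symbol 1 = 'X_[0]); last by rewrite mpolyX0.
rewrite lsumX.
have -> : mnm_vec (fun i => 0%MM (lshift n i)) = 0.
  by apply/matrixP => i j; rewrite !mxE mnm0E.
rewrite subr0 /dpow /iters; congr (_ a); elim: (enum _) => //= i s ->.
by rewrite mnm0E.
Qed.

Lemma weyl_act0 phi a : weyl_act 0 phi a = 0.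
Proof. by rewrite weyl_actE linear0. Qed.

(** By linearity [P] is a monomial; its factors are peeled off from the left, once in front of [Q]
    and once in front of 1. *)
Lemma weyl_actM P Q phi a : weyl_act (P * Q) phi a = weyl_act P (weyl_act Q phi) a.
Proof.
case: P => p.
apply: (eq_linear_mpoly (f := fun p => weyl_act (Weyl p * Q) phi a)
          (g := fun p => weyl_act (Weyl p) (weyl_act Q phi) a)) => [c u v|c u v|m].
- have -> : Weyl (c *: u + v) = c *: Weyl u + Weyl v :> D by [].
  by rewrite mulrDl -scalerAl weyl_actDl weyl_actZl.
- have -> : Weyl (c *: u + v) = c *: Weyl u + Weyl v :> D by [].
  by rewrite weyl_actDl weyl_actZl.
have actprod (f : 'I_n -> D) (g : 'I_n -> series -> series) (e : 'I_n -> nat) W psi :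
    (forall i P psi a, weyl_act (f i * P) psi a = g i (weyl_act P psi) a) ->
  weyl_act ((\prod_(i < n) f i ^+ e i) * W) psi = iters g e (enum 'I_n) (weyl_act W psi).
  move=> fg; rewrite (_ : \prod_(i < n) _ = \prod_(i <- enum 'I_n) f i ^+ e i); last first.
    by rewrite enumT [index_enum _]unlock.
  elim: (enum _) => [|i s IH]; first by rewrite big_nil mul1r.
  rewrite big_cons -mulrA /= -IH; elim: (e i) => [|k IHk]; first by rewrite mul1r.
  by apply: funext => b; rewrite exprS -mulrA fg IHk.
rewrite weyl_monomialE -mulrA (actprod _ (@series_x K n)); last exact: weyl_act_x.
rewrite (actprod _ (@series_d K n)); last exact: weyl_act_d.
rewrite -[X in _ * X]mulr1 (actprod _ (@series_x K n)); last exact: weyl_act_x.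
rewrite (actprod _ (@series_d K n)); last exact: weyl_act_d.
congr (iters _ _ _ (iters _ _ _ _) a).
by apply: funext => b; rewrite weyl_act1.
Qed.

Lemma annihilator_left_ideal phi : left_ideal (fun P => forall a, weyl_act P phi a = 0).
Proof.
split=> [a|P Q hP hQ a|P Q hQ a].
- exact: weyl_act0.
- by rewrite weyl_actDl hP hQ addr0.
rewrite weyl_actM (_ : weyl_act Q phi = fun=> 0); last exact/funext.
rewrite weyl_actE lsum_eq0 // => m _.
suff -> : dpow (fun i => m (rshift n i)) (fun _ : 'cV[K]_n => 0) = fun=> 0 by [].
rewrite /dpow /iters; elim: (enum _) => //= i s ->.
elim: (m _) => //= k ->; apply: funext => b.
by rewrite /series_d scaler0 mderiv0 addr0.
Qed.

Lemma is_solution_gen S phi : is_solution (ideal_gen S) phi <->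
  (forall P, S P -> forall a, weyl_act P phi a = 0).
Proof.
split=> [sol P SP|S0 P]; first by apply: sol => J _; apply.
by move=> /(_ _ (annihilator_left_ideal phi)); apply.
Qed.

End Action.

(** * The initial ideal of the toric ideal *)

Section ToricInitialIdeal.
Variable R : realType.
Local Notation C := R[i].
Variables (d n : nat) (A : 'M[int]_(d, n)).
Local Notation I_A := (@toric_ideal R d n A).
Implicit Types (m k u : 'X_{1..n}) (f g : {mpoly C[n]}) (w : 'cV[R]_n).

Definition grade m : 'cV[int]_d := A *m mnm_col m.

Lemma gradeD m k : grade (m + k)%MM = grade m + grade k.
Proof.
rewrite /grade -mulmxDr; congr (_ *m _); apply/matrixP => i j.
by rewrite !mxE mnmDE PoszD.
Qed.

Lemma weightD w m k : weight w (m + k)%MM = weight w m + weight w k.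
Proof. by rewrite /weight -big_split /=; apply: eq_bigr => i _; rewrite mnmDE mulrnDr. Qed.

(** A kernel of a functional is only a subspace; requiring all monomial shifts to vanish as well
    gives the largest ideal inside it, so that generators suffice as tests. *)
Lemma left_ideal_lsum (V : lmodType C) (F : 'X_{1..n} -> V) :
  left_ideal (fun f => forall k, lsum (fun m => F (k + m)%MM) f = 0).
Proof.
split=> [k|p q hp hq k|p q hq k]; rewrite ?linear0 //.
  by rewrite linearD /= hp hq addr0.
apply: (eq_linear_mpoly (f := fun p => lsum (fun m => F (k + m)%MM) (p * q))
          (g := fun=> 0)) => [c u v|c u v|m].
- by rewrite mulrDl -scalerAl linearP.
- by rewrite scaler0 addr0.
- by rewrite lsumMX -[RHS](hq (k + m)%MM); apply: eq_lsum => j _; rewrite addmA.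
Qed.

Lemma lsum_ideal_gen (V : lmodType C) (F : 'X_{1..n} -> V) S f :
  (forall q, S q -> forall k, lsum (fun m => F (k + m)%MM) q = 0) ->
  ideal_gen S f -> lsum F f = 0.
Proof.
move=> hS /(_ _ (left_ideal_lsum F) hS 0%MM) <-.
by apply: eq_lsum => m _; rewrite add0m.
Qed.

(** A function of the degree takes equal values on both terms of each binomial and of its multiples.
    This bounds in_w(I_A) from above and later shows that I_A annihilates the Gamma-series. *)
Lemma toric_lsum (V : lmodType C) (chi : 'cV[int]_d -> V) f :
  I_A f -> lsum (fun m => chi (grade m)) f = 0.
Proof.
apply: lsum_ideal_gen => _ [u [v [uv ->]]] k.
by rewrite linearB /= !lsumX !gradeD /grade uv subrr.
Qed.

Lemma lsum_initial_form (V : lmodType C) (F : 'X_{1..n} -> V) w f :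
  lsum F (initial_form w f) =
  \sum_(m <- msupp f | all (fun m' => weight w m' <= weight w m) (msupp f)) f@_m *: F m.
Proof.
rewrite /initial_form linear_sum /=; apply: eq_bigr => m _.
by rewrite linearZ /= lsumX.
Qed.

(* Since [f] has zero coefficient sum in every degree, the terms of maximal
   weight of [f] cannot hit only the minimal-weight part of a degree without
   the coefficients cancelling. *)
Lemma lsum_initial_minimizer w u g :
    (forall m, grade m = grade u -> weight w u <= weight w m) ->
    initial_ideal w I_A g ->
  lsum (fun m => ((grade m == grade u) && (weight w m == weight w u))%:R : C^o) g = 0.
Proof.
move=> umin; apply: lsum_ideal_gen => _ [f [If f0] ->] k.
rewrite lsum_initial_form.
pose top m := all (fun m' => weight w m' <= weight w m) (msupp f).
(* If the shift of a maximal term reaches the weight of [u], then every term shifted into the degree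
   of [u] has the weight of [m0]: at least by minimality of [u], at most by maximality of [m0]. The
   weight tests then hold automatically and [toric_lsum] applies. *)
have [[m0 m0f /andP[m0t /eqP m0u]]|no] :=
  pselect (exists2 m0, m0 \in msupp f & top m0 && (weight w (k + m0)%MM == weight w u)); last first.
  rewrite big_seq_cond big1 // => m /andP[mf mt].
  case: eqP => [_|]; last by rewrite scaler0.
  case: eqP => [mu|]; last by rewrite scaler0.
  by case: no; exists m; rewrite // mu eqxx andbT.
rewrite -[RHS](@toric_lsum C^o (fun b => (grade k + b == grade u)%:R) f If) /lsum.
rewrite big_mkcond big_seq [RHS]big_seq; apply: eq_bigr => m mf.
rewrite -gradeD; case: eqP => [mg|_] /=; last by case: ifP => _; rewrite ?scaler0.
have le1 := umin _ mg.
have le2 : weight w m <= weight w m0 by move/allP: m0t; apply.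
have eqmm0 : weight w m = weight w m0.
  by apply/eqP; rewrite eq_le le2 -(lerD2l (weight w k)) -!weightD m0u le1.
have : top m by apply/allP => m' m'f; rewrite eqmm0; move/allP: m0t; apply.
rewrite /top => ->.
by rewrite weightD eqmm0 -weightD m0u eqxx.
Qed.

Lemma initial_ideal_binomial w m m' : grade m = grade m' ->
  weight w m' < weight w m -> initial_ideal w I_A 'X_[m].
Proof.
move=> gr lt J _; apply.
have mm' : m != m' by apply: contraTneq lt => ->; rewrite ltxx.
have cm : ('X_[m] - 'X_[m'] : {mpoly C[n]})@_m = 1.
  by rewrite mcoeffB !mcoeffX eqxx eq_sym (negPf mm') subr0.
exists ('X_[m] - 'X_[m']).
  split; first by move=> J' _; apply; exists m, m'.
  by apply/eqP => /(congr1 (mcoeff m)); rewrite cm mcoeff0 => /eqP; rewrite oner_eq0.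
apply/mpolyP => k; rewrite -[LHS]/(mcoeff k _).
pose F : 'X_{1..n} -> C^o := fun j => (j == k)%:R.
have FE p : mcoeff k p = lsum F p.
  apply: (eq_linear_mpoly (V := C^o) (f := fun p => p@_k)) => [c u v|c u v|j].
  - by rewrite mcoeffD mcoeffZ.
  - by rewrite linearP.
  - by rewrite lsumX mcoeffX.
rewrite !FE lsum_initial_form lsumX.
have mf : m \in msupp ('X_[m] - 'X_[m'] : {mpoly C[n]}).
  by rewrite mcoeff_msupp cm oner_neq0.
have sub j : j \in msupp ('X_[m] - 'X_[m'] : {mpoly C[n]}) -> (j == m) || (j == m').
  rewrite mcoeff_msupp mcoeffB !mcoeffX; apply: contraR => /norP[/negPf jm /negPf jm'].
  by rewrite ![_ == j]eq_sym jm jm' subrr.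
rewrite big_mkcond (bigD1_seq m) ?msupp_uniq //= ifT; last first.
  by apply/allP => j /sub /orP[] /eqP -> //; apply: ltW.
rewrite cm scale1r big_seq_cond big1 ?addr0 // => j /andP[jf jm].
case: ifP => // /allP/(_ _ mf); have := sub _ jf.
by rewrite (negPf jm) => /eqP ->; rewrite leNgt lt.
Qed.

End ToricInitialIdeal.

(** * Openness of the weight cone *)

Section Cones.
Variables (R : realType) (k n : nat) (H : 'M[int]_(k, n)).

(** The radius is the least slack of [w] relative to the l1-norm of a row of [H]; the 1 added to
    that norm guards against zero rows and leaves room for strictness. *)
Lemma open_cone_nbhs (w : 'cV[R]_n) : open_cone H w ->
  exists2 e : R, 0 < e & forall u : 'cV[R]_n, (forall i, `|u i 0| <= e) -> open_cone H (w + u).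
Proof.
move=> Hw; pose N i := 1 + \sum_j `|(H i j)%:~R : R|.
have N0 i : 0 < N i by rewrite ltr_pwDl // sumr_ge0.
pose e := \big[Order.min/1]_i ((map_mx intr H *m w) i 0 / N i).
exists e => [|u ue i].
  by rewrite /e; elim/big_ind: _ => // [x y x0 y0|i _]; rewrite ?lt_min ?x0 ?divr_gt0.
have e0 : 0 <= e.
  by rewrite /e; elim/big_ind: _ => // [x y x0 y0|j _]; rewrite ?le_min ?x0 ?divr_ge0 // ltW.
have eH : e * N i <= (map_mx intr H *m w) i 0.
  by rewrite -ler_pdivlMr // /e (bigD1 i) //= ge_min lexx.
rewrite mulmxDr mxE; have : `|(map_mx intr H *m u) i 0| <= e * (N i - 1).
  rewrite mxE /N addrAC subrr add0r mulr_sumr (le_trans (ler_norm_sum _ _ _)) //.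
  by apply: ler_sum => j _; rewrite !mxE normrM mulrC ler_wpM2r.
rewrite ler_norml => /andP[le1 _].
have [le0|] := lerP (N i - 1) 0.
  have N1 : N i = 1 by apply/eqP; rewrite eq_le -subr_le0 le0 lerDl sumr_ge0.
  move: le1; rewrite N1 subrr mulr0 oppr0 => le1.
  by rewrite ltr_pwDl.
move=> N1; have [e00|en0] := eqVneq e 0.
  by move: le1; rewrite e00 mul0r oppr0 => le1; rewrite ltr_pwDl.
have ep : 0 < e by rewrite lt_def en0.
nra.
Qed.

End Cones.

(** * Standard monomials as unique minimizers of their degree *)

Section StandardMonomials.
Variable R : realType.
Local Notation C := R[i].
Variables (d n : nat) (A : 'M[int]_(d, n)) (beta : 'cV[C]_d) (w : 'cV[R]_n).
Local Notation I_A := (@toric_ideal R d n A).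
Local Notation M := (initial_ideal w I_A).
Local Notation grade := (grade A).
Implicit Types (m : 'X_{1..n}) (g : {mpoly C[n]}).

Definition standard m := ~ M 'X_[m].

Lemma standardD m m' : standard (m + m')%MM -> standard m.
Proof.
by move=> st Mm; apply: st; rewrite mpolyXD mulrC => J lJ SJ; case: (lJ) => _ _; apply; apply: Mm.
Qed.

Hypothesis hw : weight_vector A beta w.

Lemma weight_cone_standard k (H : 'M[int]_(k, n)) (w' : 'cV[R]_n) m m' :
    weight_cone A beta w H -> open_cone H w' ->
    standard m -> grade m' = grade m -> weight w' m <= weight w' m'.
Proof.
move=> [_ _ _ Heq] Hw' st gr; rewrite leNgt; apply/negP => lt; apply: st.
by exact: ((Heq _ Hw').1 _).2 (initial_ideal_binomial (esym gr) lt).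
Qed.

Lemma weight_perturb (u : 'cV[R]_n) e m :
  weight (w + e *: u) m = weight w m + e * weight u m.
Proof.
rewrite /weight mulr_sumr -big_split /=; apply: eq_bigr => i _.
by rewrite !mxE mulrnDl mulrnAr.
Qed.

(** If [w] gives both the same weight, move it within its cone in the direction u = m - m'. Their
    u-weights differ by the sum of the squares of u_i, so the tie breaks, while the initial ideal is
    unchanged. *)
Lemma initial_ideal_tie m m' : grade m = grade m' -> m <> m' ->
  M 'X_[m] \/ M 'X_[m'].
Proof.
move=> gr mm'; have [k [H [Hsc Hw Hpos Heq]]] := hw.
have [e e0 He] := open_cone_nbhs Hw.
pose u : 'cV[R]_n := \col_i ((m i)%:R - (m' i)%:R).
pose N := 1 + \sum_i `|u i 0|.
have N0 : 0 < N by rewrite ltr_pwDl // sumr_ge0.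
have ue c : `|c| <= 1 -> open_cone H (w + (c * (e / N)) *: u).
  move=> c1; apply: He => i; rewrite mxE !normrM.
  have -> : `|e| = e by apply/gtr0_norm.
  have -> : `|N^-1| = N^-1 by apply/gtr0_norm; rewrite invr_gt0.
  have uN : `|u i 0| <= N.
    by rewrite /N (bigD1 i) //= addrCA lerDl addr_ge0 // sumr_ge0.
  have y1 : `|u i 0| / N <= 1 by rewrite ler_pdivrMr ?mul1r.
  have y0 : 0 <= `|u i 0| / N by rewrite divr_ge0 // ltW.
  have -> : `|c| * (e * N^-1) * `|u i 0| = e * (`|c| * (`|u i 0| / N)) by ring.
  by rewrite ler_piMr // ?(ltW e0) // mulr_ile1.
have uu : weight u m - weight u m' != 0.
  have -> : weight u m - weight u m' = \sum_i (u i 0) ^+ 2.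
    rewrite /weight -sumrB; apply: eq_bigr => i _.
    by rewrite -mulr_natr -[X in _ - X]mulr_natr -mulrBr mxE expr2.
  apply: contra_notN mm' => uu0; apply/mnmP => i.
  have := uu0; rewrite psumr_eq0 => [/allP/(_ i)|j _]; last exact: sqr_ge0.
  rewrite mem_index_enum => /(_ isT); rewrite sqrf_eq0 mxE subr_eq0 => /eqP.
  by move/eqP; rewrite eqr_nat => /eqP.
have test c : `|c| <= 1 -> weight (w + (c * (e / N)) *: u) m' <
   weight (w + (c * (e / N)) *: u) m -> M 'X_[m].
  by move=> c1 lt; exact: ((Heq _ (ue _ c1)).1 _).2 (initial_ideal_binomial gr lt).
have test' c : `|c| <= 1 -> weight (w + (c * (e / N)) *: u) m <
   weight (w + (c * (e / N)) *: u) m' -> M 'X_[m'].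
  by move=> c1 lt; exact: ((Heq _ (ue _ c1)).1 _).2 (initial_ideal_binomial (esym gr) lt).
have [lt|lt|eqw] := ltgtP (weight w m) (weight w m').
- by right; apply: (test' 0); rewrite ?normr0 ?ler01 // mul0r scale0r addr0.
- by left; apply: (test 0); rewrite ?normr0 ?ler01 // mul0r scale0r addr0.
have eN : 0 < e / N by rewrite divr_gt0.
have [lt|lt|eqw'] := ltgtP (weight u m) (weight u m').
- right; apply: (test' 1); rewrite ?normr1 // !weight_perturb eqw mul1r ltrD2l.
  by rewrite ltr_pM2l.
- left; apply: (test 1); rewrite ?normr1 // !weight_perturb eqw mul1r ltrD2l.
  by rewrite ltr_pM2l.
- by move: uu; rewrite eqw' subrr eqxx.
Qed.

Lemma minimizer_standard m :
  (forall m', grade m' = grade m -> weight w m <= weight w m') -> standard m.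
Proof.
move=> mmin /(lsum_initial_minimizer mmin); rewrite lsumX !eqxx => /eqP.
by rewrite oner_eq0.
Qed.

Lemma standard_min m m' : standard m -> grade m' = grade m ->
  weight w m <= weight w m'.
Proof.
move=> st gr; have [k [H [h1 h2 h3 h4]]] := hw.
by apply: (weight_cone_standard (H := H)) gr.
Qed.

(** A second minimizer would lie in [M] by [initial_ideal_tie], but the minimizer functional of the
    degree, which vanishes on [M], is 1 on it. *)
Lemma standard_unique_min m m' : standard m -> grade m' = grade m ->
  m' <> m -> weight w m < weight w m'.
Proof.
move=> st gr mm'; rewrite lt_neqAle (standard_min st gr) andbT.
apply/eqP => eqw; case: (initial_ideal_tie gr mm') => // Mm'.
have mmin k : grade k = grade m -> weight w m <= weight w k by apply: standard_min.
have := lsum_initial_minimizer mmin Mm'; rewrite lsumX gr eqxx eqw eqxx => /eqP.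
by rewrite oner_eq0.
Qed.

Lemma standard_inj m m' : standard m -> standard m' -> grade m = grade m' -> m = m'.
Proof.
move=> st st' gr; apply: contrapT => mm'.
by case: (initial_ideal_tie gr mm').
Qed.

(** If [m] were standard, the minimizer functional of its degree would, by uniqueness, just read the
    coefficient at [m]. Hence [M] is a monomial ideal. *)
Lemma initial_ideal_monomial g m : M g -> m \in msupp g -> M 'X_[m].
Proof.
move=> Mg mg; apply: contrapT => st.
have mmin k : grade k = grade m -> weight w m <= weight w k by apply: standard_min.
have := lsum_initial_minimizer mmin Mg; rewrite /lsum (bigD1_seq m) ?msupp_uniq //= !eqxx.
rewrite big1 ?addr0 => [|k km]; last first.
  case: eqP => [gr|_]; last by rewrite scaler0.
  case: eqP => [eqw|_]; last by rewrite scaler0.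
  by have := standard_unique_min st gr (elimN eqP km); rewrite eqw ltxx.
by move: mg; rewrite mcoeff_msupp => /negPf mg /eqP; rewrite scaler_eq0 oner_eq0 mg.
Qed.

End StandardMonomials.

(** * Facets of the regular subdivision *)

Section FourierMotzkin.
Variable R : realFieldType.

Lemma separating_point (I : finType) (P N : pred I) (L U : I -> R) :
  (forall p q, P p -> N q -> L p <= U q) ->
  exists x, (forall p, P p -> L p <= x) /\ (forall q, N q -> x <= U q).
Proof.
move=> LU; case: (pickP P) => [p0 Pp0|P0].
  exists (L [arg max_(p > p0 | P p) L p]%O); case: arg_maxP => // p Pp pmax.
  by split=> [q /pmax//|q Nq]; apply: LU.
case: (pickP N) => [q0 Nq0|N0].
  exists (U [arg min_(q < q0 | N q) U q]%O); case: arg_minP => // q Nq qmin.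
  by split=> [p|r /qmin//]; rewrite P0.
by exists 0; split=> p; rewrite ?P0 ?N0.
Qed.

(* Integrality of the certificate [l] comes for free, as the matrix is integral
   although the bounds are real. *)
Lemma fourier_motzkin d (I : finType) (a : I -> 'I_d -> int) (b : I -> R) :
  (exists c : 'I_d -> R, forall i, b i <= \sum_j c j * (a i j)%:~R) \/
  (exists l : I -> nat, (forall j, \sum_i (l i)%:R * a i j = 0) /\
     0 < \sum_i (l i)%:R * b i).
Proof.
elim: d I a b => [|d IH] I a b.
  have [i bi|b0] := pickP (fun i => 0 < b i); last first.
    left; exists (fun=> 0) => i; rewrite big_ord0 leNgt; exact/negbT/b0.
  right; exists (fun j => nat_of_bool (j == i)); split=> [[]//|].
  rewrite (bigD1 i) //= eqxx mul1r big1 ?addr0 // => j /negPf ->.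
  by rewrite mul0r.
pose P i := 0 < a i ord0; pose N i := a i ord0 < 0; pose Z i := a i ord0 == 0.
pose q0 i : nat := `|a i ord0|%N.
(* Elimination of the variable [ord0]: rows with coefficient 0 are kept, a positive and a negative
   row are added with the multiplicities that cancel it, and every other index yields the void
   inequality 0 <= 0. *)
pose comb (V : zmodType) (F : I -> V) (x : I + I * I) : V :=
  match x with
  | inl i => if Z i then F i else 0
  | inr (p, q) => if P p && N q then F p *+ q0 q + F q *+ q0 p else 0
  end.
case: (IH _ (fun x j => comb _ (fun i => a i (lift ord0 j)) x) (comb _ b)) => [[c hc]|[l [l0 lb]]].
  pose S i := \sum_j c j * (a i (lift ord0 j))%:~R.
  have combS x : \sum_j c j * (comb _ (fun i => a i (lift ord0 j)) x)%:~R = comb _ S x.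
    case: x => [i|[p q]] /=.
      by case: ifP => _ //; rewrite big1 // => j _; rewrite mulr0.
    case: ifP => _; last by rewrite big1 // => j _; rewrite mulr0.
    rewrite /S -!sumrMnl -big_split /=; apply: eq_bigr => j _.
    by rewrite intrD !mulrDr -!mulrnAr !rmorphMn.
  have [x [xP xN]] : exists x : R, (forall p, P p -> (b p - S p) / (a p ord0)%:~R <= x)
      /\ (forall q, N q -> x <= (b q - S q) / (a q ord0)%:~R).
    apply: separating_point => p q Pp Nq.
    have := hc (inr (p, q)); rewrite combS /= Pp Nq /=.
    have -> : (a p ord0)%:~R = (q0 p)%:R :> R.
      by rewrite [RHS]pmulrn /q0 gtz0_abs.
    have -> : (a q ord0)%:~R = - (q0 q)%:R :> R.
      by rewrite [X in - X]pmulrn /q0 ltz0_abs // intrN opprK.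
    have p0 : 0 < (q0 p)%:R :> R by rewrite ltr0n absz_gt0 gt_eqF.
    have q1 : 0 < (q0 q)%:R :> R by rewrite ltr0n absz_gt0 lt_eqF.
    rewrite -(mulr_natr (b p)) -(mulr_natr (b q)) -(mulr_natr (S p)) -(mulr_natr (S q)).
    rewrite invrN mulrN -mulNr ler_pdivrMr // mulrAC ler_pdivlMr //.
    by move: (q0 p)%:R (q0 q)%:R => y z; lra.
  left; exists (fun j => if unlift ord0 j is Some j' then c j' else x) => i.
  rewrite big_ord_recl unlift_none (eq_bigr (fun j => c j * (a i (lift ord0 j))%:~R)); last first.
    by move=> j _; rewrite liftK.
  rewrite -/(S i) -lerBlDr; have [Zi|Ni|Pi] := ltgtP (a i ord0) 0; last first.
  - by have := hc (inl i); rewrite combS /= /Z Pi eqxx mulr0 subr_le0.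
  - by rewrite -ler_pdivrMr ?ltr0z //; apply: xP.
  by rewrite -ler_ndivlMr ?ltrz0 //; apply: xN.
(* The certificate pulled back: row [i] collects its kept copy and all the pairs in which it is the
   positive or the negative member. *)
right; exists (fun i => (Z i) * l (inl i) +
   (\sum_q (P i && N q) * (l (inr (i, q)) * q0 q) +
    \sum_p (P p && N i) * (l (inr (p, i)) * q0 p)))%N.
have sumE (V : pzRingType) (F : I -> V) : 
  \sum_i ((Z i) * l (inl i) +
   (\sum_q (P i && N q) * (l (inr (i, q)) * q0 q) +
    \sum_p (P p && N i) * (l (inr (p, i)) * q0 p)))%:R * F i
  = \sum_x (l x)%:R * comb V F x.
  under eq_bigr do rewrite !natrD !mulrDl.
  rewrite big_sumType /= !big_split /=; congr (_ + _).
    apply: eq_bigr => i _; case: (Z i); rewrite ?mul1n ?mul0n ?mul0r ?mulr0 //.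
  transitivity (\sum_p \sum_q (l (inr (p, q)))%:R * comb V F (inr (p, q))); last first.
    by rewrite pair_big; apply: eq_bigr => -[].
  rewrite [X in _ + X](_ : _ = \sum_p \sum_q
     ((P p && N q) * (l (inr (p, q)) * q0 p))%:R * F q); last first.
    rewrite exchange_big /=; apply: eq_bigr => i _.
    by rewrite natr_sum mulr_suml.
  rewrite -big_split; apply: eq_bigr => p _ /=.
  rewrite natr_sum mulr_suml -big_split; apply: eq_bigr => q _ /=.
  case: (P p && N q); rewrite ?mul1n ?mul0n ?mul0r ?mulr0 ?addr0 //.
  by rewrite mulrDr !natrM -!mulrA !mulr_natl.
split=> [j|]; rewrite sumE //.
case: (unliftP ord0 j) => [j' ->|->]; first exact: l0.
rewrite big1 // => -[i|[p q]] _ /=.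
  by rewrite /Z; case: eqP => [->|_]; rewrite mulr0.
case: ifP => [/andP[Pp Nq]|_]; last by rewrite mulr0.
rewrite -(mulr_natr (a p _)) -(mulr_natr (a q _)) !natz /q0 (gtz0_abs Pp) (ltz0_abs Nq); ring.
Qed.

End FourierMotzkin.

Section Facets.
Variable R : realType.
Local Notation C := R[i].
Variables (d n : nat) (A : 'M[int]_(d, n)) (beta : 'cV[C]_d) (w : 'cV[R]_n).
Local Notation grade := (grade A).
Local Notation std := (standard A w).
Implicit Types (m : 'X_{1..n}) (c : 'rV[R]_d) (s t : {set 'I_(1 + n)}).

(** The value of the functional (c, 1) at the lifted column, relative to the vertex 0, which is
    lifted to the origin; equally the reduced cost of column [i] when w.m is minimized over A m =
    b. *)
Definition height c (i : 'I_n) : R := (c *m map_mx intr A) 0 i + w i 0.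

Lemma lifted_value0 (c : 'rV[R]_(1 + d)) : lifted_value A (rho_weight w) c ord0 = c 0 ord0.
Proof.
have -> : ord0 = lshift n ord0 :> 'I_(1 + n) by apply: val_inj.
rewrite /lifted_value /rho_weight col_mxEu [X in _ + X]mxE addr0 /rho map_block_mx.
rewrite -{1}[c]hsubmxK mul_row_block row_mxEl !mxE big_ord1 !mxE mulr1.
rewrite [X in _ + X]big1 => [|k _]; rewrite ?addr0; first by congr (c _ _); apply: val_inj.
by rewrite !mxE mulr0.
Qed.

Lemma lifted_valueS (c : 'rV[R]_(1 + d)) i : lifted_value A (rho_weight w) c (rshift 1 i) =
  c 0 ord0 + height (rsubmx c) i.
Proof.
rewrite /lifted_value /rho_weight col_mxEd /rho map_block_mx.
rewrite -{1}[c]hsubmxK mul_row_block row_mxEr mxE /height addrA; congr (_ + _ + _).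
by rewrite mxE big_ord1 !mxE mulr1; congr (c _ _); apply: val_inj.
Qed.

(** Since 0 is on the face, the minimum is attained there; subtracting that value [c 0 ord0] removes
    the homogenizing coordinate. *)
Lemma lower_faceP s : ord0 \in s -> lower_face A (rho_weight w) s <->
  exists c, forall i, 0 <= height c i /\ (rshift 1 i \in s <-> height c i = 0).
Proof.
move=> s0; split=> [[c hc]|[c hc]].
  have c0 i : 0 <= height (rsubmx c) i.
    by have := (hc ord0).1 s0 (rshift 1 i); rewrite lifted_value0 lifted_valueS lerDl.
  exists (rsubmx c) => i; split=> //; split=> [si|hi].
    apply/eqP; rewrite eq_le c0 andbT.
    by have := (hc _).1 si ord0; rewrite lifted_value0 lifted_valueS gerDl.
  apply/hc => j; apply: le_trans ((hc ord0).1 s0 j).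
  by rewrite lifted_value0 lifted_valueS hi addr0.
exists (row_mx (0 : 'M_1) c) => i.
have val0 : lifted_value A (rho_weight w) (row_mx (0 : 'M_1) c) ord0 = 0.
  by rewrite lifted_value0 mxE; case: splitP => // j _; rewrite mxE.
have valS j : lifted_value A (rho_weight w) (row_mx (0 : 'M_1) c) (rshift 1 j) = height c j.
  by rewrite lifted_valueS row_mxKr -lifted_value0 val0 add0r.
have ge0 j : 0 <= lifted_value A (rho_weight w) (row_mx (0 : 'M_1) c) j.
  rewrite -(splitK j); case: (split j) => k /=; last by rewrite valS; case: (hc k).
  by rewrite (_ : lshift n k = ord0) ?val0 //; apply: val_inj; rewrite /= ord1.
have sE : i \in s <-> lifted_value A (rho_weight w) (row_mx (0 : 'M_1) c) i = 0.
  rewrite -(splitK i); case: (split i) => k /=; last by rewrite valS; case: (hc k).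
  by rewrite (_ : lshift n k = ord0) ?val0 //; apply: val_inj; rewrite /= ord1.
split=> [/sE -> j //|/(_ ord0)]; rewrite val0 => le0.
by apply/sE/eqP; rewrite eq_le le0 ge0.
Qed.

Lemma lower_face_sub_facet s : lower_face A (rho_weight w) s ->
  exists2 t, facet A (rho_weight w) t & s \subset t.
Proof.
move=> fs; have [|t /maxsetP[/asboolP ft tmax] st] :=
  @maxset_exists _ (fun t => `[< lower_face A (rho_weight w) t >]) s; first exact/asboolP.
by exists t => //; split=> // t' ft' tt'; apply: tmax; first exact/asboolP.
Qed.

(** Within one degree, weight and total height differ by a constant, so [w] may be replaced by
    nonnegative heights in comparisons. *)
Lemma weight_height c m : weight w m =
  \sum_i height c i *+ m i - (c *m map_mx intr (grade m)) 0 0.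
Proof.
rewrite /grade map_mxM mulmxA mxE -sumrB; apply: eq_bigr => i _.
have -> : map_mx intr (mnm_col m) i 0 = (m i)%:R :> R by rewrite !mxE.
rewrite -[w i 0 *+ _]mulr_natr -[height c i *+ _]mulr_natr /height; ring.
Qed.

Lemma height_weight_le c m m' : grade m' = grade m ->
  (weight w m <= weight w m') =
  (\sum_i height c i *+ m i <= \sum_i height c i *+ m' i).
Proof. by move=> gr; rewrite !(weight_height c) gr lerD2r. Qed.

Lemma support_standard c m : (forall i, 0 <= height c i) ->
  (forall i, m i != 0%N -> height c i = 0) -> std m.
Proof.
move=> h0 ms; apply: minimizer_standard => m' gr.
rewrite (height_weight_le c gr) big1 => [|i _].
  by apply: sumr_ge0 => i _; rewrite mulrn_wge0.
by have [->|/ms ->] := eqVneq (m i) 0%N; rewrite ?mulr0n ?mul0rn.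
Qed.

(** The inequalities ask for heights >= 0 everywhere and <= 0 on [s]. A certificate of infeasibility
    consists of two monomials of one degree, with [m'] supported on [s] and [m] of smaller weight,
    although [m'] is standard. *)
Lemma standard_lower_face (s : {set 'I_n}) : weight_vector A beta w ->
    (forall m, (forall i, m i != 0%N -> i \in s) -> std m) ->
  exists c, (forall i, 0 <= height c i) /\ (forall i, i \in s -> height c i = 0).
Proof.
move=> hw hs.
pose a (x : 'I_n + 'I_n) (j : 'I_d) : int :=
  match x with inl i => A j i | inr i => if i \in s then - A j i else 0 end.
pose b (x : 'I_n + 'I_n) : R :=
  match x with inl i => - w i 0 | inr i => if i \in s then w i 0 else 0 end.
case: (fourier_motzkin a b) => [[c hc]|[l [l0 lb]]].
  have cE i : \sum_j c j * (A j i)%:~R = ((\row_j c j) *m map_mx intr A) 0 i.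
    by rewrite mxE; apply: eq_bigr => j _; rewrite !mxE.
  have h0 i : 0 <= height (\row_j c j) i.
    by have := hc (inl i); rewrite /= cE /height; lra.
  exists (\row_j c j); split=> // i si; apply/eqP; rewrite eq_le h0 andbT.
  have := hc (inr i); rewrite /= si.
  have -> : \sum_j c j * (- A j i)%:~R = - \sum_j c j * (A j i)%:~R.
    by rewrite -sumrN; apply: eq_bigr => j _; rewrite rmorphN mulrN.
  by rewrite cE /height; lra.
pose m : 'X_{1..n} := [multinom l (inl i) | i < n].
pose m' : 'X_{1..n} := [multinom (if i \in s then l (inr i) else 0)%N | i < n].
have st' : std m' by apply: hs => i; rewrite mnmE; case: ifP.
have gr : grade m = grade m'.
  apply/matrixP => j k; rewrite !mxE; apply/eqP; rewrite -subr_eq0 -sumrB.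
  have := l0 j; rewrite big_sumType /= -big_split /= => l0j.
  rewrite -[X in _ == X]l0j; apply/eqP; apply: eq_bigr => i _.
  by rewrite !mxE !mnmE !natz; case: ifP => _; rewrite ?mulr0; ring.
have := standard_min hw st' gr; rewrite leNgt => /negP[].
move: lb; rewrite big_sumType /= -big_split /= -(subr_gt0 (weight w m)) /weight -sumrB.
congr (0 < _); apply: eq_bigr => i _; rewrite !mnmE.
by case: ifP => _; rewrite -[w i 0 *+ l (inl i)]mulr_natr -?[w i 0 *+ l (inr i)]mulr_natr ?mulr0n; ring.
Qed.

End Facets.

Lemma clear_denominators k (v : 'I_k -> rat) :
  exists2 z : int, z != 0 & forall i, exists y : int, z%:~R * v i = y%:~R.
Proof.
exists (\prod_i denq (v i)); first by apply/prodf_neq0 => i _; apply: denq_neq0.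
move=> i; exists (numq (v i) * \prod_(j | j != i) denq (v j)).
rewrite (bigD1 i) //= !intrM mulrAC; congr (_ * _).
by rewrite mulrC numqE.
Qed.

(** The ranks over the rationals and the reals agree, and a rational kernel vector becomes integral
    after clearing denominators. *)
Lemma int_kernel_trivial (R : realType) d k (B : 'M[int]_(d, k)) :
    (forall y : 'cV[int]_k, B *m y = 0 -> y = 0) ->
  \rank (map_mx intr B : 'M[R]_(d, k)) = k.
Proof.
move=> ker0; have -> : map_mx intr B = map_mx ratr (map_mx intr B : 'M[rat]_(d, k)) :> 'M[R]_(d, k).
  by apply/matrixP => i j; rewrite !mxE ratr_int.
rewrite mxrank_map -mxrank_tr; apply/eqP.
rewrite -[_ == _]/(row_free _) -kermx_eq0; apply/eqP/row_matrixP => i; rewrite row0.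
set v := row i _; have vB : v *m (map_mx intr B)^T = 0.
  by apply/sub_kermxP; rewrite row_sub.
move: (v : 'rV[rat]_k) vB => {}v vB.
have [z z0 /choice[y hy]] := clear_denominators (fun j => v 0 j).
have /ker0 y0 : B *m (\col_j y j) = 0.
  apply/matrixP => a b; rewrite !mxE; apply/eqP; rewrite -(intr_eq0 rat).
  have := congr1 (fun M : 'rV__ => M 0 a) vB; rewrite !mxE rmorph_sum /= => /(congr1 ( *%R z%:~R)).
  rewrite mulr0 mulr_sumr => E; rewrite -[X in _ == X]E; apply/eqP; apply: eq_bigr => j _.
  by rewrite !mxE rmorphM /= mulrA hy mulrC.
apply/matrixP => a j; rewrite ord1 mxE; apply/eqP.
have := congr1 (fun M : 'cV__ => M j 0) y0; rewrite !mxE => yj.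
have := hy j; rewrite yj => /eqP; rewrite mulf_eq0 intr_eq0 (negPf z0) /=.
by [].
Qed.

(** * Facets through the vertex 0 *)

Section FacetStructure.
Variable R : realType.
Local Notation C := R[i].
Variables (d n : nat) (A : 'M[int]_(d, n)) (beta : 'cV[C]_d) (w : 'cV[R]_n).
Local Notation grade := (grade A).
Local Notation std := (standard A w).
Local Notation height := (height A w).
Implicit Types (m : 'X_{1..n}) (c : 'rV[R]_d) (s t : {set 'I_(1 + n)}).

Hypothesis hw : weight_vector A beta w.

(** The positive and the negative part of [u] are monomials of total height 0, hence standard; they
    share their degree, so they coincide. *)
Lemma zero_height_independent c (u : 'cV[int]_n) : (forall i, 0 <= height c i) ->
  (forall i, u i 0 != 0 -> height c i = 0) -> A *m u = 0 -> u = 0.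
Proof.
move=> h0 us Au.
pose m : 'X_{1..n} := [multinom absz (Num.max (u i 0) 0)%R | i < n].
pose m' : 'X_{1..n} := [multinom absz (Num.max (- u i 0) 0)%R | i < n].
have st : std m.
  apply: (support_standard h0) => i; rewrite mnmE => mi; apply: us.
  by apply: contraNneq mi => ->; rewrite maxxx.
have st' : std m'.
  apply: (support_standard h0) => i; rewrite mnmE => mi; apply: us.
  by apply: contraNneq mi => ->; rewrite oppr0 maxxx.
have uE : u = mnm_col m - mnm_col m'.
  apply/matrixP => i j; rewrite ord1 !mxE !mnmE; lia.
have : m = m'.
  apply: (standard_inj hw) => //; apply/eqP; rewrite -subr_eq0 -mulmxBr -uE.
  exact/eqP.
by move=> mm'; rewrite uE mm' subrr.
Qed.

Hypothesis hA : columns_generate A.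

Lemma row_map_A_eq0 (y : 'rV[R]_d) : y *m map_mx intr A = 0 -> y = 0.
Proof.
move=> yA.
have [U hU] := choice (fun j : 'I_d => hA (delta_mx j 0)).
apply/matrixP => a j; rewrite ord1.
have := congr1 (fun M => (M *m map_mx intr (U j)) 0 0) yA.
rewrite -mulmxA -map_mxM hU mul0mx mxE (bigD1 j) //= big1 => [|k kj].
  by rewrite !mxE !eqxx mulr1 addr0.
by rewrite !mxE (negPf kj) mulr0.
Qed.

Lemma zero_height_rank c k (g : 'I_k -> 'I_n) : injective g ->
    (forall i, 0 <= height c i) -> (forall j, height c (g j) = 0) ->
  \rank (map_mx intr (colsub g A) : 'M[R]_(d, k)) = k.
Proof.
move=> ginj h0 hg; apply: int_kernel_trivial => y By.
pose u : 'cV[int]_n := \col_i \sum_(j | g j == i) y j 0.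
have ug j : u (g j) 0 = y j 0.
  by rewrite mxE (bigD1 j) //= big1 ?addr0 // => j' /andP[/eqP/ginj ->]; rewrite eqxx.
suff u0 : u = 0.
  by apply/matrixP => j b; rewrite ord1 -ug u0 !mxE.
apply: (zero_height_independent h0) => [i|].
  by apply: contraNeq => hi; rewrite mxE big_pred0 // => j; apply: contra_neqF hi => /eqP <-.
rewrite -[RHS]By; apply/matrixP => a b; rewrite ord1 !mxE.
under eq_bigr do rewrite mxE mulr_sumr.
rewrite (exchange_big_dep predT) //=; apply: eq_bigr => j _.
by rewrite (big_pred1 (g j)) ?mxE // => i; rewrite eq_sym.
Qed.

(** [g] lists the vertices other than 0. Their columns are independent by [zero_height_rank] and
    span by maximality of the face, so there are [d] of them. As column 0 of [rho A] is the first
    unit vector, the volume reduces to the minor of [A]. *)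
Lemma facet_structure s : facet A (rho_weight w) s -> ord0 \in s ->
  exists (g : 'I_d -> 'I_n) c,
    [/\ injective g, \det (colsub g A) != 0,
       simplex_volume A s = `|\det (colsub g A)|%N,
       forall i, 0 <= height c i /\ (height c i = 0 <-> exists j, g j = i) &
       forall i, rshift 1 i \in s <-> exists j, g j = i].
Proof.
move=> [fs smax] s0; have [c hc] := (lower_faceP A w s0).1 fs.
have h0 i : 0 <= height c i by case: (hc i).
pose tau := [set i | rshift 1 i \in s].
have tauE i : (i \in tau) = (rshift 1 i \in s) by rewrite inE.
have span k (g : 'I_k -> 'I_n) : (forall i, i \in tau -> exists j, g j = i) ->
    \rank (map_mx intr (colsub g A) : 'M[R]_(d, k)) = d.
  move=> gtau; apply/eqP; rewrite -[_ == _]/(row_free _) -kermx_eq0.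
  apply/eqP/row_matrixP => i0; rewrite row0; set y := row i0 _.
  have yB : y *m map_mx intr (colsub g A) = 0 by apply/sub_kermxP; rewrite row_sub.
  clearbody y; move: y yB => y yB; apply: contrapT => y0.
  have [z [z0 zB [i zi]]] : exists z : 'rV[R]_d, [/\ z <> 0,
      z *m map_mx intr (colsub g A) = 0 & exists i, (z *m map_mx intr A) 0 i < 0].
    have [i yi] : exists i, (y *m map_mx intr A) 0 i != 0.
      apply: contrapT => no; apply/y0/row_map_A_eq0/matrixP => a i.
      by rewrite ord1 [RHS]mxE; apply: contrapT => /eqP yi; apply: no; exists i.
    have [yi0|yi0|yi0] := ltgtP ((y *m map_mx intr A) 0 i) 0; last by rewrite yi0 eqxx in yi.
      by exists y; split=> //; exists i.
    exists (- y); split; first by move/eqP; rewrite oppr_eq0 => /eqP.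
      by rewrite mulNmx yB oppr0.
    by exists i; rewrite mulNmx mxE oppr_lt0.
  pose a i := (z *m map_mx intr A) 0 i.
  have atau j : j \in tau -> a j = 0.
    move=> /gtau[l <-]; have := congr1 (fun M : 'rV__ => M 0 l) zB.
    by rewrite !mxE /a mxE => zl; rewrite -[RHS]zl; apply: eq_bigr => b _; rewrite !mxE.
  (* Ratio test: [t] is the largest step along [z] that keeps all heights nonnegative. Heights on
     the facet stay 0 and that of [i1] drops to 0, which would enlarge the face. *)
  pose r i := height c i / - a i.
  have [i1 ai1 rmin] := @arg_minP _ _ _ i (fun i => a i < 0) r zi.
  pose t := r i1; have t0 : 0 <= t by rewrite /t /r divr_ge0 // oppr_ge0 ltW.
  have hE j : height (c + t *: z) j = height c j + t * a j.
    by rewrite /height mulmxDl -scalemxAl mxE [X in _ + X + _]mxE addrAC.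
  have h1 j : 0 <= height (c + t *: z) j.
    rewrite hE; have [aj|aj] := ltP (a j) 0; last exact: addr_ge0 (h0 j) (mulr_ge0 t0 aj).
    have := rmin _ aj; rewrite -/t /r ler_pdivlMr ?oppr_gt0 // mulrN.
    by rewrite -subr_ge0 opprK.
  pose s' := ord0 |: [set rshift 1 i | i in [set i | height (c + t *: z) i == 0]].
  have s'S j : (rshift 1 j \in s') = (height (c + t *: z) j == 0).
    rewrite !inE -val_eqE /=; apply/imsetP/eqP => [[l]|hj].
      by rewrite inE => /eqP hl /(@rshift_inj 1 n) ->.
    by exists j; rewrite // inE hj.
  have fs' : lower_face A (rho_weight w) s'.
    apply/lower_faceP; first by rewrite !inE eqxx.
    by exists (c + t *: z) => j; split=> //; rewrite s'S; split=> /eqP.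
  have ss' : s \subset s'.
    apply/subsetP => x; rewrite -(splitK x); case: (split x) => j /=.
      by move=> _; rewrite !inE -val_eqE /= ord1.
    move=> js; rewrite s'S hE atau ?tauE // mulr0 addr0.
    by apply/eqP/(hc j).2.
  have := smax _ fs' ss' => s's.
  have : rshift 1 i1 \in s.
    rewrite -s's s'S hE /t /r invrN mulrN mulNr mulfVK ?subrr //.
    by rewrite lt_eqF.
  by rewrite -tauE => /atau ai10; move: ai1; rewrite ai10 ltxx.
have indep k (g : 'I_k -> 'I_n) : injective g -> (forall j, g j \in tau) ->
    \rank (map_mx intr (colsub g A) : 'M[R]_(d, k)) = k.
  move=> ginj gtau; apply: (zero_height_rank ginj h0) => j.
  by apply/(hc _).2; rewrite -tauE.
have ek : #|tau| = d.
  rewrite -[LHS](indep _ (@enum_val _ (mem tau))) ?span //.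
  - by move=> i it; exists (enum_rank_in it i); rewrite enum_rankK_in.
  - exact: enum_val_inj.
  - by move=> j; apply: enum_valP.
pose g (j : 'I_d) := enum_val (cast_ord (esym ek) j) : 'I_n.
have ginj : injective g by move=> i j /enum_val_inj/cast_ord_inj.
have gtau j : g j \in tau by apply: enum_valP.
have taug i : i \in tau -> exists j, g j = i.
  move=> it; exists (cast_ord ek (enum_rank_in it i)).
  by rewrite /g cast_ordK enum_rankK_in.
have taugP i : rshift 1 i \in s <-> exists j, g j = i.
  by rewrite -tauE; split=> [/taug//|[j <-]].
exists g, c; split=> //.
- rewrite -(intr_eq0 R) -det_map_mx -unitfE -unitmxE -row_free_unit.
  by rewrite /row_free indep.
- rewrite /simplex_volume; congr absz.
  (* The vertex 0 is enumerated first and [g] follows the same order, so the matrix is block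
     triangular without a permutation. *)
  have enumE : enum s = ord0 :: [seq rshift 1 i | i <- enum tau].
    have enum_filter (T : finType) (B : {set T}) : enum B = filter (mem B) (enum T).
      by rewrite enumT.
    rewrite (enum_filter _ s) (enum_filter _ tau) (enum_ordSl n) /= s0; congr (_ :: _).
    rewrite filter_map; congr map; first by apply/funext => i; apply: val_inj.
    by apply: eq_filter => i; rewrite /= tauE; congr (_ \in s); apply: val_inj.
  rewrite (_ : colsub _ (rho A) = block_mx 1 (const_mx 1) 0 (colsub g A)).
    by rewrite det_ublock det1 mul1r.
  have f0 : nth ord0 (enum s) (lshift d (ord0 : 'I_1)) = lshift n ord0 :> 'I_(1 + n).
    by rewrite enumE; apply: val_inj.
  have fS j : nth ord0 (enum s) (rshift 1 j) = rshift 1 (g j) :> 'I_(1 + n).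
    have sz : (j < size (enum tau))%N by rewrite -cardE ek.
    by rewrite enumE /= (nth_map (g j)) // {2}/g (enum_val_nth (g j)).
  apply/matrixP => x y; rewrite -(splitK x) -(splitK y) mxE.
  case: (split y) => y' /=; rewrite ?(ord1 y') ?f0 ?fS /rho; case: (split x) => x' /=.
  - by rewrite !block_mxEul.
  - by rewrite !block_mxEdl !mxE.
  - by rewrite !block_mxEur !mxE.
  - by rewrite !block_mxEdr !mxE.
- move=> i; split=> //; split=> [/((hc i).2)/taugP//|/taugP/((hc i).2)//].
Qed.

End FacetStructure.

(** * Top-dimensional standard pairs *)

(** With Smith form B = L S Q, the representatives are the images under [L] of the box 0 <= f_i <
    |e_i|. *)
Lemma lattice_transversal d (B : 'M[int]_d) : \det B != 0 ->
  exists r : seq 'cV[int]_d, [/\ uniq r, size r = `|\det B|%N,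
    forall z, exists2 x, x \in r & exists y, z = x + B *m y &
    forall x x', x \in r -> x' \in r -> (exists y, x = x' + B *m y) -> x = x'].
Proof.
have [L uL [Q uQ [e _ BE]]] := int_Smith_normal_form B.
set S := \matrix_(i, j) _ in BE.
have SE : S = diag_mx (\row_i e`_i).
  apply/matrixP => i j; rewrite !mxE; have [->|ij] := eqVneq i j; first by rewrite eqxx.
  by rewrite -(inj_eq val_inj) in ij; rewrite (negPf ij).
have absdet (P : 'M[int]_d) : P \in unitmx -> `|\det P|%N = 1%N.
  by rewrite unitmxE => /orP[] /eqP ->.
move=> detB; have detE : `|\det B|%N = (\prod_(i < d) absz (e`_i)%R)%N.
  rewrite BE !det_mulmx !abszM (absdet _ uL) (absdet _ uQ) mul1n muln1 SE det_diag.
  by elim/big_rec2: _ => // i x y _ <-; rewrite abszM mxE.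
have e0 (i : 'I_d) : (0 < absz (e`_i)%R)%N.
  rewrite absz_gt0; apply: contraNneq detB => ei.
  by rewrite -absz_eq0 detE (bigD1 i) //= ei.
pose T := {dffun forall i : 'I_d, 'I_(absz (e`_i)%R)}.
pose rep (f : T) : 'cV[int]_d := L *m \col_i (f i)%:Z.
have repP f f' y : rep f = rep f' + B *m y -> f = f'.
  rewrite /rep BE -!mulmxA -mulmxDr => /(can_inj (mulKmx uL)); rewrite SE.
  move: (Q *m y) => z fE; apply/ffunP => i; apply/val_inj.
  have /matrixP/(_ i 0) := fE; rewrite mul_diag_mx !mxE => /(congr1 (modz^~ e`_i)).
  rewrite addrC [_ * z i 0]mulrC modzMDl -modz_abs -[RHS]modz_abs.
  by rewrite !modz_small ?lez_nat ?ltz_nat ?ltn_ord ?leq0n // => -[].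
pose r := [seq rep f | f <- enum {: T}].
have memr f : rep f \in r by apply: map_f; rewrite mem_enum.
exists r; split.
- rewrite map_inj_uniq ?enum_uniq // => f f' ff'.
  by apply: (repP f f' 0); rewrite mulmx0 addr0.
- rewrite size_map -cardE card_dep_ffun detE.
  rewrite /image_mem -big_enum /=; elim: (enum _) => [|i s IH]; rewrite ?big_nil // big_cons /=.
  by rewrite card_ord IH.
- move=> z; have [z' ->] : exists z', z = L *m z' by exists (invmx L *m z); rewrite mulKVmx.
  have lt (i : 'I_d) : (absz (modz (z' i 0)%R (e`_i)%R) < absz (e`_i)%R)%N.
    by rewrite -ltz_nat gez0_abs ?modz_ge0 -?absz_gt0 // abszE ltz_mod // -absz_gt0.
  pose f : T := [ffun i => Ordinal (lt i)].
  exists (rep f) => //; exists (invmx Q *m \col_i divz (z' i 0) e`_i).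
  rewrite /rep BE -!mulmxA mulKVmx // -mulmxDr; congr (_ *m _).
  apply/matrixP => i j; rewrite ord1 SE mul_diag_mx !mxE ffunE /=.
  rewrite [LHS](divz_eq (z' i 0) e`_i) addrC mulrC; congr (_ + _).
  by rewrite gez0_abs // modz_ge0 // -absz_gt0.
- by move=> x x' /mapP[f _ ->] /mapP[f' _ ->] [y] /repP ->.
Qed.

Lemma sum_codom (V : nmodType) k n (g : 'I_k -> 'I_n) (F : 'I_n -> V) : injective g ->
  (forall i, F i != 0 -> exists j, g j = i) -> \sum_i F i = \sum_j F (g j).
Proof.
move=> ginj Fg; transitivity (\sum_j \sum_(i | g j == i) F i); last first.
  by apply: eq_bigr => j _; rewrite (big_pred1 (g j)) // => i; rewrite eq_sym.
rewrite (exchange_big_dep predT) //=; apply: eq_bigr => i _.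
have [Fi|/Fg[j <-]] := eqVneq (F i) 0; first by rewrite Fi big1.
by rewrite (big_pred1 j) // => l; rewrite (inj_eq ginj).
Qed.

Lemma leq_bigsum_one (I : finType) (F : I -> nat) i : (F i <= \sum_j F j)%N.
Proof. by rewrite (bigD1 i) //= leq_addr. Qed.

Lemma mulmx_support (K : pzRingType) d k n (g : 'I_k -> 'I_n) (B : 'M[K]_(d, n))
    (u : 'cV[K]_n) : injective g -> (forall i, u i 0 != 0 -> exists j, g j = i) ->
  B *m u = colsub g B *m \col_j u (g j) 0.
Proof.
move=> ginj ug; apply/matrixP => a b; rewrite ord1 !mxE (sum_codom ginj).
  by apply: eq_bigr => j _; rewrite !mxE.
by move=> i Bu; apply: ug; apply: contraNneq Bu => ->; rewrite mulr0.
Qed.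

(** * Standard pairs over a fixed facet *)

Section ChartPairs.
Variable R : realType.
Local Notation C := R[i].
Variables (d n : nat) (A : 'M[int]_(d, n)) (beta : 'cV[C]_d) (w : 'cV[R]_n).
Local Notation grade := (grade A).
Local Notation std := (standard A w).
Local Notation height := (height A w).
Hypotheses (hw : weight_vector A beta w) (hA : columns_generate A).
Implicit Types (m al : 'X_{1..n}) (c : 'rV[R]_d).

Variables (g : 'I_d -> 'I_n) (c : 'rV[R]_d).
Hypotheses (ginj : injective g) (gdet : \det (colsub g A) != 0).
Hypothesis (hc : forall i, 0 <= height c i /\ (height c i = 0 <-> exists j, g j = i)).
Local Notation Ag := (colsub g A).

(** The monomial form of a standard pair whose face is the image of [g]; [chart_pair_top] and
    [standard_pair_standard] link it to the geometric definition. *)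
Definition chart_pair al := (forall j, al (g j) = 0%N) /\
  forall m, (forall i, m i != 0%N -> exists j, g j = i) -> std (al + m)%MM.

Definition chart_mnm (y : 'I_d -> nat) : 'X_{1..n} :=
  [multinom (\sum_(j | g j == i) y j)%N | i < n].

Lemma chart_mnmE y j : chart_mnm y (g j) = y j.
Proof.
rewrite mnmE (bigD1 j) //= big1 ?addn0 // => j' /andP[/eqP/ginj ->].
by rewrite eqxx.
Qed.

Lemma chart_mnm_support y i : chart_mnm y i != 0%N -> exists j, g j = i.
Proof.
rewrite mnmE; case: (pickP (fun j => g j == i)) => [j /eqP <-|no]; first by exists j.
by rewrite big_pred0.
Qed.

Lemma grade_support m : (forall i, m i != 0%N -> exists j, g j = i) ->
  grade m = Ag *m \col_j (m (g j))%:Z.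
Proof.
move=> ms; rewrite /grade (mulmx_support _ ginj) => [|i]; last by rewrite mxE; apply: ms.
by congr (_ *m _); apply/matrixP => j k; rewrite !mxE.
Qed.

Lemma grade_chart_mnm y : grade (chart_mnm y) = Ag *m \col_j (y j)%:Z.
Proof.
rewrite grade_support; last exact: chart_mnm_support.
by congr (_ *m _); apply/matrixP => j k; rewrite !mxE chart_mnmE.
Qed.

Lemma chart_kernel (y : 'cV[int]_d) : Ag *m y = 0 -> y = 0.
Proof.
move=> /(congr1 (mulmx (\adj Ag))); rewrite mulmxA mul_adj_mx mulmx0 mul_scalar_mx.
move=> dy; apply/matrixP => j k; have /matrixP/(_ j k)/eqP := dy.
by rewrite !mxE mulf_eq0 (negPf gdet) => /eqP.
Qed.

(** Splitting [y] by sign, al + y^- and al' + y^+ are standard of the same degree, hence equal;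
    compare them off the chart. *)
Lemma chart_pair_inj al al' (y : 'cV[int]_d) : chart_pair al -> chart_pair al' ->
  grade al = grade al' + Ag *m y -> al = al'.
Proof.
move=> [al0 als] [al0' als'] gr.
pose yp j := absz (Num.max (y j 0) 0); pose yn j := absz (Num.max (- y j 0) 0).
have E : (al + chart_mnm yn = al' + chart_mnm yp)%MM.
  apply: (standard_inj hw).
  - exact: als (@chart_mnm_support yn).
  - exact: als' (@chart_mnm_support yp).
  rewrite !gradeD !grade_chart_mnm gr -addrA -mulmxDr; congr (_ + _ *m _).
  by apply/matrixP => j k; rewrite ord1 !mxE /yp /yn; move: (y j 0) => t; clear; lia.
apply/mnmP => i; have := congr1 (fun m : 'X_{1..n} => m i) E; rewrite !mnmDE.
have [[j <-]|ig] := pselect (exists j, g j = i); first by rewrite al0 al0'.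
have z0 yy : chart_mnm yy i = 0%N.
  by apply/eqP; apply: contra_notT ig => /chart_mnm_support.
by rewrite !z0 !addn0.
Qed.

Let W m := \sum_i height c i *+ m i.

(** Off the chart every height is positive, so the total height [W] bounds those exponents. *)
Lemma chart_offset_bound m : exists B : nat, forall m', W m' <= W m ->
  forall i, (forall j, g j <> i) -> (m' i <= B)%N.
Proof.
have h0 i : 0 <= height c i by case: (hc i).
have W0 : 0 <= W m by apply: sumr_ge0 => i _; rewrite mulrn_wge0.
pose B i := Num.bound (W m / height c i).
exists (\sum_i B i)%N => m' le i ig.
have hi : 0 < height c i.
  by rewrite lt_def h0 andbT; apply/eqP => /((hc i).2)[j]; apply: ig.
apply: leq_trans (leq_bigsum_one B i); rewrite -(ler_nat R).
apply/ltW/(le_lt_trans _ (archi_boundP _)); last by rewrite divr_ge0 // ltW.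
rewrite ler_pdivlMr // mulr_natl; apply: le_trans le.
by rewrite /W (bigD1 i) //= lerDl sumr_ge0 // => k _; rewrite mulrn_wge0.
Qed.

(** [W] depends only on the exponents off the chart, which range over a finite box; so its minimum
    in the degree is attained, and a minimizer is standard. *)
Lemma standard_in_grade m (B : nat) :
    (forall m', W m' <= W m -> forall i, (forall j, g j <> i) -> (m' i <= B)%N) ->
  exists m', [/\ grade m' = grade m, std m' &
     forall i, (forall j, g j <> i) -> (m' i <= B)%N].
Proof.
move=> bB; pose F := {ffun 'I_n -> 'I_B.+1}.
pose P (f : F) := `[< exists m', grade m' = grade m /\
   forall i, (forall j, g j <> i) -> m' i = f i >].
have WE m' (f : F) : (forall i, (forall j, g j <> i) -> m' i = f i) ->
    W m' = \sum_i height c i *+ f i.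
  move=> mf; apply: eq_bigr => i _.
  have [[j ji]|ig] := pselect (exists j, g j = i).
    by rewrite (_ : height c i = 0) ?mul0rn //; apply/(hc i).2; exists j.
  by rewrite mf // => j ji; apply: ig; exists j.
have Pm m' : W m' <= W m -> 
    exists f : F, forall i, (forall j, g j <> i) -> m' i = f i.
  move=> le; exists [ffun i => inord (m' i)] => i ig.
  by rewrite ffunE inordK // ltnS (bB _ le).
have [f0 f0P] := Pm m (lexx _).
have Pf0 : P f0 by apply/asboolP; exists m.
have [f /asboolP[m' [gr mf]] fmin] := @arg_minP _ _ _ f0 P (fun f => \sum_i height c i *+ f i) Pf0.
exists m'; split=> //; last by move=> i /mf ->; rewrite -ltnS.
apply: minimizer_standard => m'' gr'; rewrite (height_weight_le _ c gr').
rewrite -/(W m') -/(W m'') (WE _ _ mf).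
have [le|lt] := leP (W m'') (W m).
  have [f'' mf''] := Pm _ le; rewrite (WE _ _ mf''); apply: fmin.
  by apply/asboolP; exists m''; rewrite gr' gr.
apply: le_trans (ltW lt); rewrite (WE _ _ f0P); exact: fmin.
Qed.

(** The standard monomials of the degrees of [mu + one k] all have off-chart exponents at most [B].
    A part [f] recurring for infinitely many [k] is the required [al], since the chart exponents
    grow with [k]. *)
Lemma chart_pair_exists (z : 'cV[int]_d) :
  exists al y, chart_pair al /\ z = grade al + Ag *m y.
Proof.
have [u0 u0z] := hA z; pose D := \det Ag.
pose ab : 'cV[int]_n := \col_i `|u0 i 0|.
(* Adding D^2 |u0| makes the exponents nonnegative, D^2 being at least 1, and keeps the class:
   multiples of [D] lie in the image of [Ag] by the adjugate. *)
pose mu : 'X_{1..n} := [multinom absz (u0 i 0 + D ^+ 2 * `|u0 i 0|)%R | i < n].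
have D2 : 1 <= D ^+ 2 by rewrite -gtz0_ge1 exprn_even_gt0.
have muE : mnm_col mu = u0 + D ^+ 2 *: ab.
  apply/matrixP => i j; rewrite ord1 !mxE mnmE gez0_abs //.
  have : `|u0 i 0| <= D ^+ 2 * `|u0 i 0| by rewrite ler_peMl.
  lia.
pose y1 := D *: (\adj Ag *m (A *m ab)).
have grmu : grade mu = z + Ag *m y1.
  rewrite /grade muE mulmxDr u0z /y1; congr (_ + _).
  by rewrite -!scalemxAr mulmxA mul_mx_adj mul_scalar_mx scalerA expr2.
have [B bB] := chart_offset_bound mu.
pose one k : 'X_{1..n} := chart_mnm (fun=> k).
have Wone k : W (mu + one k) = W mu.
  apply: eq_bigr => i _; rewrite mnmDE mulrnDr.
  have [->|/chart_mnm_support/(hc i).2 ->] := eqVneq (one k i) 0%N.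
    by rewrite mulr0n addr0.
  by rewrite !mul0rn addr0.
have /choice[mk hmk] : forall k, exists m', [/\ grade m' = grade (mu + one k)%MM, std m' &
     forall i, (forall j, g j <> i) -> (m' i <= B)%N].
  by move=> k; apply: standard_in_grade => m' le; apply: bB; rewrite -(Wone k).
pose F := {ffun 'I_n -> 'I_B.+1}.
have /choice[fk hfk] : forall k, exists f : F, forall i, (forall j, g j <> i) -> mk k i = f i.
  move=> k; exists [ffun i => inord (mk k i)] => i ig.
  by rewrite ffunE inordK // ltnS; case: (hmk k) => _ _; apply.
have [f finf] : exists f, forall N, exists2 k, (N <= k)%N & fk k = f.
  apply: contrapT => no.
  have /choice[Nf hN] : forall f, exists N, forall k, fk k = f -> (k < N)%N.
    move=> f; apply: contrapT => nN; apply: no; exists f => N.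
    apply: contrapT => nk; apply: nN; exists N => k kf; rewrite ltnNge.
    by apply/negP => Nk; apply: nk; exists k.
  have := hN _ (\sum_f Nf f)%N erefl; rewrite ltnNge => /negP; apply.
  exact: leq_bigsum_one.
pose al : 'X_{1..n} := [multinom (if [exists j, g j == i] then 0 else f i)%N | i < n].
have al0 j : al (g j) = 0%N.
  by rewrite mnmE ifT //; apply/existsP; exists j.
have alN i : (forall j, g j <> i) -> al i = f i.
  by move=> ig; rewrite mnmE ifF //; apply/existsP => -[j /eqP]; apply: ig.
have mkE k : fk k = f -> mk k = (al + chart_mnm (fun j => mk k (g j)))%MM.
  move=> kf; apply/mnmP => i; rewrite mnmDE.
  have [[j <-]|ig] := pselect (exists j, g j = i); first by rewrite al0 chart_mnmE.
  have ig' j : g j <> i by move=> ji; apply: ig; exists j.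
  rewrite alN // -kf -hfk //.
  suff -> : chart_mnm (fun j => mk k (g j)) i = 0%N by rewrite addn0.
  by apply/eqP; apply: contra_notT ig => /chart_mnm_support.
have grk k : fk k = f -> z + Ag *m (y1 + const_mx k%:Z) =
    grade al + Ag *m \col_j (mk k (g j))%:Z.
  move=> kf; rewrite -grade_chart_mnm -gradeD -mkE //; case: (hmk k) => -> _ _.
  rewrite gradeD grmu mulmxDr addrA; congr (_ + _).
  by rewrite grade_chart_mnm; congr (_ *m _); apply/matrixP => a b; rewrite !mxE.
have [k0 _ k0f] := finf 0%N.
(* Two indices with the same off-chart part differ only along the chart, where injectivity of [Ag]
   forces a growth of exactly k - k0. *)
have mkj k j : fk k = f -> (mk k (g j))%:Z = (mk k0 (g j))%:Z + k%:Z - k0%:Z.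
  move=> kf; have /chart_kernel : Ag *m (\col_j (mk k (g j))%:Z - \col_j (mk k0 (g j))%:Z
     - const_mx k%:Z + const_mx k0%:Z) = 0.
    have := grk _ kf; have := grk _ k0f.
    rewrite !mulmxDr !mulmxN.
    move: (Ag *m _) (Ag *m _) (Ag *m _) (Ag *m _) (Ag *m _) (grade al) => a1 a2 a3 a4 a5 a6.
    move=> /matrixP E0 /matrixP E1; apply/matrixP => a b.
    have := E0 a b; have := E1 a b; rewrite !mxE.
    move: (z a b) (a1 a b) (a2 a b) (a3 a b) (a4 a b) (a5 a b) (a6 a b); clear; lia.
  by move=> /matrixP/(_ j 0); rewrite !mxE; lia.
exists al, (\col_j (mk k0 (g j))%:Z - y1 - const_mx k0%:Z); split; last first.
  have := grk _ k0f; rewrite !mulmxDr !mulmxN.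
  move: (Ag *m _) (Ag *m _) (Ag *m _) (grade al) => a1 a2 a3 a4 /matrixP E.
  by apply/matrixP => a b; have := E a b; rewrite !mxE;
     move: (z a b) (a1 a b) (a2 a b) (a3 a b) (a4 a b); clear; lia.
split=> // m ms.
(* For this [k] every chart exponent of [mk k] is at least that of [m], so [al + m] divides a
   standard monomial. *)
have [k k0k kf] := finf (k0 + \sum_i m i)%N.
have [_ stk _] := hmk k; move: stk; rewrite (mkE _ kf).
have -> : (al + chart_mnm (fun j => mk k (g j)) =
  (al + m) + chart_mnm (fun j => (mk k (g j) - m (g j))%N))%MM.
  apply/mnmP => i; rewrite !mnmDE -addnA; congr (_ + _)%N.
  have [[j <-]|ig] := pselect (exists j, g j = i).
    rewrite !chart_mnmE subnKC //.
    have := mkj _ j kf; have := leq_bigsum_one m (g j); lia.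
  have z0 yy : chart_mnm yy i = 0%N.
    by apply/eqP; apply: contra_notT ig => /chart_mnm_support.
  by rewrite !z0 addn0; apply/esym/eqP; apply: contra_notT ig => /ms.
exact: standardD.
Qed.

Lemma chart_pairs_enum : exists l : seq 'X_{1..n},
  [/\ uniq l, size l = `|\det Ag|%N & forall al, al \in l <-> chart_pair al].
Proof.
have [r [ur sr rex runiq]] := lattice_transversal gdet.
have /choice[f hf] : forall z, exists al, exists y, chart_pair al /\ z = grade al + Ag *m y.
  exact: chart_pair_exists.
exists (map f r); split; rewrite ?size_map //.
  rewrite map_inj_in_uniq // => x x' xr xr' fxx'.
  have [y [_ xE]] := hf x; have [y' [_ xE']] := hf x'.
  apply: runiq => //; exists (y - y'); rewrite {1}xE {1}xE' fxx' mulmxBr.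
  by rewrite -addrA [Ag *m y' + _]addrC subrK.
move=> al; split=> [/mapP[x _ ->]|pal]; first by have [y []] := hf x.
have [x xr [y yE]] := rex (grade al); apply/mapP; exists x => //.
have [y' [px xE]] := hf x.
by apply: (@chart_pair_inj _ _ (y' + y)) => //; rewrite yE {1}xE mulmxDr addrA.
Qed.

End ChartPairs.

(** * Monomial ideals and coordinate planes *)

Section MonomialIdeals.
Variables (K : fieldType) (n : nat).
Implicit Types (p q f : {mpoly K[n]}) (m u : 'X_{1..n}) (s : {set 'I_n}).

Lemma monomial_left_ideal (Q : 'X_{1..n} -> Prop) :
  (forall m m', Q m -> Q (m' + m)%MM) ->
  left_ideal (fun f : {mpoly K[n]} => forall m, m \in msupp f -> Q m).
Proof.
move=> Qup; split=> [m|p q hp hq m|p q hq m]; first by rewrite msupp0.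
  by move=> /msuppD_le; rewrite mem_cat => /orP[/hp|/hq].
by move=> /msuppM_le/allpairsP[[m1 m2] /= [_ /hq Qm2 ->]]; apply: Qup.
Qed.

Lemma monomial_ideal_gen S f :
  (forall m, m \in msupp f -> exists m1 m2, m = (m1 + m2)%MM /\ S 'X_[m2]) ->
  ideal_gen S f.
Proof.
move=> hf J lJ SJ; have [J0 JD JM] := lJ; rewrite [f]mpolyE big_seq.
elim/big_ind: _ => // m /hf[m1 [m2 [-> /SJ Jm2]]].
by rewrite mpolyXD scalerAl; apply: JM.
Qed.

Lemma coordinate_idealP s f : coordinate_ideal s f <->
  forall m, m \in msupp f -> exists2 i, i \notin s & m i != 0%N.
Proof.
split=> [|hf]; last first.
  apply: monomial_ideal_gen => m /hf[i si mi]; exists (m - U_(i))%MM, U_(i)%MM.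
  by rewrite submK ?lep1mP //; split=> //; exists i.
move=> /(_ (fun f => forall m, m \in msupp f -> exists2 i, i \notin s & m i != 0%N)).
apply; first apply: monomial_left_ideal => m m' [i si mi].
  by exists i => //; rewrite mnmDE addn_eq0 negb_and mi orbT.
move=> _ [i si ->] m; rewrite msuppX inE => /eqP ->; exists i => //.
by rewrite mnm1E eqxx.
Qed.

Definition coordinate_proj s : {mpoly K[n]} -> {mpoly K[n]} :=
  mmap (@mpolyC n K) (fun i => if i \in s then 'X_i else 0).

Lemma mcoeff_coordinate_proj s f m : (coordinate_proj s f)@_m =
  if [forall i, (m i != 0%N) ==> (i \in s)] then f@_m else 0.
Proof.
pose b : bool := [forall i, (m i != 0%N) ==> (i \in s)].
apply: (eq_linear_mpoly (V := K^o) (f := fun f => (coordinate_proj s f)@_m)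
         (g := fun f => if b then f@_m else 0)) => [c u v|c u v|k].
- by rewrite /coordinate_proj mmapD mmapZ /= mul_mpolyC mcoeffD mcoeffZ.
- by case: b; rewrite ?mcoeffD ?mcoeffZ // scaler0 addr0.
rewrite /coordinate_proj mmapX /mmap1 mcoeffX /b.
have [ks|] := boolP [forall i, (k i != 0%N) ==> (i \in s)].
  rewrite (eq_bigr (fun i => 'X_i ^+ k i)) => [|i _].
    rewrite -mpolyXE_id mcoeffX; case: eqP => [<-|_]; first by rewrite ks.
    by case: ifP.
  case: ifP => // si; have /forallP/(_ i) := ks; rewrite si implybF negbK => /eqP ->.
  by rewrite !expr0.
rewrite negb_forall => /existsP[a]; rewrite negb_imply => /andP[ka sa].
rewrite (bigD1 a) //= (negPf sa) expr0n (negPf ka) mul0r mcoeff0.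
case: eqP => [km|_]; last by case: ifP.
by case: ifP => // /forallP/(_ a); rewrite -km ka (negPf sa).
Qed.

Lemma coordinate_ideal_proj s f : coordinate_ideal s f <-> coordinate_proj s f = 0.
Proof.
rewrite coordinate_idealP; split=> [hf|f0 m].
  apply/mpolyP => m; rewrite mcoeff_coordinate_proj mcoeff0.
  case: ifP => // /forallP ms; apply: contrapT => /eqP.
  rewrite -mcoeff_msupp => /hf[i si mi].
  by have := ms i; rewrite mi (negPf si).
rewrite mcoeff_msupp => fm; apply: contrapT => no.
have := congr1 (mcoeff m) f0; rewrite mcoeff_coordinate_proj mcoeff0 ifT => [/eqP|].
  by rewrite (negPf fm).
apply/forallP => i; apply/implyP => mi; apply: contrapT => /negP si.
by apply: no; exists i.
Qed.

(** It is the kernel of the ring morphism that sets the variables outside [s] to 0, with values in a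
    domain. *)
Lemma coordinate_ideal_prime s : prime_ideal (@coordinate_ideal K n s).
Proof.
split.
- split=> [J [J0 _ _] _ //|p q hp hq J lJ SJ|p q hq J lJ SJ].
    by have [_ JD _] := lJ; apply: JD; [apply: hp|apply: hq].
  by have [_ _ JM] := lJ; apply: JM; apply: hq.
- move=> /coordinate_ideal_proj; rewrite /coordinate_proj rmorph1 => /eqP.
  by rewrite oner_eq0.
move=> p q /coordinate_ideal_proj; rewrite /coordinate_proj rmorphM => /eqP.
by rewrite mulf_eq0 => /orP[] /eqP h; [left|right]; apply/coordinate_ideal_proj.
Qed.

Lemma prime_ideal_monomial (Q : {mpoly K[n]} -> Prop) m : prime_ideal Q ->
  Q 'X_[m] -> exists2 i, m i != 0%N & Q 'X_i.
Proof.
move=> [lQ Q1 QM]; rewrite mpolyXE_id.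
have pow i (j : nat) : Q ('X_i ^+ j) -> j != 0%N /\ Q 'X_i.
  elim: j => [/Q1//|j IHj]; rewrite exprS => /QM[//|/IHj[]//].
elim/big_rec: _ => // i y _ IH /QM[/pow[mi Qi]|//].
by exists i.
Qed.

End MonomialIdeals.

Section ZariskiPlanes.
Variables (K : numFieldType) (n : nat).
Implicit Types (p q f : {mpoly K[n]}) (m u al : 'X_{1..n}) (s : {set 'I_n}) (x y z : 'cV[K]_n).
Local Notation "p .[@ z ]" := (p.@[fun i => z i 0]) (at level 2, format "p .[@ z ]").

Lemma poly_nat_eq0 (q : {poly K}) : (forall k : nat, q.[k%:R] = 0) -> q = 0.
Proof.
move=> q0; apply/eqP; apply: contraT => nz.
have := @max_poly_roots _ q [seq k%:R | k <- iota 0 (size q)] nz.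
rewrite size_map size_iota ltnn map_inj_uniq ?iota_uniq; last first.
  by move=> j k /eqP; rewrite eqr_nat => /eqP.
by apply=> //; apply/allP => _ /mapP[k _ ->]; apply/eqP.
Qed.

Lemma line_poly p x y : exists q : {poly K}, forall t, q.[t] = p.[@ (x + t *: y)].
Proof.
exists (mmap (@polyC K) (fun i => (x i 0)%:P + (y i 0) *: 'X) p) => t.
apply: (eq_linear_mpoly (V := K^o)
  (f := fun p => (mmap (@polyC K) (fun i => (x i 0)%:P + (y i 0) *: 'X) p).[t])
  (g := fun p => p.[@ (x + t *: y)])) => [c u v|c u v|m].
- by rewrite mmapD mmapZ /= !hornerE.
- by rewrite mevalD mevalZ.
rewrite mmapX mevalX /mmap1 horner_prod; apply: eq_bigr => i _.
by rewrite horner_exp !hornerE !mxE [t * _]mulrC.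
Qed.

(** The eigenvalue of x^u d^u on x^z. At a lattice point it vanishes unless [u] is below that point,
    so it turns divisibility into a polynomial condition. *)
Definition falling_poly u : {mpoly K[n]} :=
  \prod_(i < n) \prod_(j < u i) ('X_i - (j%:R)%:MP).

Lemma meval_falling_poly u z :
  (falling_poly u).[@ z] = \prod_(i < n) \prod_(j < u i) (z i 0 - j%:R).
Proof.
rewrite rmorph_prod; apply: eq_bigr => i _ /=; rewrite rmorph_prod.
by apply: eq_bigr => j _ /=; rewrite mevalB mevalXU mevalC.
Qed.

Lemma falling_poly_lattice u m : ~ (forall i, (u i <= m i)%N) ->
  (falling_poly u).[@ (mnm_point K m)] = 0.
Proof.
move=> um; have [i lt] : exists i, (m i < u i)%N.
  apply: contrapT => no; apply: um => i; rewrite leqNgt; apply/negP => lt.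
  by apply: no; exists i.
rewrite meval_falling_poly (bigD1 i) //= (bigD1 (Ordinal lt)) //= mxE subrr.
by rewrite !mul0r.
Qed.

Lemma irreducible_set_prod (I : eqType) (r : seq I) (P : I -> {mpoly K[n]}) Z :
    irreducible_set Z -> (forall z, Z z -> (\prod_(i <- r) P i).[@ z] = 0) ->
  exists2 i, i \in r & forall z, Z z -> (P i).[@ z] = 0.
Proof.
move=> [[z0 Zz0] Zirr]; elim: r => [|i r IH] hr.
  by have := hr _ Zz0; rewrite big_nil meval1 => /eqP; rewrite oner_eq0.
have closedV p : zariski_closed (fun z => p.[@ z] = 0).
  by move=> z; apply.
case: (Zirr _ _ (closedV (P i)) (closedV (\prod_(i <- r) P i))) => [z Zz|Pi|Pr].
- have := hr _ Zz; rewrite big_cons mevalM => /eqP; rewrite mulf_eq0.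
  by case/orP => /eqP; [left|right].
- by exists i; rewrite // mem_head.
- by have [k kr Pk] := IH Pr; exists k; rewrite // inE kr orbT.
Qed.

Lemma irreducible_set_falling u Z : irreducible_set Z ->
    (forall z, Z z -> (falling_poly u).[@ z] = 0) ->
  exists i (k : nat), (k < u i)%N /\ forall z, Z z -> z i 0 = k%:R.
Proof.
move=> Zirr /(irreducible_set_prod Zirr)[i _].
move=> /(irreducible_set_prod Zirr)[k _ hk]; exists i, k; split=> // z /hk/eqP.
by rewrite mevalB mevalXU mevalC subr_eq0 => /eqP.
Qed.

(** If neither closed set contained the plane, join a point outside each by a line: the product of
    the two separating polynomials vanishes at all natural parameters, but neither factor is 0. *)
Lemma coordinate_plane_irreducible al s : irreducible_set (@coordinate_plane K n al s).
Proof.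
split=> [|F G Fc Gc FG]; first by exists (mnm_point K al) => i _; rewrite mxE.
have sep S x : zariski_closed S -> ~ S x -> exists2 p, 
    (forall y, S y -> p.[@ y] = 0) & p.[@ x] <> 0.
  move=> Sc nS; apply: contrapT => no; apply/nS/Sc => p hp.
  by apply: contrapT => px; apply: no; exists p.
apply: contrapT => /not_orP[/existsNP[x /not_implyP[Px Fx]] /existsNP[y /not_implyP[Py Gy]]].
have [p pF px] := sep _ _ Fc Fx; have [q qG qy] := sep _ _ Gc Gy.
have [p1 p1E] := line_poly p x (y - x); have [q1 q1E] := line_poly q x (y - x).
have /eqP : p1 * q1 = 0.
  apply: poly_nat_eq0 => k; rewrite hornerM p1E q1E.
  case: (FG (x + k%:R *: (y - x))) => [i si|/pF ->|/qG ->]; rewrite ?mul0r ?mulr0 //.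
  by rewrite !mxE Px // Py // subrr mulr0 addr0.
rewrite mulf_eq0 => /orP[] /eqP h0.
  by apply: px; have := p1E 0; rewrite h0 horner0 scale0r addr0.
by apply: qy; have := q1E 1; rewrite h0 horner0 scale1r addrC subrK.
Qed.

(** Coordinates in [s] are released from being natural numbers one at a time, [l] listing the
    released ones; each time a univariate polynomial vanishes at all naturals. *)
Lemma coordinate_plane_closure al s (S : 'X_{1..n} -> Prop) :
    (forall m, (forall i, m i != 0%N -> i \in s) -> S (al + m)%MM) ->
    (forall i, i \in s -> al i = 0%N) ->
  forall z, coordinate_plane al s z ->
    zariski_closure (fun z => exists2 u, S u & z = mnm_point K u) z.
Proof.
move=> hS al0 z Pz p hp.
suff vanish (l : seq 'I_n) : forall z, coordinate_plane al s z ->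
    (forall i, i \in s -> i \notin l -> exists k : nat, z i 0 = k%:R) -> p.[@ z] = 0.
  by apply: (vanish (enum 'I_n)) => // i _; rewrite mem_enum.
elim: l => [|i l IH] {Pz}z Pz hz.
  have /choice[k hk] : forall i, exists k : nat, i \in s -> z i 0 = k%:R.
    by move=> i; case: (boolP (i \in s)) => [/hz[//|k ->]|_]; [exists k|exists 0%N].
  apply: hp; exists (al + [multinom (if i \in s then k i else 0)%N | i < n])%MM.
    by apply: hS => i; rewrite mnmE; case: ifP.
  apply/matrixP => i j; rewrite ord1 mxE mnmDE mnmE.
  case: ifPn => si; first by rewrite al0 // add0n hk.
  by rewrite addn0 Pz.
have [si|si] := boolP (i \in s); last first.
  apply: IH => // j sj jl; apply: hz => //; rewrite inE negb_or jl andbT.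
  by apply: contraNneq si => <-.
have [q qE] := line_poly p (z - z i 0 *: delta_mx i 0) (delta_mx i 0).
have qz : q = 0.
  apply: poly_nat_eq0 => k; rewrite qE; apply: IH => j sj.
    rewrite !mxE Pz // (_ : j == i = false) ?mulr0 ?subr0 ?addr0 //.
    by apply: contraNF sj => /eqP ->.
  move=> jl; rewrite !mxE eqxx andbT; have [->|ji] := eqVneq j i.
    by exists k; rewrite !mulr1 subrr add0r.
  have [|k' k'E] := hz j sj; first by rewrite inE negb_or ji.
  by exists k'; rewrite !mulr0 subr0 addr0.
by have := qE (z i 0); rewrite qz horner0 subrK.
Qed.

End ZariskiPlanes.

(** * Facets and top-dimensional pairs *)

Section TopStandardPairs.
Variable R : realType.
Local Notation C := R[i].
Variables (d n : nat) (A : 'M[int]_(d, n)) (beta : 'cV[C]_d) (w : 'cV[R]_n).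
Local Notation I_A := (@toric_ideal R d n A).
Local Notation M := (initial_ideal w I_A).
Local Notation grade := (grade A).
Local Notation std := (standard A w).
Local Notation height := (height A w).
Hypotheses (hw : weight_vector A beta w) (hA : columns_generate A).
Implicit Types (m u al : 'X_{1..n}) (s : {set 'I_n}) (t : {set 'I_(1 + n)}).

Definition link t : {set 'I_n} := [set i | rshift 1 i \in t].

Lemma initial_ideal_mulX u m : M 'X_[u] -> (forall i, (u i <= m i)%N) -> M 'X_[m].
Proof.
move=> Mu um; have <- : (m - u + u = m)%MM.
  by apply/mnmP => i; rewrite mnmDE mnmBE subnK.
rewrite mpolyXD => J lJ SJ; have [_ _ JM] := lJ.
by apply: JM; apply: Mu.
Qed.

Lemma initial_ideal_sub_coordinate s :
  (forall m, (forall i, m i != 0%N -> i \in s) -> std m) ->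
  forall f, M f -> coordinate_ideal s f.
Proof.
move=> hs f Mf; apply/coordinate_idealP => m mf; apply: contrapT => no.
apply: (hs m) => [i mi|]; last exact: initial_ideal_monomial hw _ _ Mf mf.
by apply: contrapT => /negP si; apply: no; exists i.
Qed.

(** If [al + m] were in [M], its falling factorial would vanish on all standard exponents, hence on
    their closure and on the plane; it is nonzero at a suitable point of the plane. *)
Lemma standard_pair_standard al s : standard_pair M al s ->
  (forall i, i \in s -> al i = 0%N) /\
  forall m, (forall i, m i != 0%N -> i \in s) -> std (al + m)%MM.
Proof.
move=> [[_ sub _] min]; split=> [i si|m ms Mm].
  apply/eqP; rewrite -leqn0.
  have := min [multinom (if i \in s then 0 else al i)%N | i < n] _ i.
  rewrite mnmE si; apply => j js; rewrite mxE mnmE (negPf js) //.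
(* -1 is no root of a falling factorial, and off [s], where m_i = 0, al_i - j is nonzero for j <
   al_i. *)
pose z : 'cV[C]_n := \col_i (if i \in s then -1 else (al i)%:R).
have Pz : coordinate_plane al s z by move=> i /negPf si; rewrite mxE si.
have := sub z Pz (falling_poly C (al + m)%MM); rewrite meval_falling_poly => h.
have /eqP : \prod_(i < n) \prod_(j < (al + m)%MM i) (z i 0 - j%:R) = 0.
  apply: h => _ [u su ->]; apply: falling_poly_lattice => um.
  exact: su (initial_ideal_mulX Mm um).
apply/negP/prodf_neq0 => i _; apply/prodf_neq0 => j _; rewrite mxE.
case: ifPn => si.
  by rewrite -opprD oppr_eq0 nat1r pnatr_eq0.
rewrite subr_eq0 eqr_nat; apply: contraTneq (ltn_ord j) => <-.
rewrite mnmDE -leqNgt (_ : m i = 0%N) ?addn0 //.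
by apply: contraNeq si => /ms.
Qed.

Lemma standard_pair_face al s : standard_pair M al s ->
  forall m, (forall i, m i != 0%N -> i \in s) -> std m.
Proof.
by move=> /standard_pair_standard[_ h] m /h; rewrite addmC; apply: standardD.
Qed.

(** A face of standard monomials extends to a facet [t]. The prime of [link t] contains [M] and lies
    in that of [s]; minimality of the latter gives equality. *)
Lemma top_standard_pair_facet al s : top_standard_pair M al s ->
  exists2 t, facet A (rho_weight w) t /\ ord0 \in t & s = link t.
Proof.
move=> [sp [_ _ pmin]]; have face := standard_pair_face sp.
have [c [h0 hs]] := standard_lower_face hw face.
pose t0 := ord0 |: [set rshift 1 i | i in [set i | height c i == 0]].
have t0S j : (rshift 1 j \in t0) = (height c j == 0).
  rewrite !inE -val_eqE /=; apply/imsetP/eqP => [[l]|hj].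
    by rewrite inE => /eqP hl /(@rshift_inj 1 n) ->.
  by exists j; rewrite // inE hj.
have t00 : ord0 \in t0 by rewrite !inE eqxx.
have /lower_face_sub_facet[t ft t0t] : lower_face A (rho_weight w) t0.
  apply/lower_faceP => //; exists c => i; split=> //; rewrite t0S.
  by split=> /eqP.
have tt0 := subsetP t0t _ t00; exists t => //.
have st : s \subset link t.
  by apply/subsetP => i si; rewrite inE; apply/(subsetP t0t); rewrite t0S hs.
have [g [c' [_ _ _ hc' tg]]] := facet_structure hw hA ft tt0.
have face' m : (forall i, m i != 0%N -> i \in link t) -> std m.
  move=> ms; apply: (@support_standard _ _ _ _ _ c') => [i|i /ms]; first by case: (hc' i).
  by rewrite inE => /tg/((hc' i).2).
apply/eqP; rewrite eqEsubset st; apply/subsetP => i it.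
apply: contraT => si.
have : coordinate_ideal (link t) ('X_i : {mpoly C[n]}).
  apply: (pmin (coordinate_ideal (link t))).
  - exact: coordinate_ideal_prime.
  - exact: initial_ideal_sub_coordinate.
  - move=> f /coordinate_idealP hf; apply/coordinate_idealP => m /hf[j jt mj].
    by exists j => //; apply: contra jt; apply/subsetP.
  - by move=> J lJ; apply; exists i.
move=> /coordinate_idealP/(_ U_(i)%MM); rewrite msuppX inE eqxx => /(_ isT)[j jt].
by rewrite mnm1E; have [ij|//] := eqVneq i j; rewrite ij (negPf jt) in it.
Qed.

Section Chart.
Variables (g : 'I_d -> 'I_n) (c : 'rV[R]_d).
Hypotheses (ginj : injective g) (gdet : \det (colsub g A) != 0).
Hypothesis (hc : forall i, 0 <= height c i /\ (height c i = 0 <-> exists j, g j = i)).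
Local Notation Ag := (colsub g A).

(** By the adjugate, D^2 a_i is an integral combination of chart columns; the square makes the
    multiplier positive. Split by sign, this gives two monomials of one degree, and the one
    containing [i] has positive total height, the other height 0. *)
Lemma chart_power i : (forall j, g j <> i) ->
  exists2 u : 'X_{1..n}, M 'X_[u] & forall k, u k != 0%N -> k = i \/ exists j, g j = k.
Proof.
move=> ig; pose D := \det Ag.
have [y Agy] : exists y, Ag *m y = D ^+ 2 *: col i A.
  exists (D *: (\adj Ag *m col i A)).
  by rewrite -scalemxAr mulmxA mul_mx_adj mul_scalar_mx scalerA expr2.
pose yp j := absz (Num.max (y j 0) 0); pose yn j := absz (Num.max (- y j 0) 0).
pose N := absz (D ^+ 2).
have N0 : (0 < N)%N by rewrite absz_gt0 expf_neq0.
have NE : N%:Z = D ^+ 2 by rewrite gez0_abs // sqr_ge0.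
rewrite -NE in Agy.
have colE : grade U_(i) = col i A.
  apply/matrixP => a b; rewrite ord1 !mxE (bigD1 i) //= big1 ?addr0 => [|k ki].
    by rewrite !mxE mnm1E eqxx mulr1.
  by rewrite !mxE mnm1E eq_sym (negPf ki) mulr0.
have gradeMn m k : grade (m *+ k)%MM = k%:Z *: grade m.
  elim: k => [|k IH].
    rewrite mulm0n scale0r; apply/matrixP => a b; rewrite !mxE big1 // => l _.
    by rewrite !mxE mnm0E mulr0.
  by rewrite mulmS gradeD IH intS scalerDl scale1r.
pose u := (U_(i) *+ N + chart_mnm g yn)%MM; pose u' := chart_mnm g yp.
have gr : grade u = grade u'.
  rewrite gradeD gradeMn colE -Agy !grade_chart_mnm // -mulmxDr; congr (_ *m _).
  by apply/matrixP => j k; rewrite ord1 !mxE /yp /yn; move: (y j 0) => z; clear; lia.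
exists u; last first.
  move=> k; rewrite /u mnmDE mulmnE mnm1E; have [->|ik] := eqVneq i k; first by left.
  by rewrite add0n => /chart_mnm_support; right.
apply: (initial_ideal_binomial gr); rewrite ltNge (height_weight_le _ c (esym gr)).
rewrite -ltNge.
have W0 yy : \sum_k height c k *+ chart_mnm g yy k = 0.
  apply: big1 => k _; have [->|/chart_mnm_support/((hc k).2) ->] := eqVneq (chart_mnm g yy k) 0%N.
    by rewrite mulr0n.
  by rewrite mul0rn.
rewrite W0; under eq_bigr do rewrite mnmDE mulrnDr.
rewrite big_split /= W0 addr0 (bigD1 i) //= big1 ?addr0 => [|k ki].
  rewrite mulmnE mnm1E eqxx mul1n pmulrn_lgt0 // lt_def; case: (hc i) => -> h.
  by rewrite andbT; apply/eqP => /h[j]; apply: ig.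
by rewrite mulmnE mnm1E eq_sym (negPf ki) mul0n mulr0n.
Qed.

(** [chart_power] serves twice. An irreducible set between the plane and the closure has a constant
    natural coordinate among those of [u]; it is [i], as chart coordinates reach -1 on the plane.
    Likewise a prime over [M] inside the coordinate ideal contains a variable of [u], again [i]. *)
Lemma chart_pair_top al s : (forall i, i \in s <-> exists j, g j = i) ->
  chart_pair A w g al -> top_standard_pair M al s.
Proof.
move=> sg [al0 als].
have al0' i : i \in s -> al i = 0%N by move=> /sg[j <-].
have als' m : (forall i, m i != 0%N -> i \in s) -> std (al + m)%MM.
  by move=> ms; apply: als => i /ms/sg.
have face m : (forall i, m i != 0%N -> i \in s) -> std m.
  by move=> /als'; rewrite addmC; apply: standardD.
have notin i : i \notin s -> forall j, g j <> i.
  by move=> /negP si j ji; apply/si/sg; exists j.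
split; [split; [split|]|split].
- exact: coordinate_plane_irreducible.
- exact: coordinate_plane_closure.
- move=> Z Zirr ZX PZ z Zz i si.
  have [u Mu us] := chart_power (notin _ si).
  have [|k [b [bu Zk]]] := irreducible_set_falling (u := u) Zirr.
    move=> y /ZX; apply => _ [m sm ->]; apply: falling_poly_lattice => um.
    exact: sm (initial_ideal_mulX Mu um).
  have [ki|[j jk]] : k = i \/ exists j, g j = k by apply: us; case: (u k) bu.
    have Zal : Z (mnm_point C al) by apply: PZ => l _; rewrite mxE.
    by rewrite -ki Zk // -(Zk _ Zal) mxE.
  have ks : k \in s by apply/sg; exists j.
  have /Zk : Z (\col_l (if l \in s then -1 else (al l)%:R)).
    by apply: PZ => l /negPf ls; rewrite mxE ls.
  rewrite mxE ks => /eqP; rewrite eq_sym -subr_eq0 opprK natr1 pnatr_eq0.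
  by [].
- move=> u Pu i; have [si|si] := boolP (i \in s); first by rewrite al0'.
  by have := Pu i si; rewrite mxE => /eqP; rewrite eqr_nat => /eqP ->.
- exact: coordinate_ideal_prime.
- exact: initial_ideal_sub_coordinate.
move=> Q Qp MQ Qs f hf; have [lQ _ _] := Qp; apply: hf => // _ [i si ->].
have [u Mu us] := chart_power (notin _ si).
have [k uk Qk] := prime_ideal_monomial Qp (MQ _ Mu).
have [<-//|[j jk]] := us _ uk.
have /coordinate_idealP/(_ U_(k)%MM) := Qs _ Qk.
rewrite msuppX inE eqxx => /(_ isT)[l ls]; rewrite mnm1E; have [kl|//] := eqVneq k l.
by move/negP: ls; case; apply/sg; exists j; rewrite jk.
Qed.

End Chart.

End TopStandardPairs.

(** * Canonical series and Nilsson solutions *)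

Section LatticeSeries.
Variables (K : numFieldType) (n : nat).
Implicit Types (v a : 'cV[K]_n) (u : 'cV[int]_n) (F : 'cV[int]_n -> K) (phi : log_series K n).

Lemma map_intr_inj : injective (map_mx intr : 'cV[int]_n -> 'cV[K]_n).
Proof.
move=> u u' /matrixP uu'; apply/matrixP => i j; have := uu' i j.
by rewrite !mxE => /intr_inj.
Qed.

Definition lattice_series v F : log_series K n := fun a =>
  if pselect (exists u, a = v + map_mx intr u) is left h
  then (F (projT1 (cid h)))%:MP else 0.

Lemma lattice_seriesE v F u : lattice_series v F (v + map_mx intr u) = (F u)%:MP.
Proof.
rewrite /lattice_series; case: pselect => [h|]; last by case; exists u.
by case: cid => u' /= /addrI/map_intr_inj ->.
Qed.

Lemma lattice_series_out v F a : (forall u, a <> v + map_mx intr u) ->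
  lattice_series v F a = 0.
Proof. by move=> h; rewrite /lattice_series; case: pselect => // E; case: (E) => u au; case: (h u). Qed.

Lemma lattice_series_d v F i : series_d i (lattice_series v F) =
  lattice_series v (fun u => (v i 0 + (u i 0 + 1)%:~R) * F (u + delta_mx i 0)).
Proof.
apply: funext => a; rewrite /series_d.
have dE : map_mx intr (delta_mx i 0 : 'cV[int]_n) = delta_mx i 0 :> 'cV[K]_n.
  by apply/matrixP => j k; rewrite !mxE; case: (_ && _).
have [[u ->]|nu] := pselect (exists u, a = v + map_mx intr u).
  rewrite -addrA -dE -map_mxD !lattice_seriesE mderivC addr0 -mul_mpolyC -mpolyCM.
  by rewrite !mxE !eqxx.
rewrite !lattice_series_out ?mderiv0 ?scaler0 ?addr0 // => u ua; apply: nu.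
  by exists u.
exists (u - delta_mx i 0); apply/(addIr (delta_mx i 0)).
by rewrite ua -addrA -dE -map_mxD subrK.
Qed.

(* The coefficients of the Gamma-series: [gam k] plays the part of
   [Gamma (v + 1) / Gamma (v + k + 1)]. *)
Lemma gamma_coefficients (v : K) :
    (forall k : int, v <> k%:~R) \/ (exists al : nat, v = al%:R) ->
  exists gam : int -> K, [/\ gam 0 != 0,
    forall k, (v + k%:~R) * gam k = gam (k - 1) &
    forall (al : nat) k, v = al%:R -> gam k != 0 -> 0 <= al%:Z + k].
Proof.
move=> [vint|[al ->]].
  have v0 (k : int) : v + k%:~R != 0.
    by apply/eqP => /eqP; rewrite addr_eq0 -intrN => /eqP; apply: vint.
  pose gam (k : int) : K := match k with
    | Posz k => (\prod_(j < k) (v + j.+1%:R))^-1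
    | Negz k => \prod_(j < k.+1) (v - j%:R) end.
  have g0 : gam 0 = 1 by rewrite -[gam 0]/(\prod_(j < 0) (v + j.+1%:R))^-1 big_ord0 invr1.
  exists gam; split=> [|[[|k]|k]|al k va]; rewrite /gam.
  - by rewrite -/(gam 0) g0 oner_eq0.
  - have -> : Posz 0 - 1 = Negz 0 by [].
    by rewrite big_ord0 invr1 mulr1 addr0 big_ord1 subr0.
  - have -> : Posz k.+1 - 1 = k by lia.
    by rewrite big_ord_recr /= invfM mulrCA mulfV ?mulr1 // (v0 k.+1).
  - have -> : Negz k - 1 = Negz k.+1 by lia.
    by rewrite [RHS]big_ord_recr /= mulrC NegzE intrN.
  - by case: (vint al).
(* The values 1/(al + k)! omit the constant al! and are cut to 0 below; the recursion survives the
   cut because its factor v + k vanishes there. *)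
pose gam (k : int) : K := if 0 <= al%:Z + k then (absz (al%:Z + k)%R)`!%:R^-1 else 0.
exists gam; split=> [|k|al' k]; rewrite /gam.
- by rewrite addr0 lez_nat leq0n invr_eq0 pnatr_eq0 -lt0n fact_gt0.
- have -> : al%:R + k%:~R = (al%:Z + k)%:~R :> K by rewrite intrD.
  rewrite addrA; case: (al%:Z + k) => [[|N]|N].
  + by rewrite /= mul0r.
  + have -> : N.+1%:Z - 1 = N by lia.
    by rewrite !lez_nat !leq0n /= factS natrM invfM mulrA mulfV ?mul1r // pnatr_eq0.
  + by rewrite mulr0.
by move=> /eqP; rewrite eqr_nat => /eqP ->; case: ifP => //; rewrite eqxx.
Qed.

End LatticeSeries.

Section HypergeometricAction.
Variable R : realType.
Local Notation C := R[i].
Variables (d n : nat) (A : 'M[int]_(d, n)) (beta : 'cV[C]_d).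
Implicit Types (phi : log_series C n) (m : 'X_{1..n}) (f : {mpoly C[n]}) (a v : 'cV[C]_n).

Lemma poly_d_act f phi a : weyl_act (poly_d f) phi a = lsum (fun m => dpow m phi a) f.
Proof.
rewrite /poly_d /lsum.
elim: (msupp f) => [|m s IH]; first by rewrite !big_nil weyl_act0.
rewrite !big_cons weyl_actDl weyl_actZl IH; congr (_ *: _ + _).
pose m' : 'X_{1..n + n} := [multinom (if split i is inr j then m j else 0%N) | i < n + n].
have m'l j : m' (lshift n j) = 0%N by rewrite mnmE (unsplitK (inl j)).
have m'r j : m' (rshift n j) = m j by rewrite mnmE (unsplitK (inr j)).
have -> : \prod_(i < n) weyl_d C i ^+ m i = Weyl 'X_[m'].
  rewrite weyl_monomialE [X in _ = X * _]big1 ?mul1r => [|j _]; last by rewrite m'l.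
  by apply: eq_bigr => j _; rewrite m'r.
rewrite weyl_actE lsumX; have -> : mnm_vec C (fun i => m' (lshift n i)) = 0.
  by apply/matrixP => i j; rewrite !mxE m'l.
by rewrite subr0; congr (dpow _ phi a); apply: funext => j.
Qed.

(** x_j d_j preserves the exponent [a] and acts on its polynomial as a_j + d/dy_j. *)
Lemma euler_act i phi a : weyl_act (euler R A i - (beta i 0)%:A) phi a =
  ((map_mx intr A *m a) i 0 - beta i 0) *: phi a +
  \sum_j (A i j)%:~R *: (phi a)^`M(j).
Proof.
rewrite -scaleNr weyl_actDl weyl_actZl weyl_act1 scaleNr scalerBl mxE.
rewrite [RHS]addrAC; congr (_ - _).
rewrite scaler_suml -big_split /= /euler.
elim/big_ind2: _ => [|x1 y1 x2 y2 h1 h2|j _]; first exact: weyl_act0.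
  by rewrite weyl_actDl h1 h2.
rewrite weyl_actZl weyl_act_x -[weyl_d C j]mulr1 /series_x weyl_act_d /series_d.
rewrite subrK weyl_act1 scalerDr scalerA mxE.
by congr (_ *: _ + _).
Qed.

End HypergeometricAction.

(** * Gamma-series *)

Section CanonicalSolutions.
Variable R : realType.
Local Notation C := R[i].
Variables (d n : nat) (A : 'M[int]_(d, n)) (beta : 'cV[C]_d) (w : 'cV[R]_n).
Local Notation H_A := (hypergeometric_ideal A beta).
Local Notation std := (standard A w).
Implicit Types (v : 'cV[C]_n) (al m : 'X_{1..n}) (s : {set 'I_n}) (u : 'cV[int]_n).

(** The support condition covers all cones at once, because the series will be subtracted from
    Nilsson solutions that come with cones of their own. *)
Definition canonical_coefficients v (F : 'cV[int]_n -> C) :=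
  [/\ is_solution H_A (lattice_series v F), F 0 != 0 &
    forall u, F u != 0 -> A *m u = 0 /\
      forall k (H : 'M[int]_(k, n)), weight_cone A beta w H -> 
        in_dual_cone H (map_mx intr u : 'cV[R]_n)].

Lemma canonical_coefficients_exist v al s :
    map_mx intr A *m v = beta -> coordinate_plane al s v ->
    (forall i, i \in s -> ~ exists z : int, v i 0 = z%:~R) ->
    (forall m, (forall i, m i != 0%N -> i \in s) -> std (al + m)%MM) ->
  exists F, canonical_coefficients v F.
Proof.
move=> Av vs vint als.
have /choice[gam hgam] : forall i, exists gam : int -> C, [/\ gam 0 != 0,
    forall k, (v i 0 + k%:~R) * gam k = gam (k - 1) &
    forall (al : nat) k, v i 0 = al%:R -> gam k != 0 -> 0 <= al%:Z + k].
  move=> i; apply: gamma_coefficients; have [si|si] := boolP (i \in s).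
    by left=> k vk; case: (vint i si); exists k.
  by right; exists (al i); apply: vs.
pose G u := \prod_i gam i (u i 0).
(* Restriction of the Gamma product to A u = b. Differentiation by x_i turns [F b] into
   [F (b - col i A)], so the effect of d^m depends only on the degree of [m], as [toric_lsum]
   demands. *)
pose F b u : C := if A *m u == b then G u else 0.
have dF b i : series_d i (lattice_series v (F b)) = lattice_series v (F (b - col i A)).
  rewrite lattice_series_d; congr lattice_series; apply: funext => u.
  rewrite /F mulmxDr -colE eq_sym -subr_eq eq_sym.
  case: eqP => _; last by rewrite mulr0.
  rewrite /G (bigD1 i) //= [RHS](bigD1 i) //= mulrA; congr (_ * _).
    have [_ rec _] := hgam i; rewrite !mxE !eqxx /= -[u i 0 in RHS](addrK 1) -rec.
    by rewrite mulr1n.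
  by apply: eq_bigr => j ji; rewrite !mxE (negPf ji) addr0.
have dpowF b m : dpow m (lattice_series v (F b)) = lattice_series v (F (b - grade A m)).
  have -> : grade A m = \sum_(i <- enum 'I_n) (m i)%:Z *: col i A.
    rewrite big_enum /=; apply/matrixP => x y; rewrite ord1 summxE mxE.
    by apply: eq_bigr => j _; rewrite !mxE mulrC.
  have it i k b' : iter k (series_d i) (lattice_series v (F b')) =
      lattice_series v (F (b' - k%:Z *: col i A)).
    elim: k => [|k IHk] /=; first by rewrite scale0r subr0.
    by rewrite IHk dF intS scalerDl scale1r [col i A + _]addrC opprD addrA.
  rewrite /dpow; elim: (enum _) => [|i l IH] /=; first by rewrite big_nil subr0.
  by rewrite big_cons IH it [_ + \sum_(_ <- _) _]addrC opprD addrA.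
have FE u : F 0 u != 0 -> A *m u = 0 /\ G u != 0.
  by rewrite /F; case: ifP => [/eqP//|]; rewrite eqxx.
exists (F 0); split.
- apply/is_solution_gen => P [[f If ->]|[i ->]] a.
    rewrite poly_d_act -[RHS](toric_lsum (fun b => lattice_series v (F (0 - b)) a) If).
    by apply: eq_lsum => m _; rewrite dpowF.
  rewrite euler_act; have [[u ->]|nu] := pselect (exists u, a = v + map_mx intr u).
    rewrite lattice_seriesE big1 ?addr0 => [|j _]; last by rewrite mderivC scaler0.
    have [->|/FE[Au _]] := eqVneq (F 0 u) 0; first by rewrite mpolyC0 scaler0.
    by rewrite mulmxDr Av -map_mxM Au map_mx0 addr0 subrr scale0r.
  rewrite lattice_series_out => [|u ua]; last by apply: nu; exists u.
  by rewrite scaler0 big1 ?addr0 // => j _; rewrite mderiv0 scaler0.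
- rewrite /F mulmx0 eqxx; apply/prodf_neq0 => i _; rewrite mxE.
  by case: (hgam i).
move=> u /FE[Au Gu]; split=> // k H Hw w' Hw'.
have al_u i : i \notin s -> 0 <= (al i)%:Z + u i 0.
  move=> si; have [_ _] := hgam i; apply; first exact: vs.
  by apply: contraNneq Gu => gi; rewrite /G (bigD1 i) //= gi mul0r.
(* Raising [al] by [N] on [s] makes m + u a monomial of the degree of the standard [m]; comparing
   their w'-weights gives w'.u >= 0. *)
pose N := (\sum_i absz (u i 0%R))%N.
pose m : 'X_{1..n} := (al + [multinom (if i \in s then N else 0)%N | i < n])%MM.
have m_u i : 0 <= (m i)%:Z + u i 0.
  rewrite /m mnmDE mnmE; case: ifPn => si; last by rewrite addn0 al_u.
  have : (absz (u i 0%R) <= N)%N by apply: leq_bigsum_one.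
  by move: (u i 0) => z; clear; lia.
pose m' : 'X_{1..n} := [multinom absz ((m i)%:Z + u i 0%R)%R | i < n].
have stm : std m by apply: als => i; rewrite mnmE; case: ifP.
have gr : grade A m' = grade A m.
  rewrite /grade (_ : mnm_col m' = mnm_col m + u); first by rewrite mulmxDr Au addr0.
  by apply/matrixP => i j; rewrite ord1 !mxE mnmE gez0_abs.
have := weight_cone_standard Hw Hw' stm gr; rewrite -subr_ge0 /weight -sumrB.
congr (0 <= _); apply: eq_bigr => i _; rewrite !mxE mnmE.
have -> : w' i 0 *+ absz ((m i)%:Z + u i 0)%R = w' i 0 * (m i)%:R + w' i 0 * (u i 0)%:~R.
  have natE : (absz ((m i)%:Z + u i 0)%R)%:R = ((m i)%:Z + u i 0)%:~R :> R.
    by rewrite [LHS]pmulrn gez0_abs.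
  by rewrite -[w' i 0 *+ _]mulr_natr natE intrD mulrDr.
by rewrite -[w' i 0 *+ _]mulr_natr addrC addKr mulrC.
Qed.

Lemma canonical_basic v F : weight_vector A beta w -> canonical_coefficients v F ->
  basic_nilsson A beta w (lattice_series v F).
Proof.
move=> [k [H Hw]] [sol F0 hF]; split=> //.
exists v, (fun u => F u != 0), (fun u => (F u)%:MP); split.
- by move=> u _; rewrite lattice_seriesE.
- move=> a ha; have [[u au]|nu] := pselect (exists u, a = v + map_mx intr u).
    rewrite au lattice_seriesE; have [->|Fu] := eqVneq (F u) 0; first exact: mpolyC0.
    by case: (ha u Fu).
  by apply: lattice_series_out => u ua; apply: nu; exists u.
- by exists k, H; split=> // u /hF[Au hu]; split=> //; apply: hu.
- by exists 1%N => u _; rewrite msizeC; case: (_ != 0).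
- by split=> // /eqP; rewrite mpolyC_eq0 (negPf F0).
Qed.

End CanonicalSolutions.

(** * Injectivity of derivatives on logarithmic terms *)

Section SeriesDerivatives.
Variables (K : numFieldType) (n : nat).
Implicit Types (p : {mpoly K[n]}) (a b : 'cV[K]_n) (phi psi : log_series K n)
  (e : 'I_n -> nat) (s : seq 'I_n).

(** The derivatives lower the degree, so the leading coefficient is just multiplied by [c]. *)
Lemma derivation_neq0 p c (f : 'I_n -> K) : c != 0 -> p != 0 ->
  c *: p + \sum_j f j *: p^`M(j) != 0.
Proof.
move=> c0 p0; apply/eqP => /(congr1 (mcoeff (mlead p))).
rewrite mcoeffD mcoeffZ raddf_sum /= mcoeff0 big1 ?addr0 => [/eqP|j _].
  by rewrite mulf_eq0 (negPf c0) /= mleadc_eq0 (negPf p0).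
rewrite mcoeffZ mcoeff_deriv (_ : p@_(_ + _) = 0) ?mul0rn ?mulr0 //.
apply: memN_msupp_eq0; apply: contraTN isT => /msize_mdeg_lt.
by rewrite mdegD mdeg1 addn1 mlead_deg // ltnn.
Qed.

Lemma series_d_neq0 p c i : c != 0 -> p != 0 -> c *: p + p^`M(i) != 0.
Proof.
move=> c0 p0; have := derivation_neq0 (fun j => (j == i)%:R) c0 p0.
rewrite (bigD1 i) //= eqxx scale1r big1 ?addr0 // => j /negPf ->.
by rewrite scale0r.
Qed.

Lemma mnm_vecE e : mnm_vec K e = \sum_(i <- enum 'I_n) (e i)%:R *: delta_mx i 0.
Proof.
rewrite big_enum /=; apply/matrixP => i j; rewrite ord1 summxE !mxE (bigD1 i) //=.
rewrite !mxE !eqxx mulr1 big1 ?addr0 // => k ki.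
by rewrite !mxE eq_sym (negPf ki) mulr0.
Qed.

Lemma shift_notin e s i : i \notin s ->
  (\sum_(j <- s) (e j)%:R *: delta_mx j 0 : 'cV[K]_n) i 0 = 0.
Proof.
move=> is_; rewrite summxE big_seq big1 // => j js; rewrite !mxE.
by rewrite (_ : i == j = false) ?mulr0 //; apply: contraNF is_ => /eqP ->.
Qed.

Lemma dpow_local e phi psi a : phi (a + mnm_vec K e) = psi (a + mnm_vec K e) ->
  dpow e phi a = dpow e psi a.
Proof.
rewrite mnm_vecE.
rewrite /dpow; elim: (enum _) a => [|i s IH] a; first by rewrite big_nil addr0.
rewrite big_cons addrA => /IH /=.
move: (iters _ e s phi) (iters _ e s psi) => f1 f2.
elim: (e i) a => [|k IHk] a; first by rewrite scale0r addr0.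
rewrite -nat1r scalerDl scale1r addrA => /IHk /= h.
by rewrite /series_d h.
Qed.

Lemma dpow_eq0 e phi a : phi (a + mnm_vec K e) = 0 -> dpow e phi a = 0.
Proof.
move=> h; rewrite (@dpow_local e phi (fun=> 0)) //.
rewrite /dpow; move: a {h}; elim: (enum _) => //= i s IH a.
elim: (e i) a => [|k IHk] a //=.
by rewrite /series_d IHk scaler0 mderiv0 addr0.
Qed.

Lemma iter_series_d_neq0 k i phi a : phi a != 0 ->
    (forall j, (j < k)%N -> a i 0 != j%:R) ->
  iter k (series_d i) phi (a - k%:R *: delta_mx i 0) != 0.
Proof.
move=> pa; elim: k => [|k IH] ak; first by rewrite scale0r subr0.
rewrite iterS /series_d -natr1 scalerDl scale1r opprD addrA subrK.
apply: series_d_neq0; last by apply: IH => j /ltnW; apply: ak.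
by rewrite !mxE !eqxx mulr1 subr_eq0 ak.
Qed.

Lemma mderiv_iter_series_d_neq0 l k i phi a : (phi a)^`M(l) != 0 ->
    (forall j, (j < k)%N -> a i 0 != j%:R) ->
  (iter k (series_d i) phi (a - k%:R *: delta_mx i 0))^`M(l) != 0.
Proof.
move=> pa; elim: k => [|k IH] ak; first by rewrite scale0r subr0.
rewrite iterS /series_d -natr1 scalerDl scale1r opprD addrA subrK.
rewrite mderivD mderivZ mderiv_comm.
apply: series_d_neq0; last by apply: IH => j /ltnW; apply: ak.
by rewrite !mxE !eqxx mulr1 subr_eq0 ak.
Qed.

(* Along direction [i] at most one of the factors [a i - j + d/dy_i] is not
   injective, namely the one that reduces to [d/dy_i]. *)
Lemma iter_series_d_log_neq0 k i phi a : (phi a)^`M(i) != 0 ->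
  iter k (series_d i) phi (a - k%:R *: delta_mx i 0) != 0.
Proof.
move=> pa; elim: k => [|k IH].
  by rewrite scale0r subr0 /=; apply: contraNneq pa => ->; rewrite mderiv0.
rewrite iterS /series_d -natr1 scalerDl scale1r opprD addrA subrK.
rewrite !mxE !eqxx mulr1; have [ak|ak] := eqVneq (a i 0) k%:R; last first.
  by apply: series_d_neq0; rewrite ?subr_eq0.
rewrite ak subrr scale0r add0r; apply: mderiv_iter_series_d_neq0 => // j jk.
by rewrite ak eqr_nat gtn_eqF.
Qed.

Lemma dpow_neq0 (m : 'X_{1..n}) phi a : phi a != 0 ->
    (forall i j, (j < m i)%N -> a i 0 != j%:R) ->
  dpow m phi (a - mnm_vec K m) != 0.
Proof.
move=> pa am; rewrite mnm_vecE /dpow.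
elim: (enum _) (enum_uniq 'I_n) => [|i s IH] /=; first by rewrite big_nil subr0.
move=> /andP[is_ us]; rewrite big_cons opprD [- _ - _]addrC addrA.
apply: iter_series_d_neq0 => [|j ji]; first exact: IH.
by rewrite !mxE shift_notin // subr0 am.
Qed.

Lemma dpow_log_neq0 (m : 'X_{1..n}) phi a l : (phi a)^`M(l) != 0 ->
    (forall i j, i != l -> (j < m i)%N -> a i 0 != j%:R) ->
  dpow m phi (a - mnm_vec K m) != 0.
Proof.
move=> pa am; rewrite mnm_vecE /dpow.
(* Until direction [l] is processed, the derivative in y_l must be kept nonzero as well, since a
   singular factor there acts as d/dy_l. *)
suff : iters (@series_d K n) m (enum 'I_n) phi
      (a - \sum_(i <- enum 'I_n) (m i)%:R *: delta_mx i 0) != 0 /\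
    (l \notin enum 'I_n -> (iters (@series_d K n) m (enum 'I_n) phi
      (a - \sum_(i <- enum 'I_n) (m i)%:R *: delta_mx i 0))^`M(l) != 0) by case.
elim: (enum _) (enum_uniq 'I_n) => [|i s IH] /=.
  by rewrite big_nil subr0; split=> //; apply: contraNneq pa => ->; rewrite mderiv0.
move=> /andP[is_ us]; have [h1 h2] := IH us.
rewrite big_cons opprD [- _ - _]addrC addrA inE.
have aj j : i != l -> (j < m i)%N ->
    (a - \sum_(i <- s) (m i)%:R *: delta_mx i 0) i 0 != j%:R.
  by move=> il ji; rewrite !mxE shift_notin // subr0 am.
split; last first.
  move=> /norP[li ls]; apply: mderiv_iter_series_d_neq0 => [|j]; first exact: h2.
  by apply: aj; rewrite eq_sym.
have [il|il] := eqVneq i l; last by apply: iter_series_d_neq0 => // j; apply: aj.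
by rewrite il in is_ *; apply: iter_series_d_log_neq0; apply: h2.
Qed.

Lemma dpow_power (m : 'X_{1..n}) a i : (exists2 k : nat, (k < m i)%N & a i 0 = k%:R) ->
  forall b, dpow m (power a) b = 0.
Proof.
move=> [k ki ak].
have pd (x : 'cV[K]_n) c j : series_d j (fun b => c *: power x b) =
    fun b => (c * x j 0) *: power (x - delta_mx j 0) b.
  apply: funext => b; rewrite /series_d /power mderivZ eq_sym -subr_eq eq_sym.
  case: eqP => [->|_]; last by rewrite mderiv0 !scaler0 addr0.
  by rewrite -mpolyC1 mderivC scaler0 addr0 subrK scalerA mulrC.
have it (x : 'cV[K]_n) c j N : iter N (series_d j) (fun b => c *: power x b) =
    fun b => (c * \prod_(l < N) (x j 0 - l%:R)) *: power (x - N%:R *: delta_mx j 0) b.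
  elim: N => [|N IH]; first by rewrite big_ord0 mulr1 scale0r subr0.
  rewrite iterS IH pd big_ord_recr /= mulrA !mxE !eqxx mulr1.
  by rewrite -addrA -opprD -natr1 scalerDl scale1r.
have -> : power a = fun b => 1 *: power a b.
  by apply: funext => b; rewrite scale1r.
have [c [cE c0]] : exists c, (forall b, dpow m (fun b => 1 *: power a b) b =
    c *: power (a - \sum_(i <- enum 'I_n) (m i)%:R *: delta_mx i 0) b) /\
    (i \in enum 'I_n -> c = 0).
  rewrite /dpow; elim: (enum _) (enum_uniq 'I_n) => [|j s IH] /=.
    by exists 1; split=> // b; rewrite big_nil subr0.
  move=> /andP[js us]; have [c [cE c0]] := IH us.
  rewrite (_ : iters _ m s _ = fun b => c *:
    power (a - \sum_(i <- s) (m i)%:R *: delta_mx i 0) b); last exact/funext/cE.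
  rewrite it big_cons opprD [- _ - _]addrC addrA.
  exists (c * \prod_(l < m j) ((a - \sum_(i <- s) (m i)%:R *: delta_mx i 0) j 0 - l%:R)).
  split=> //.
  rewrite inE => /orP[/eqP ij|/c0 ->]; last by rewrite mul0r.
  rewrite -ij in js *; rewrite !mxE shift_notin // subr0 ak.
  by rewrite (bigD1 (Ordinal ki)) //= subrr mul0r mulr0.
by move=> b; rewrite cE c0 ?scale0r // mem_enum.
Qed.

Lemma dpow_lin e phi psi c a :
  dpow e (fun b => phi b + c *: psi b) a = dpow e phi a + c *: dpow e psi a.
Proof.
rewrite /dpow; elim: (enum _) a => //= i s IH a.
elim: (e i) a => [|k IHk] a //=.
rewrite /series_d !IHk mderivD mderivZ !scalerDr !scalerA [c * _]mulrC.
by rewrite addrACA.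
Qed.

Lemma weyl_act_lin P phi psi c a : weyl_act P (fun b => phi b + c *: psi b) a =
  weyl_act P phi a + c *: weyl_act P psi a.
Proof.
rewrite !weyl_actE /lsum scaler_sumr -big_split /=; apply: eq_bigr => m _.
by rewrite dpow_lin scalerDr !scalerA [c * _]mulrC.
Qed.

Lemma mpoly_const p : (forall i, p^`M(i) = 0) -> exists c, p = c%:MP.
Proof.
move=> hp; exists p@_0; apply/mpolyP => m; rewrite mcoeffC.
case: eqP => [<-|m0]; first by rewrite mulr1.
have [i mi] : exists i, m i != 0%N.
  apply: contrapT => no; apply/m0/mnmP => i; rewrite mnm0E.
  by case: (m i =P 0%N) => [->//|/eqP mi]; case: no; exists i.
have := congr1 (mcoeff (m - U_(i))) (hp i); rewrite mcoeff_deriv mcoeff0 submK ?lep1mP //.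
by move/eqP; rewrite mulr0 -mulr_natr mulf_eq0 pnatr_eq0 orbF => /eqP.
Qed.

End SeriesDerivatives.

(** * Lowest-weight parts of series *)

Section InitialSeries.
Variable R : realType.
Local Notation C := R[i].
Variables (n : nat) (w : 'cV[R]_n).
Implicit Types (a b : 'cV[C]_n) (phi : log_series C n) (P : weyl n C).

(** Within one coset of Z^n the imaginary part of w.a is constant, so the real part orders the
    terms. *)
Definition exponent_weight a : R := \sum_i w i 0 * complex.Re (a i 0).

Lemma exponent_weightD a b :
  exponent_weight (a + b) = exponent_weight a + exponent_weight b.
Proof.
rewrite /exponent_weight -big_split /=; apply: eq_bigr => i _.
by rewrite mxE raddfD mulrDr.
Qed.

Lemma exponent_weightB a b :
  exponent_weight (a - b) = exponent_weight a - exponent_weight b.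
Proof. by apply/eqP; rewrite eq_sym subr_eq -exponent_weightD subrK. Qed.

Lemma Re_int (z : int) : complex.Re (z%:~R : C) = z%:~R.
Proof.
have Re_nat (k : nat) : complex.Re (k%:R : C) = k%:R.
  by elim: k => // k IH; rewrite -!natr1 raddfD /= IH.
by case: z => k; rewrite ?NegzE ?intrN ?raddfN /= -?pmulrn ?Re_nat.
Qed.

Lemma exponent_weight_nat (e : 'I_n -> nat) :
  exponent_weight (mnm_vec _ e) = \sum_i w i 0 *+ e i.
Proof.
apply: eq_bigr => i _; rewrite mxE -[w i 0 *+ e i]mulr_natr; congr (_ * _).
exact: (Re_int (e i)).
Qed.

Lemma exponent_weight_int (u : 'cV[int]_n) :
  exponent_weight (map_mx intr u) = \sum_i w i 0 * (u i 0)%:~R.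
Proof. by apply: eq_bigr => i _; rewrite mxE Re_int. Qed.

Definition initial_series (t : R) phi : log_series C n :=
  fun a => if exponent_weight a == t then phi a else 0.

(** A term of weight W read at [a] looks up [phi] at weight [exponent_weight a] + W. If the maximal
    W leads to [t], the lower terms look below [t] and find 0, so the sum is that of P phi;
    otherwise the initial series contributes 0. *)
Lemma weyl_act_initial P phi t : (forall a, phi a != 0 -> t <= exponent_weight a) ->
    (forall a, weyl_act P phi a = 0) ->
  forall a, weyl_act (weyl_initial_form w P) (initial_series t phi) a = 0.
Proof.
move=> phit Pphi a; rewrite weyl_actE lsum_initial_form.
set W := weight _; set p := symbol P.
pose top m := all (fun m' => W m' <= W m) (msupp p).
pose l (m : 'X_{1..n + n}) := fun i => m (lshift n i).
pose r (m : 'X_{1..n + n}) := fun i => m (rshift n i).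
have wtE m : exponent_weight (a - mnm_vec _ (l m) + mnm_vec _ (r m)) =
    exponent_weight a + W m.
  rewrite exponent_weightD exponent_weightB !exponent_weight_nat -addrA; congr (_ + _).
  rewrite /W /weight big_split_ord /= -sumrN; congr (_ + _); apply: eq_bigr => i _.
    by rewrite col_mxEu mxE mulNrn.
  by rewrite col_mxEd.
have [[m0 m0p m0t]|no] := pselect (exists2 m0, m0 \in msupp p & top m0); last first.
  by rewrite big_seq_cond big1 // => m /andP[mp mt]; case: no; exists m.
have [at0|at0] := eqVneq (exponent_weight a + W m0) t; last first.
  rewrite big_seq_cond big1 // => m /andP[mp mt].
  rewrite dpow_eq0 ?scaler0 // /initial_series wtE.
  suff -> : W m = W m0 by rewrite (negPf at0).
  by apply/eqP; rewrite eq_le (allP m0t) // (allP mt).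
rewrite -[RHS](Pphi a) weyl_actE /lsum big_mkcond; apply: eq_big_seq => m mp.
case: ifP => mt; last first.
  rewrite dpow_eq0 ?scaler0 //; apply: contraFeq mt => /phit.
  rewrite wtE -at0 lerD2l => le; apply/allP => m' m'p.
  by apply: le_trans le; apply: (allP m0t).
congr (_ *: _); apply: dpow_local; rewrite /initial_series wtE.
have -> : W m = W m0 by apply/eqP; rewrite eq_le (allP m0t) // (allP mt).
by rewrite at0 eqxx.
Qed.

Lemma is_solution_initial (J : weyl n C -> Prop) phi t :
    is_solution J phi -> (forall a, phi a != 0 -> t <= exponent_weight a) ->
  is_solution (weyl_initial_ideal w J) (initial_series t phi).
Proof.
move=> sol phit; apply/is_solution_gen => _ [P [JP _] ->].
by apply: weyl_act_initial => //; apply: sol.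
Qed.

(** On the dual of an open cone w.u dominates a multiple of |u|, so only finitely many lattice
    points lie below a given weight. *)
Lemma dual_cone_min k (H : 'M[int]_(k, n)) (S : 'cV[int]_n -> Prop) : open_cone H w ->
    (forall u, S u -> in_dual_cone H (map_mx intr u : 'cV[R]_n)) -> (exists u, S u) ->
  exists2 u0, S u0 & forall u, S u ->
    exponent_weight (map_mx intr u0) <= exponent_weight (map_mx intr u).
Proof.
move=> Hw SH [u1 Su1]; have [e e0 He] := open_cone_nbhs Hw.
have low u : S u -> forall i, e * `|(u i 0)%:~R| <= exponent_weight (map_mx intr u).
  (* Pairing [u] with w - e sign(u), still in the cone, gives w.u >= e sum |u_j|. *)
  move=> Su i; pose sg : 'cV[R]_n := \col_j (- e * Num.sg (u j 0)%:~R).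
  have /(SH _ Su) : open_cone H (w + sg).
    apply: He => j; rewrite mxE normrM normrN (gtr0_norm e0) ler_piMr ?(ltW e0) //.
    by rewrite normr_sg lern1 leq_b1.
  under eq_bigr do rewrite !mxE mulrDr.
  rewrite big_split /= exponent_weight_int => h.
  have -> : \sum_j w j 0 * (u j 0)%:~R = \sum_j (u j 0)%:~R * w j 0.
    by apply: eq_bigr => j _; rewrite mulrC.
  rewrite -subr_ge0; apply: le_trans h _; rewrite lerD2l lerNr -sumrN.
  have E j : - ((u j 0)%:~R * (- e * Num.sg (u j 0)%:~R)) = e * `|(u j 0)%:~R| :> R.
    by rewrite normrEsg; ring.
  under eq_bigr do rewrite E.
  by rewrite (bigD1 i) //= lerDl sumr_ge0 // => j _; rewrite mulr_ge0 // ltW.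
pose T := exponent_weight (map_mx intr u1).
pose B := Num.bound (T / e).
pose F := {ffun 'I_n -> 'I_(B + B).+1}.
pose dec (f : F) : 'cV[int]_n := \col_i ((f i)%:Z - B%:Z).
have enc u : S u -> exponent_weight (map_mx intr u) <= T -> exists f, u = dec f.
  move=> Su le; have uB i : (absz (u i 0%R) <= B)%N.
    rewrite -(ler_nat R); apply/ltW/le_lt_trans/archi_boundP; last first.
      rewrite divr_ge0 ?(ltW e0) //; apply: le_trans (low _ Su1 i).
      by rewrite mulr_ge0 // ltW.
    rewrite ler_pdivlMr // mulrC; apply: le_trans le; apply: le_trans (low _ Su i).
    by rewrite ler_pM2l // -intr_norm -abszE.
  exists [ffun i => inord (absz (u i 0 + B%:Z)%R)]; apply/matrixP => i j.
  rewrite ord1 mxE ffunE; have := uB i; move: (u i 0) => z zB.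
  by rewrite inordK; move: zB; clear; lia.
have [f1 u1E] := enc _ Su1 (lexx _).
pose Q f := `[< S (dec f) >].
have Qf1 : Q f1 by apply/asboolP; rewrite -u1E.
have [f /asboolP Sf fmin] :=
  @arg_minP _ _ _ f1 Q (fun f => exponent_weight (map_mx intr (dec f))) Qf1.
exists (dec f) => // u Su.
have [le|lt] := leP (exponent_weight (map_mx intr u)) T.
  by have [f' uE] := enc _ Su le; rewrite uE; apply: fmin; apply/asboolP; rewrite -uE.
by apply: le_trans (ltW lt); rewrite /T u1E; apply: fmin.
Qed.

End InitialSeries.

(** * Exponents of top-dimensional pairs *)

Section Exponents.
Variable R : realType.
Local Notation C := R[i].
Variables (d n : nat) (A : 'M[int]_(d, n)) (beta : 'cV[C]_d) (w : 'cV[R]_n).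
Local Notation I_A := (@toric_ideal R d n A).
Local Notation M := (initial_ideal w I_A).
Local Notation height := (height A w).
Local Notation top_pair := (top_standard_pair M).
Hypotheses (hw : weight_vector A beta w) (hA : columns_generate A).
Implicit Types (m u al : 'X_{1..n}) (s : {set 'I_n}) (t : {set 'I_(1 + n)}) (a v : 'cV[C]_n).

Lemma top_pair_chart al s : top_pair al s -> exists (g : 'I_d -> 'I_n) c,
  [/\ injective g, \det (colsub g A) != 0,
      forall i, 0 <= height c i /\ (height c i = 0 <-> exists j, g j = i),
      forall i, i \in s <-> exists j, g j = i & chart_pair A w g al].
Proof.
move=> tp; have [t [ft t0] st] := top_standard_pair_facet hw hA tp.
have [g [c [ginj gdet _ hc tg]]] := facet_structure hw hA ft t0.
have sg i : i \in s <-> exists j, g j = i by rewrite st inE.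
have [al0 als] := standard_pair_standard tp.1.
exists g, c; split=> //; split=> [j|m ms]; first by apply/al0/sg; exists j.
by apply: als => i /ms/sg.
Qed.

Lemma top_pair_le al al' s : top_pair al s -> (forall i, (al' i <= al i)%N) ->
  top_pair al' s.
Proof.
move=> tp le; have [g [c [ginj gdet hc sg [al0 als]]]] := top_pair_chart tp.
apply: (chart_pair_top hw ginj gdet hc sg); split=> [j|m ms].
  by apply/eqP; rewrite -leqn0 -(al0 j).
apply: (@standardD _ _ _ _ _ _ (al - al')%MM).
have -> : (al' + m + (al - al') = al + m)%MM; last exact: als.
by apply/mnmP => i; rewrite !mnmDE mnmBE addnAC subnKC.
Qed.

Lemma top_pair_unique al s a v : top_pair al s ->
    coordinate_plane al s a -> coordinate_plane al s v ->
    map_mx intr A *m a = map_mx intr A *m v -> a = v.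
Proof.
move=> tp pa pv /eqP; have [g [c [ginj gdet hc sg _]]] := top_pair_chart tp.
rewrite -subr_eq0 -mulmxBr (mulmx_support _ ginj); last first.
  move=> i; rewrite !mxE => ni; apply/sg; apply: contraNT ni => si.
  by rewrite pa // pv // subrr.
have uB : (map_mx intr (colsub g A) : 'M[C]_d) \in unitmx.
  by rewrite unitmxE unitfE det_map_mx intr_eq0.
rewrite (_ : colsub g (map_mx intr A) = map_mx intr (colsub g A)); last first.
  by apply/matrixP => i j; rewrite !mxE.
rewrite -(mulmx0 _ (map_mx intr (colsub g A))) => /eqP/(can_inj (mulKmx uB)) z0.
apply/matrixP => i j; rewrite ord1; have [/sg[k <-]|si] := boolP (i \in s).
  have := congr1 (fun N : 'cV__ => N k 0) z0; rewrite !mxE.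
  by move/eqP; rewrite subr_eq0 => /eqP.
by rewrite pa // pv.
Qed.

Lemma top_pair_point al s : top_pair al s ->
  exists v, coordinate_plane al s v /\ map_mx intr A *m v = beta.
Proof.
move=> tp; have [g [c [ginj gdet hc sg [al0 _]]]] := top_pair_chart tp.
have uB : (map_mx intr (colsub g A) : 'M[C]_d) \in unitmx.
  by rewrite unitmxE unitfE det_map_mx intr_eq0.
pose y := invmx (map_mx intr (colsub g A)) *m (beta - map_mx intr A *m mnm_point _ al).
pose z : 'cV[C]_n := \col_i \sum_(j | g j == i) y j 0.
have zE j : z (g j) 0 = y j 0.
  rewrite mxE (bigD1 j) //= big1 ?addr0 // => k /andP[/eqP/ginj ->].
  by rewrite eqxx.
have z0 i : (forall j, g j <> i) -> z i 0 = 0.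
  by move=> ig; rewrite mxE big_pred0 // => j; apply/eqP/ig.
exists (mnm_point _ al + z); split=> [i si|].
  rewrite [LHS]mxE z0 ?addr0 ?mxE // => j ji.
  by move/negP: si; apply; apply/sg; exists j.
rewrite mulmxDr (mulmx_support _ ginj (u := z)); last first.
  move=> i zi; apply: contrapT => no; move/eqP: zi; apply; apply: z0 => j ji.
  by apply: no; exists j.
rewrite (_ : colsub g (map_mx intr A) = map_mx intr (colsub g A)); last first.
  by apply/matrixP => i j; rewrite !mxE.
rewrite (_ : \col_j z (g j) 0 = y); last by apply/matrixP => j k; rewrite ord1 mxE zE.
by rewrite /y mulKVmx // addrC subrK.
Qed.

Lemma top_pairs_enum : exists T : seq ('X_{1..n} * {set 'I_n}),
  [/\ uniq T,
    size T = (\sum_(t : {set 'I_(1 + n)} | `[< facet A (rho_weight w) t >] && (ord0 \in t))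
                simplex_volume A t)%N &
    forall al s, (al, s) \in T <-> top_pair al s].
Proof.
pose good t := `[< facet A (rho_weight w) t >] && (ord0 \in t).
have /choice[L hL] : forall t, exists l : seq 'X_{1..n}, good t ->
    [/\ uniq l, size l = simplex_volume A t &
        forall al, al \in l <-> top_pair al (link t)].
  move=> t; have [/andP[/asboolP ft t0]|_] := boolP (good t); last by exists [::].
  have [g [c [ginj gdet vol hc tg]]] := facet_structure hw hA ft t0.
  have sg i : i \in link t <-> exists j, g j = i by rewrite inE.
  have [l [ul sl hl]] := chart_pairs_enum hw hA ginj gdet hc.
  exists l => _; split=> // [|al]; first by rewrite sl vol.
  split=> [/hl|tp]; first exact: (chart_pair_top hw ginj gdet hc sg).
  apply/hl; have [al0 als] := standard_pair_standard tp.1.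
  split=> [j|m ms]; first by apply/al0/sg; exists j.
  by apply: als => i /ms/sg.
pose ts := [seq t <- enum {set 'I_(1 + n)} | good t].
have ts_good t : t \in ts = good t by rewrite mem_filter mem_enum andbT.
have link_inj t t' : good t -> good t' -> link t = link t' -> t = t'.
  move=> /andP[_ t0] /andP[_ t0'] /setP tt'; apply/setP => x.
  rewrite -(splitK x); case: (split x) => j /=; last by have := tt' j; rewrite !inE.
  by rewrite (_ : lshift n j = ord0) ?t0 ?t0' //; apply: val_inj; rewrite /= ord1.
exists [seq (al, link t) | t <- ts, al <- L t]; split.
- apply: allpairs_uniq_dep => [||[t al] [t' al']].
  + by rewrite filter_uniq ?enum_uniq.
  + by move=> t; rewrite ts_good => /hL[].
  move=> /allpairsPdep[t1 [al1 [t1s _ /= E]]] /allpairsPdep[t2 [al2 [t2s _ /= E']]].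
  move=> [aa lt]; have tt : t = t'.
    apply: link_inj => //; rewrite -ts_good.
      by have /= -> := congr1 tag E.
    by have /= -> := congr1 tag E'.
  by rewrite -tt aa.
- rewrite size_allpairs_dep sumnE big_map big_filter big_enum_cond /=.
  by apply: eq_bigr => t /hL[].
move=> al s; split=> [/allpairsPdep[t [al' [ts' al't [-> ->]]]]|tp].
  by move: ts'; rewrite ts_good => /hL[_ _ h]; apply/h.
have [t [ft t0] st] := top_standard_pair_facet hw hA tp.
have gt : good t by rewrite /good t0 andbT; apply/asboolP.
apply/allpairsPdep; exists t, al; split; rewrite ?ts_good ?st //.
by have [_ _ h] := hL _ gt; apply/h; rewrite -st.
Qed.

End Exponents.

(** * Nilsson solutions at generic parameters *)

Section GenericNilsson.
Variable R : realType.
Local Notation C := R[i].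
Variables (d n : nat) (A : 'M[int]_(d, n)) (beta : 'cV[C]_d) (w : 'cV[R]_n).
Local Notation I_A := (@toric_ideal R d n A).
Local Notation M := (initial_ideal w I_A).
Local Notation H_A := (hypergeometric_ideal A beta).
Local Notation top_pair := (top_standard_pair M).
Hypotheses (hw : weight_vector A beta w) (hA : columns_generate A).
Hypothesis hbeta : generic_parameter A beta w.
Implicit Types (m al : 'X_{1..n}) (s : {set 'I_n}) (a v : 'cV[C]_n) (phi : log_series C n).

(** Each monomial of an element of top(M) differentiates more than al_i times in some direction i
    off [s], where a_i = al_i. *)
Lemma pair_exponent al s a : top_pair al s -> coordinate_plane al s a ->
  map_mx intr A *m a = beta -> is_exponent A beta w a.
Proof.
move=> tp pa Aa P; have [inH _ _] := hbeta; move=> /inH.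
suff : is_solution (add_euler A beta (top_part M)) (power a) by apply.
apply/is_solution_gen => {}P [[f topf ->]|[i ->]] b.
  rewrite poly_d_act lsum_eq0 // => m mf.
  have [i si mi] : exists2 i, i \notin s & (al i < m i)%N.
    move: m mf; apply: (topf _ _ tp (fun f => forall m, m \in msupp f ->
      exists2 i, i \notin s & (al i < m i)%N)).
      apply: monomial_left_ideal => m m' [i si mi]; exists i => //.
      by rewrite mnmDE ltn_addl.
    move=> _ [i si ->] m; rewrite mpolyXn msuppX inE => /eqP ->; exists i => //.
    by rewrite mulmnE mnm1E eqxx mul1n.
  by apply: (@dpow_power _ _ _ _ i); exists (al i); rewrite ?pa.
rewrite euler_act /power; case: eqP => [->|_].
  rewrite Aa subrr scale0r add0r big1 // => j _.
  by rewrite -mpolyC1 mderivC scaler0.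
by rewrite scaler0 big1 ?addr0 // => j _; rewrite mderiv0 scaler0.
Qed.

(** The least common multiple of one chosen generator from each of the ideals intersected in
    [top_part]. *)
Lemma top_part_join (T : seq ('X_{1..n} * {set 'I_n})) (iota : 'X_{1..n} * {set 'I_n} -> 'I_n) :
    (forall al s, (al, s) \in T <-> top_pair al s) ->
    (forall x, x \in T -> iota x \notin x.2) ->
  top_part M 'X_[[multinom (\max_(x <- T | iota x == i) (x.1 i).+1)%N | i < n]].
Proof.
move=> hT hiota al s /hT alT; apply: monomial_ideal_gen => m.
rewrite msuppX inE => /eqP ->.
set m0 := [multinom _ | _ < _]; pose k := iota (al, s).
exists (m0 - U_(k) *+ (al k).+1)%MM, (U_(k) *+ (al k).+1)%MM; split.
  rewrite submK //; apply/mnm_lepP => i; rewrite mulmnE mnm1E.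
  have [<-|] := eqVneq k i; last by rewrite mul0n.
  rewrite mul1n mnmE.
  exact: (@leq_bigmax_seq _ T (fun x => iota x == k) (fun x => (x.1 k).+1) (al, s)).
by exists k; [exact: hiota alT|rewrite mpolyXn].
Qed.

(* Testing against the monomials of [top_part] obtained by choosing one
   direction [iota x] off the face of every top-dimensional standard pair [x]:
   only compatible pairs can make a falling factor singular. *)
Lemma initial_term_exponent phi t a :
    is_solution H_A phi -> (forall b, phi b != 0 -> t <= exponent_weight w b) ->
    exponent_weight w a = t -> phi a != 0 ->
  exists al s, [/\ top_pair al s, coordinate_plane al s a,
    map_mx intr A *m a = beta & exists c, phi a = c%:MP].
Proof.
move=> sol phit at0 pa; pose psi := initial_series w t phi.
have psia : psi a = phi a by rewrite /psi /initial_series at0 eqxx.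
have psol : is_solution (add_euler A beta (top_part M)) psi.
  move=> P topP; have [inH _ _] := hbeta; apply: (is_solution_initial sol phit).
  exact/inH.
have eul i b : weyl_act (euler R A i - (beta i 0)%:A) psi b = 0.
  by apply: psol => J _; apply; right; exists i.
have kill m : top_part M 'X_[m] -> dpow m psi (a - mnm_vec _ m) = 0.
  move=> topm; rewrite -(lsumX (fun m' => dpow m' psi (a - mnm_vec C m))) -poly_d_act.
  by apply: psol => J _; apply; left; exists 'X_[m].
have Aa : map_mx intr A *m a = beta.
  apply/matrixP => i j; rewrite ord1; apply: contrapT => /eqP; rewrite -subr_eq0 => x0.
  have := eul i a; rewrite euler_act psia => /eqP.
  by rewrite (negPf (derivation_neq0 _ x0 pa)).
have eulD i : \sum_j (A i j)%:~R *: (phi a)^`M(j) = 0.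
  by have := eul i a; rewrite euler_act psia Aa subrr scale0r add0r.
have [T [_ _ hT]] := top_pairs_enum hw hA.
(* For a compatible pair, lowering [al] to the coordinates of [a] gives by [top_pair_le] a pair
   whose plane contains [a]. *)
pose compat (x : 'X_{1..n} * {set 'I_n}) :=
  forall i, i \notin x.2 -> exists2 k : nat, (k <= x.1 i)%N & a i 0 = k%:R.
have ncompat x : ~ compat x -> exists i, i \notin x.2 /\
    forall k : nat, (k <= x.1 i)%N -> a i 0 != k%:R.
  move=> nc; apply: contrapT => no; apply: nc => i si; apply: contrapT => nk.
  apply: no; exists i; split=> // k le; apply/eqP => ak; apply: nk.
  by exists k.
have sing (iota : 'X_{1..n} * {set 'I_n} -> 'I_n) i j :
    (forall x, x \in T -> ~ compat x -> forall k : nat, (k <= x.1 (iota x))%N -> a (iota x) 0 != k%:R) ->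
    (j < [multinom (\max_(x <- T | iota x == i) (x.1 i).+1)%N | i < n] i)%N ->
    a i 0 = j%:R -> exists x, [/\ x \in T, compat x & iota x = i].
  move=> hiota; rewrite mnmE => lt aj; apply: contrapT => no.
  have : (\max_(x <- T | iota x == i) (x.1 i).+1 <= j)%N.
    apply/bigmax_leqP_seq => x xT /eqP xi; rewrite ltnNge; apply/negP => le.
    have [cx|nx] := pselect (compat x); first by apply: no; exists x.
    by have := hiota x xT nx j; rewrite xi aj => /(_ le) /eqP.
  by rewrite leqNgt lt.
(* Otherwise every pair offers a direction without singular factors, and the join of these choices
   lies in top(M) yet does not annihilate the term; for empty [T] the monomial 1 does the same. *)
have [x0 [x0T cx0]] : exists x, x \in T /\ compat x.
  apply: contrapT => no.
  have [x1 x1T] : exists x1, x1 \in T.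
    apply: contrapT => T0; have := kill 0%MM.
    have topm : top_part M 'X_[0] by move=> al s /hT alT; case: T0; exists (al, s).
    move=> /(_ topm); apply/eqP/dpow_neq0 => [|i j]; first by rewrite psia.
    by rewrite mnm0E.
  have nc x : x \in T -> ~ compat x by move=> xT cx; apply: no; exists x.
  have [i1 _] := ncompat _ (nc _ x1T).
  have /choice[iota hiota] : forall x, exists i, x \in T -> i \notin x.2 /\
      forall k : nat, (k <= x.1 i)%N -> a i 0 != k%:R.
    move=> x; have [xT|_] := boolP (x \in T); last by exists i1.
    by have [i hi] := ncompat _ (nc _ xT); exists i.
  have := kill _ (top_part_join hT (fun x xT => (hiota x xT).1)).
  apply/eqP/dpow_neq0 => [|i j ji]; first by rewrite psia.
  apply/eqP => /(sing iota i j _ ji)[x xT _ k|x [xT cx _]]; first exact: (hiota x xT).2.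
  by apply: no; exists x.
have pairE x : x \in T -> compat x -> exists al, top_pair al x.2 /\ coordinate_plane al x.2 a.
  case: x => al s /hT tp cx.
  have /choice[f hf] : forall i, exists k : nat, (k <= al i)%N /\ (i \notin s -> a i 0 = k%:R).
    move=> i; have [si|/cx[k le ak]] := boolP (i \in s); first by exists 0%N.
    by exists k.
  exists [multinom f i | i < n]; split=> [|i si]; last by rewrite mnmE (hf i).2.
  by apply: (top_pair_le hw hA tp) => i; rewrite mnmE (hf i).1.
(* By genericity the face of a compatible pair is the set of non-integral coordinates of [a], so all
   compatible pairs share it. *)
have noint x : x \in T -> compat x -> forall i, (i \in x.2) <-> ~ exists z : int, a i 0 = z%:~R.
  move=> xT cx i; have [al [tp pl]] := pairE _ xT cx; have [_ nonint _] := hbeta.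
  split=> [ix|nz]; first by apply: (nonint a al x.2) => //; exact: pair_exponent tp pl Aa.
  by apply: contrapT => /negP ix; apply: nz; exists (al i); apply: pl.
have [al [tp pl]] := pairE _ x0T cx0; exists al, x0.2; split=> //.
(* Choose [i0] for all compatible pairs and a nonsingular direction for the others: singular factors
   occur only along [i0], where they are harmless if p depends on that logarithm. *)
have offD i0 : i0 \notin x0.2 -> (phi a)^`M(i0) = 0.
  move=> i0x; apply: contrapT => /eqP D0.
  have /choice[iota hiota] : forall x, exists i, x \in T -> 
     [/\ i \notin x.2, (~ compat x -> forall k : nat, (k <= x.1 i)%N -> a i 0 != k%:R) &
     compat x -> i = i0].
    move=> x; have [xT|_] := boolP (x \in T); last by exists i0.
    have [cx|nx] := pselect (compat x); last first.
      by have [i [ix hi]] := ncompat _ nx; exists i.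
    exists i0 => _; split=> //; apply: contra i0x => /(noint _ xT cx) ni.
    exact/(noint _ x0T cx0).
  have hi1 x : x \in T -> iota x \notin x.2 by move=> /hiota[].
  have := kill _ (top_part_join hT hi1).
  apply/eqP/(@dpow_log_neq0 _ _ _ _ _ i0) => [|i j ii0 ji]; first by rewrite psia.
  apply/eqP => /(sing iota i j _ ji)[x xT nx|x [xT cx xi]]; first by have [_ + _] := hiota x xT; apply.
  by have [_ _ /(_ cx)] := hiota x xT; rewrite xi => /eqP; rewrite (negPf ii0).
(* The derivatives along the face satisfy the Euler equations, coefficientwise a square system with
   the invertible matrix of the facet. *)
apply: mpoly_const => i; have [ix|/offD//] := boolP (i \in x0.2).
have [g [c [ginj gdet hc sg _]]] := top_pair_chart hw hA tp.
have uB : (map_mx intr (colsub g A) : 'M[C]_d) \in unitmx.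
  by rewrite unitmxE unitfE det_map_mx intr_eq0.
have /sg[l <-] := ix; apply/mpolyP => m; rewrite mcoeff0.
have : map_mx intr (colsub g A) *m (\col_j ((phi a)^`M(g j))@_m) = 0 :> 'cV[C]_d.
  apply/matrixP => k j; rewrite ord1 !mxE.
  have := congr1 (mcoeff m) (eulD k); rewrite raddf_sum /= mcoeff0 (sum_codom ginj) => [E|q qn0].
    by rewrite -[RHS]E; apply: eq_bigr => q _; rewrite !mxE mcoeffZ.
  apply/sg; apply: contraT => qs; move: qn0; rewrite offD //.
  by rewrite scaler0 mcoeff0 eqxx.
rewrite -(mulmx0 _ (map_mx intr (colsub g A))) => /(can_inj (mulKmx uB)) z0.
by have := congr1 (fun N : 'cV__ => N l 0) z0; rewrite !mxE.
Qed.

Lemma basic_nilsson_canonical phi : basic_nilsson A beta w phi ->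
  exists al s a, [/\ top_pair al s, coordinate_plane al s a, map_mx intr A *m a = beta &
    forall F, canonical_coefficients A beta w a F ->
      exists c, forall b, phi b = c *: lattice_series a F b].
Proof.
move=> [sol [v0 [U [p [Up Uout [k [H [Hw HU]]] _ [U0 p0]]]]]].
have [_ Hww _ _] := Hw.
pose cone u := in_dual_cone H (map_mx intr u : 'cV[R]_n).
have coneD u u' : cone u -> cone u' -> cone (u + u').
  move=> cu cu' w' Hw'; under eq_bigr do rewrite map_mxD mxE mulrDl.
  by rewrite big_split addr_ge0 ?cu ?cu'.
(* Used for [phi] and again for the difference [chi]; both are supported in [v0] plus the lattice
   points of one dual cone, so a term of least weight exists. Its exponent may differ from [v0]. *)
have lead chi : is_solution H_A chi ->
    (forall b, chi b != 0 -> exists2 u, cone u & b = v0 + map_mx intr u) ->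
    (exists b, chi b != 0) ->
  exists u, [/\ cone u, chi (v0 + map_mx intr u) != 0 &
    exists al s, [/\ top_pair al s, coordinate_plane al s (v0 + map_mx intr u),
      map_mx intr A *m (v0 + map_mx intr u) = beta &
      exists c, chi (v0 + map_mx intr u) = c%:MP]].
  move=> chisol chisupp [b chib].
  pose S u := cone u /\ chi (v0 + map_mx intr u) != 0.
  have [u0 [cu0 chiu0] umin] : exists2 u0, S u0 & forall u, S u ->
      exponent_weight w (map_mx intr u0) <= exponent_weight w (map_mx intr u).
    apply: (dual_cone_min Hww) => [u []//|].
    by have [u cu bE] := chisupp _ chib; exists u; split; rewrite // -bE.
  exists u0; split=> //.
  apply: (initial_term_exponent (t := exponent_weight w (v0 + map_mx intr u0)) chisol) => //.
  move=> b' chib'; have [u cu bE] := chisupp _ chib'.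
  by rewrite bE !exponent_weightD lerD2l umin //; split; rewrite // -bE.
have phisupp b : phi b != 0 -> exists2 u, cone u & b = v0 + map_mx intr u.
  move=> pb; apply: contrapT => no; move/eqP: pb; apply; apply: Uout => u Uu bE.
  by apply: no; exists u => //; have [] := HU u Uu.
have [|u0 [cu0 phiu0 [al [s [tp pl Aa [c0 c0E]]]]]] := lead phi sol phisupp.
  exists (v0 + map_mx intr (0 : 'cV[int]_n)); rewrite Up //; exact/eqP.
set a := v0 + map_mx intr u0 in phiu0 tp pl Aa c0E.
exists al, s, a; split=> // F [Fsol F0 FU].
have aE u : a + map_mx intr u = v0 + map_mx intr (u0 + u) by rewrite map_mxD addrA.
have LSa : lattice_series a F a = (F 0)%:MP.
  by rewrite -[RHS](lattice_seriesE a F 0) map_mx0 addr0.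
exists (c0 / F 0) => b; apply: contrapT => nb.
pose chi : log_series C n := fun b => phi b + (- (c0 / F 0)) *: lattice_series a F b.
have chisol : is_solution H_A chi.
  by move=> P JP b'; rewrite weyl_act_lin sol // Fsol // scaler0 addr0.
have chisupp b' : chi b' != 0 -> exists2 u, cone u & b' = v0 + map_mx intr u.
  have [p0b|/phisupp//] := eqVneq (phi b') 0.
  rewrite /chi p0b add0r => chib.
  have [[u bE]|nu] := pselect (exists u, b' = a + map_mx intr u); last first.
    move: chib; rewrite lattice_series_out ?scaler0 ?eqxx // => u bE.
    by apply: nu; exists u.
  exists (u0 + u); last by rewrite bE aE.
  have Fu : F u != 0.
    by apply: contraNneq chib => Fu; rewrite bE lattice_seriesE Fu mpolyC0 scaler0.
  by apply: coneD => //; have [_] := FU u Fu; apply.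
have [|u1 [_ chiu1 [al1 [s1 [tp1 pl1 Aa1 _]]]]] := lead chi chisol chisupp.
  exists b; rewrite /chi scaleNr subr_eq0; exact/eqP.
have [_ _ hdiff] := hbeta.
(* Two exponents in one class modulo Z^n agree, whereas the factor c0 / F 0 was chosen to make [chi]
   vanish at [a]. *)
have a1E : v0 + map_mx intr u1 = a.
  apply: contrapT => ne; apply: (hdiff _ _ (pair_exponent tp1 pl1 Aa1) (pair_exponent tp pl Aa) ne).
  by exists (u1 - u0); rewrite /a map_mxB opprD addrACA subrr add0r.
move: chiu1; rewrite a1E /chi c0E LSa -mul_mpolyC -mpolyCM -mpolyCD mulNr divfK //.
by rewrite subrr mpolyC0 eqxx.
Qed.

Lemma canonical_coefficients_of_pair al s a : top_pair al s -> coordinate_plane al s a ->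
  map_mx intr A *m a = beta -> exists F, canonical_coefficients A beta w a F.
Proof.
move=> tp pl Aa; have [_ als] := standard_pair_standard tp.1.
apply: (canonical_coefficients_exist Aa pl _ als).
have [_ noint _] := hbeta; apply: (noint a al s); last by split.
exact: pair_exponent tp pl Aa.
Qed.

Lemma nilsson_space_dimension : has_dimension (nilsson_space A beta w)
    (\sum_(s : {set 'I_(1 + n)} | `[< facet A (rho_weight w) s >] && (ord0 \in s))
       simplex_volume A s).
Proof.
have [T [uT <- hT]] := top_pairs_enum hw hA.
have /choice[pt hpt] : forall x, exists v : 'cV[C]_n, x \in T ->
    coordinate_plane x.1 x.2 v /\ map_mx intr A *m v = beta.
  case=> al s; have [/hT tp|_] := boolP ((al, s) \in T); last by exists 0.
  by have [v hv] := top_pair_point hw hA tp; exists v.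
have /choice[F hF] : forall x, exists F, x \in T -> canonical_coefficients A beta w (pt x) F.
  case=> al s; have [alT|_] := boolP ((al, s) \in T); last by exists (fun=> 0).
  have [pl Aa] := hpt _ alT.
  by have [F hF] := canonical_coefficients_of_pair ((hT _ _).1 alT) pl Aa; exists F.
have topT x : x \in T -> top_pair x.1 x.2 by case: x => al s /hT.
have expT x : x \in T -> is_exponent A beta w (pt x).
  by move=> xT; have [pl Aa] := hpt x xT; apply: pair_exponent (topT x xT) pl Aa.
(* The pair is recovered from its exponent: the face is the set of non-integral coordinates, and
   [al] consists of the others, extended by 0. *)
have pt_inj x y : x \in T -> y \in T -> pt x = pt y -> x = y.
  move=> xT yT xy; have [plx Ax] := hpt x xT; have [ply Ay] := hpt y yT.
  have [_ noint _] := hbeta.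
  have mem z : z \in T -> forall i, (i \in z.2) = ~~ `[< exists k : int, pt z i 0 = k%:~R >].
    move=> zT i; have [pl Aa] := hpt z zT; apply/idP/asboolPn => [iz|nz].
      by apply: (noint (pt z) z.1 z.2 (expT z zT)) => //; split=> //; apply: topT.
    apply: contrapT => /negP iz; apply: nz; exists (z.1 i : int).
    by rewrite pl.
  have s_eq : x.2 = y.2 by apply/setP => i; rewrite !mem // xy.
  have al_eq : x.1 = y.1.
    apply/mnmP => i; have [ix|ix] := boolP (i \in x.2).
      have [zx _] := standard_pair_standard (topT x xT).1.
      have [zy _] := standard_pair_standard (topT y yT).1.
      by rewrite zx // zy // -s_eq.
    by apply/eqP; rewrite -(eqr_nat C) -plx // -ply ?xy // -s_eq.
  by case: x y s_eq al_eq {xT yT xy plx Ax ply Ay} => [? ?] [? ?] /= -> ->.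
pose x := tnth (in_tuple T).
have xT i : x i \in T by apply: mem_tnth.
have x_inj : injective x by apply/tuple_uniqP.
pose b i := lattice_series (pt (x i)) (F (x i)).
have bi i : b i (pt (x i)) = (F (x i) 0)%:MP.
  by rewrite -[RHS](lattice_seriesE (pt (x i)) (F (x i)) 0) map_mx0 addr0.
(* Distinct exponents lie in distinct cosets of Z^n, so evaluation at the exponents is diagonal on
   these series. *)
have bij i j : j != i -> b j (pt (x i)) = 0.
  move=> ji; apply: lattice_series_out => u E; have [_ _ hdiff] := hbeta.
  apply: (hdiff _ _ (expT _ (xT i)) (expT _ (xT j))).
    by move=> /(pt_inj _ _ (xT i) (xT j))/x_inj ij; rewrite ij eqxx in ji.
  by exists u; rewrite E addrAC subrr add0r.
exists b; split=> [c cb i|f].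
  have := cb (pt (x i)); rewrite (bigD1 i) //= big1 ?addr0 => [|j ji]; last first.
    by rewrite bij ?scaler0.
  have [_ F0 _] := hF _ (xT i).
  rewrite bi -mul_mpolyC -mpolyCM => /eqP; rewrite mpolyC_eq0 mulf_eq0 (negPf F0) orbF.
  by move/eqP.
split=> [[N [c [psi [psib fE]]]]|[c fE]]; last first.
  exists (size T), c, b; split=> // i; apply: canonical_basic hw _; exact: hF.
have /choice[idx hidx] : forall k, exists i : 'I_(size T) * C, forall t, psi k t = i.2 *: b i.1 t.
  move=> k; have [al [s [a [tp pl Aa hpsi]]]] := basic_nilsson_canonical (psib k).
  have alT : (al, s) \in T by apply/hT.
  have [i xi] : exists i, x i = (al, s) by have /tnthP[i ->] : (al, s) \in in_tuple T by []; exists i.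
  have aE : a = pt (x i).
    have [pl' Aa'] := hpt _ (xT i); rewrite xi /= in pl' Aa'.
    by rewrite xi; apply: (top_pair_unique hw hA tp pl pl'); rewrite Aa Aa'.
  have [|c' hc'] := hpsi (F (x i)); first by rewrite aE; apply: hF.
  by exists (i, c') => t; rewrite hc' aE.
exists (fun i => \sum_(k | (idx k).1 == i) c k * (idx k).2) => t; rewrite fE.
under [RHS]eq_bigr do rewrite scaler_suml.
rewrite (exchange_big_dep predT) //=; apply: eq_bigr => k _.
by rewrite (big_pred1 (idx k).1) ?hidx ?scalerA // => i; rewrite eq_sym.
Qed.

End GenericNilsson.

Unset Implicit Arguments.

Theorem corollary4p9 (R : realType) (d n : nat) (A : 'M[int]_(d, n))
    (beta : 'cV[R[i]]_d) (w : 'cV[R]_n) (beta0 : R[i])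
    (hA : columns_generate A)
    (hw : weight_vector A beta w)
    (hbeta : generic_parameter A beta w)
    (hbeta0 : homogenizing_value A beta w beta0)
    (hrho : weight_vector (rho A) (col_mx beta0%:M beta) (rho_weight w)) :
  has_dimension (nilsson_space A beta w)
    (\sum_(s : {set 'I_(1 + n)} | `[< facet A (rho_weight w) s >] && (ord0 \in s))
       simplex_volume A s).
Proof. exact: nilsson_space_dimension hw hA hbeta. Qed.
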